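(* Let $k\ge2$ be a fixed integer (independent of $n$) and let $N(\mathcal K_k)$ be the total number of $k$-cliques in the geometric inhomogeneous random graph on $n$ vertices. (i) If $k>\frac{2}{3-\tau}$, then, as $n\to\infty$, $$\frac{N(\mathcal K_k)}{n^{(3-\tau)k/2}}\ \stackrel{p}{\longrightarrow}\ \frac{J^{\mathrm{NG}}}{\mu^{(\tau-1)k/2}\,k!}<\infty.$$ (ii) If $k<\frac{2}{3-\tau}$, then, as $n\to\infty$, $$\frac{N(\mathcal K_k)}{n}\ \stackrel{p}{\longrightarrow}\ \frac{J^{\mathrm{G}}}{\mu^{1-k}\,k!}<\infty.$$ Here $$J^{\mathrm{NG}}=\int_0^\infty dy_1\cdots\int_0^\infty dy_k\int_{[0,1]^d}dx_1\cdots\int_{[0,1]^d}dx_k\,(y_1\cdots y_k)^{-\tau}\prod_{1\le i<j\le k}\min\Big\{1,\Big(\frac{y_iy_j}{\|x_i-x_j\|^d}\Big)^\gamma\Big\},$$ $$J^{\mathrm{G}}=\int_{w_0}^\infty dw_1\cdots\int_{w_0}^\infty dw_k\int_{\mathbb R^d}dz_2\cdots\int_{\mathbb R^d}dz_k\,(w_1\cdots w_k)^{-\tau}\prod_{1\le i<j\le k}\min\Big\{1,\Big(\frac{w_iw_j}{\|z_i-z_j\|^d}\Big)^\gamma\Big\},$$ with $z_1=0$; in $J^{\mathrm{NG}}$ the norm is the torus $\infty$-norm, and in $J^{\mathrm G}$ it is the usual $\infty$-norm on $\mathbb R^d$.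
   Context: Geometric inhomogeneous random graph (GIRG). Fix $\tau\in(2,3)$, $w_0>0$, $\gamma>1$ and an integer $d\ge1$. For $n\in\mathbb N$ the vertex set is $V=\{1,\dots,n\}$. Each vertex $i$ has a weight $\mathrm w_i$ and a position $\mathrm x_i$, all independent. The weights are i.i.d. Pareto: $\mathbb P(\mathrm w>w)=(w_0/w)^{\tau-1}$ for $w\ge w_0$, i.e. with density $(\tau-1)w_0^{\tau-1}w^{-\tau}$ on $[w_0,\infty)$ and mean $\mu=\mathbb E[\mathrm w]=\frac{\tau-1}{\tau-2}w_0$. The positions are i.i.d. uniform on the torus $\mathbb T^d=\mathbb R^d/\mathbb Z^d$ (identified with $[0,1)^d$). Conditionally on weights and positions, each pair of distinct vertices $u,v$ is joined by an edge independently with probability $$p_{uv}=\min\Big\{\Big(\frac{\mathrm w_u\mathrm w_v}{n\mu\|\mathrm x_u-\mathrm x_v\|^d}\Big)^\gamma,1\Big\},$$ where the torus $\infty$-norm is $\|x-y\|=\max_{1\le h\le d}|x^{(h)}-y^{(h)}|_C$ with $|a-b|_C=\min\{|a-b|,1-|a-b|\}$. A $k$-clique $\mathcal K_k$ is a set of $k$ vertices that are pairwise connected; $N(\mathcal K_k)$ counts $k$-element subsets of $V$ that are $k$-cliques. $\stackrel{p}{\to}$ denotes convergence in probability.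
   Formalization: The printed limit constants are false for the stated Pareto density; both limits are corrected by the factor ((τ−1)w_0^{τ−1})^k, and in (ii) the denominator μ^{1−k} k! is replaced by μ^{k−1} k!. *)

(* Defs.v *)
From HB Require Import structures.
From mathcomp Require Import all_boot all_order all_algebra.
From mathcomp Require Import all_classical all_reals all_analysis.
Set Implicit Arguments.
Unset Strict Implicit.
Unset Printing Implicit Defensive.
Import Order.TTheory GRing.Theory Num.Theory.
Import numFieldNormedType.Exports.
Local Open Scope classical_set_scope.
Local Open Scope ring_scope.

(* A point of R^d is a [d.-tuple R]; this type carries the product
   sigma-algebra. *)
Definition linf_dist (R : realType) (d : nat) (x y : d.-tuple R) : R :=
  \big[Num.max/0]_(h < d) `|tnth x h - tnth y h|.

Definition circle_dist (R : realType) (a b : R) : R :=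
  Num.min `|a - b| (1 - `|a - b|).

Definition torus_dist (R : realType) (d : nat) (x y : d.-tuple R) : R :=
  \big[Num.max/0]_(h < d) circle_dist (tnth x h) (tnth y h).

(* min {(a / r)^g, 1}.  The case r = 0 is singled out because a / 0 = 0 in
   MathComp, whereas two vertices at distance 0 are joined with probability 1. *)
Definition conn (R : realType) (g a r : R) : R :=
  if r == 0 then 1 else Num.min ((a / r) `^ g) 1.

(* The Pareto density is pareto_const * w^-tau on [w0, +oo[.  The integrals J_NG
   and J_G below carry the bare w^-tau for each of the k weights, so the limit
   of the rescaled clique count carries the factor pareto_const ^+ k. *)
Definition pareto_const (R : realType) (tau w0 : R) : R :=
  (tau - 1) * w0 `^ (tau - 1).

(* The mean of the Pareto weight distribution. *)
Definition pareto_mean (R : realType) (tau w0 : R) : R :=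
  (tau - 1) / (tau - 2) * w0.

Definition edge_prob (R : realType) (tau w0 g : R) (d n : nat)
    (wu wv : R) (xu xv : d.-tuple R) : R :=
  conn g (wu * wv) (n%:R * pareto_mean tau w0 * torus_dist xu xv ^+ d).

(* A geometric inhomogeneous random graph with vertex set 'I_n, realised on an
   arbitrary probability space (Omega, P). *)
Record girg (R : realType) (tau w0 g : R) (d n : nat)
    (disp : measure_display) (Omega : measurableType disp)
    (P : probability Omega R) := Girg {
  weight : 'I_n -> {RV P >-> R};
  position : 'I_n -> {RV P >-> d.-tuple R};
  adj : Omega -> rel 'I_n;
  weight_pareto : forall (i : 'I_n) (w : R), w0 <= w ->
    P [set om | w < weight i om] = ((w0 / w) `^ (tau - 1))%:E;
  (* uniform on [0,1)^d, expressed on the generating boxes *)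
  position_uniform : forall (i : 'I_n) (A : 'I_d -> set R),
    (forall h, measurable (A h)) ->
    P [set om | forall h, A h (tnth (position i om) h)] =
    (\prod_(h < d) lebesgue_measure (A h `&` `[0%R, 1%R[))%E;
  (* mutual independence of all weights and all positions (subfamilies are
     obtained by taking some of the sets to be setT) *)
  weight_position_indep : forall (A : 'I_n -> set R) (B : 'I_n -> set (d.-tuple R)),
    (forall i, measurable (A i)) -> (forall i, measurable (B i)) ->
    P [set om | forall i, A i (weight i om) /\ B i (position i om)] =
    (\prod_(i < n) (P [set om | A i (weight i om)] *
                    P [set om | B i (position i om)]))%E;
  adj_sym : forall om, symmetric (adj om);
  adj_irrefl : forall om, irreflexive (adj om);
  adj_measurable : forall u v : 'I_n, measurable [set om | adj om u v];
  (* Given the sigma-algebra generated by all weights and positions, the edge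
     indicators of the unordered pairs {u, v} (represented with u < v) are
     independent with success probabilities p_uv: product rule for the
     conditional probabilities of every subfamily S, in integrated form. *)
  adj_cond : forall (S : {set 'I_n * 'I_n})
      (B : set (n.-tuple R * n.-tuple (d.-tuple R))),
    (forall e, e \in S -> (e.1 < e.2)%N) ->
    measurable B ->
    let D := [set om | B ([tuple weight i om | i < n],
                          [tuple position i om | i < n])] in
    P (D `&` [set om | forall e, e \in S -> adj om e.1 e.2]) =
    (\int[P]_(om in D)
      (\prod_(e in S) edge_prob tau w0 g n (weight e.1 om) (weight e.2 om)
                        (position e.1 om) (position e.2 om))%:E)%E }.

Definition nb_cliques (n k : nat) (e : rel 'I_n) : nat :=
  #|[set K : {set 'I_n} | (#|K| == k) &&
      [forall u in K, forall v in K, (u != v) ==> e u v]]|.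

Definition cvg_in_prob (R : realType) (disp : nat -> measure_display)
    (Omega : forall n, measurableType (disp n))
    (P : forall n, probability (Omega n) R)
    (Z : forall n, Omega n -> R) (c : R) : Prop :=
  forall eps : R, 0 < eps ->
    (fun n => P n [set om | eps < `|Z n om - c|]) @ \oo --> 0%E.

(* I (fun t_1 => I (fun t_2 => ... I (fun t_k => F (t_1, ..., t_k)) ...)) *)
Fixpoint iter_int (R : realType) (T : Type) (I : (T -> \bar R) -> \bar R)
    (k : nat) : (k.-tuple T -> \bar R) -> \bar R :=
  match k with
  | 0 => fun F => F [tuple]
  | k'.+1 => fun F => I (fun t => iter_int I (fun s : k'.-tuple T => F [tuple of t :: s]))
  end.

Definition int_on (R : realType) (D : set R) (f : R -> \bar R) : \bar R :=
  (\int[lebesgue_measure]_(x in D) f x)%E.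

(* d-dimensional Lebesgue integral over D^d, as an iterated integral *)
Definition int_cube (R : realType) (D : set R) (d : nat) :
  (d.-tuple R -> \bar R) -> \bar R := iter_int (int_on D) (k := d).

Definition J_integrand (R : realType) (tau g : R) (d k : nat)
    (dist : d.-tuple R -> d.-tuple R -> R)
    (y : k.-tuple R) (x : k.-tuple (d.-tuple R)) : \bar R :=
  ((\prod_(i < k) tnth y i) `^ (- tau) *
   \prod_(i < k) \prod_(j < k | (i < j)%N)
      conn g (tnth y i * tnth y j) (dist (tnth x i) (tnth x j) ^+ d))%:E.

Definition J_NG (R : realType) (tau g : R) (d k : nat) : \bar R :=
  iter_int (int_on `]0, +oo[) (fun y : k.-tuple R =>
    iter_int (@int_cube R `[0, 1] d) (fun x : k.-tuple (d.-tuple R) =>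
      J_integrand tau g (@torus_dist R d) y x)).

(* The first point z_1 is the origin, so only k - 1 positions are integrated.
   This is meant for 0 < k, for which k.-1.+1 is k. *)
Definition J_G (R : realType) (tau w0 g : R) (d k : nat) : \bar R :=
  iter_int (int_on `[w0, +oo[) (fun w : k.-1.+1.-tuple R =>
    iter_int (@int_cube R setT d) (fun z : k.-1.-tuple (d.-tuple R) =>
      J_integrand tau g (@linf_dist R d) w
        [tuple of [tuple 0 | _ < d] :: z])).

(* Main.v *)
Require Import Defs.
From HB Require Import structures.
From mathcomp Require Import all_boot all_order all_algebra.
From mathcomp Require Import all_classical all_reals all_analysis.
From mathcomp Require Import measurable_realfun.
From mathcomp Require Import ring lra zify.

(** The proof is a truncated second moment argument; write mu for the mean
    weight and a for n mu.

    Means. Weights and positions of distinct vertices are i.i.d.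
    ([vertices_law]), so the mean number of k-cliques is the binomial
    coefficient C(n, k) times an integral over k weights of the probability
    [torus_clique] that k vertices with these weights, uniformly placed on the
    torus, form a clique ([clique_probE]). Two scales compete in this integral.
    If the weights are bounded, the vertices of a clique lie within distance
    a^(-1/d) of each other; blowing up the torus by a^(1/d) around one of them
    replaces it by R^d, and the integral behaves like a^(1 - k) J_G
    ([geometric_limit]). If the weights are sqrt(a) y, then edge probabilities
    do not depend on n, and the integral behaves like a^((1 - tau) k / 2) J_NG
    ([nongeometric_limit]). Both limits are instances of dominated convergence.
    The dominating function comes from keeping, among the edges of a clique,
    only the star centred at the vertex of least weight ([le_argmin_bound]):
    over a star the positions can be integrated one vertex at a time, and then
    so can the weights. What remains is the integral of a power of the least
    weight s, namely s^((3 - tau) k - 3), which is finite at infinity when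
    (3 - tau) k < 2 and at 0 when (3 - tau) k > 2. This is where the two cases
    separate.

    Concentration. Cliques without a common vertex are independent, so the
    variance of the count is at most the expected number of ordered pairs of
    cliques with a common vertex ([clique_variance_le]). To control it, only the
    cliques with all weights in a set B_n are counted. The truncation keeps the
    mean up to a smaller order, because the limits of the means above do not
    depend on it; hence the removed cliques are negligible by Markov's
    inequality, and the remaining count concentrates by Chebyshev's inequality
    ([cvg_in_prob_truncation]).

    When (3 - tau) k < 2, the set B_n consists of the weights at most
    a^(1/(4k)). Two cliques with a common vertex contain a spanning star of
    their union U, and this star has probability at most a small power of n
    times n^(1 - |U|). When (3 - tau) k > 2, the set B_n consists of the
    weights above a^e with e slightly below 1/2. There are so few such vertices that the number of pairs of k-subsets
    with a common vertex, of order (number of vertices)^(2k - 1), is already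
    small enough. *)

Set Implicit Arguments.
Unset Strict Implicit.
Unset Printing Implicit Defensive.
Import Order.TTheory GRing.Theory Num.Theory.
Import numFieldNormedType.Exports.
Local Open Scope classical_set_scope.
Local Open Scope ring_scope.

(** * Powers of a sigma-finite measure *)

Lemma measurable_fun_comp2 d d1 d2 d3 (S : measurableType d)
    (T1 : measurableType d1) (T2 : measurableType d2) (T3 : measurableType d3)
    (F : T1 -> T2 -> T3) (f : S -> T1) (g : S -> T2) :
  measurable_fun setT (fun z : T1 * T2 => F z.1 z.2) ->
  measurable_fun setT f -> measurable_fun setT g ->
  measurable_fun setT (fun x => F (f x) (g x)).
Proof.
move=> mF mf mg.
apply: (@measurableT_comp _ _ _ _ _ _ _ _ (fun x => (f x, g x)) mF).
exact: measurable_fun_pair.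
Qed.

Section IterInt.
Local Open Scope ereal_scope.
Context {R : realType} {d : measure_display} {T : measurableType d}.

(** A map from pairs to tuples, along which the product with one more factor is
    pushed forward: this keeps all the powers of a measure on tuple types. *)
Definition cons_pair n (z : T * n.-tuple T) : n.+1.-tuple T :=
  [the n.+1.-tuple T of z.1 :: z.2].

Lemma measurable_cons_pair n : measurable_fun setT (@cons_pair n).
Proof. exact: measurable_cons. Qed.

Section MCons.
Variables (n : nat) (m : {sigma_finite_measure set T -> \bar R})
  (M : {sigma_finite_measure set (n.-tuple T) -> \bar R}).

Definition mcons : set (n.+1.-tuple T) -> \bar R :=
  pushforward (m \x M) (@cons_pair n).

HB.instance Definition _ := Measure.copy mcons
  (measure_function_pushforward__canonical__measure_function_Measure
    (m \x M) (@measurable_cons_pair n)).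

Let mcons_sigma_finite : sigma_finite setT mcons.
Proof.
have /sigma_finiteP[G [GT ndG Goo]] := sigma_finiteT M.
have /sigma_finiteP[F' [F'T ndF F'oo]] := sigma_finiteT m.
exists (fun i => [set t | F' i (thead t) /\ G i [tuple of behead t]]).
  apply/seteqP; split => // t _.
  have [i _ Fi] : (\bigcup_i F' i) (thead t) by rewrite -F'T.
  have [j _ Gj] : (\bigcup_i G i) [tuple of behead t] by rewrite -GT.
  exists (maxn i j) => //; split.
    by move: Fi; exact/subsetPset/ndF/leq_maxl.
  by move: Gj; exact/subsetPset/ndG/leq_maxr.
move=> i; have [mF Fi] := F'oo i; have [mG Gi] := Goo i; split.
  apply: measurableI; rewrite -[X in measurable X]setTI.
    exact: measurable_tnth.
  exact: measurable_behead.
rewrite /mcons /pushforward.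
suff -> : @cons_pair n @^-1` [set t | F' i (thead t) /\ G i [tuple of behead t]]
    = F' i `*` G i.
  by rewrite product_measure1E// lte_mul_pinfty// ge0_fin_numE.
apply/seteqP; split => -[x t]; rewrite /preimage /= theadE /=;
 (suff -> : [tuple of behead (cons_pair (x, t))] = t by []); exact/val_inj.
Qed.

HB.instance Definition _ := Measure_isSigmaFinite.Build _ _ _ mcons
  mcons_sigma_finite.

Lemma integral_mcons (f : n.+1.-tuple T -> \bar R) :
  measurable_fun setT f -> (forall t, 0 <= f t) ->
  \int[mcons]_t f t = \int[m]_x \int[M]_t f [tuple of x :: t].
Proof.
move=> mf f0.
have mfc : measurable_fun setT (f \o @cons_pair n).
  by apply: (measurableT_comp mf); exact: measurable_cons_pair.
rewrite ge0_integral_pushforward//; last exact: measurable_cons_pair.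
rewrite preimage_setT.
by apply: (@fubini_tonelli1 _ _ _ _ _ m M (f \o @cons_pair n)) => // z; exact: f0.
Qed.

End MCons.

(** The n-fold power of a measure. It is built one coordinate at a time, like
    the iterated integrals of [iter_int], so that Tonelli's theorem turns the
    latter into integrals to which the convergence theorems apply. *)
Fixpoint mprod (m : {sigma_finite_measure set T -> \bar R}) (n : nat) :
    {sigma_finite_measure set (n.-tuple T) -> \bar R} :=
  match n with
  | 0 => \d_([tuple] : 0.-tuple T)
  | n'.+1 => mcons m (mprod m n')
  end.

Lemma integral_mprod0 (m : {sigma_finite_measure set T -> \bar R})
    (f : 0.-tuple T -> \bar R) : measurable_fun setT f ->
  \int[mprod m 0]_t f t = f [tuple].
Proof. by move=> mf; rewrite integral_dirac// diracT mul1e. Qed.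

Lemma integral_mprodS (m : {sigma_finite_measure set T -> \bar R}) n
    (f : n.+1.-tuple T -> \bar R) :
  measurable_fun setT f -> (forall t, 0 <= f t) ->
  \int[mprod m n.+1]_t f t =
  \int[m]_x \int[mprod m n]_t f [tuple of x :: t].
Proof. exact: integral_mcons. Qed.

Lemma measurable_fun_cons1 d' (S : measurableType d') n
    (f : n.+1.-tuple T -> S) (x : T) :
  measurable_fun setT f ->
  measurable_fun setT (fun t : n.-tuple T => f [tuple of x :: t]).
Proof.
move=> mf; apply: (measurableT_comp mf); exact: (@measurable_cons _ _ _ _ (cst x)).
Qed.

Lemma measurable_integral_param d' (S : measurableType d') d2
    (T2 : measurableType d2)
    (m : {sigma_finite_measure set T2 -> \bar R}) (F : S -> T2 -> \bar R) :
  measurable_fun setT (fun z : S * T2 => F z.1 z.2) ->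
  (forall s t, 0 <= F s t) ->
  measurable_fun setT (fun s => \int[m]_t F s t).
Proof.
move=> mF F0.
exact: (@measurable_fun_fubini_tonelli_F _ _ _ _ _ m (fun z => F z.1 z.2)).
Qed.

Lemma measurable_integral_mprod_cons (m : {sigma_finite_measure set T -> \bar R}) n
    (f : n.+1.-tuple T -> \bar R) :
  measurable_fun setT f -> (forall t, 0 <= f t) ->
  measurable_fun setT (fun x => \int[mprod m n]_t f [tuple of x :: t]).
Proof.
move=> mf f0; apply: measurable_integral_param => //.
apply: (measurableT_comp mf); exact: measurable_cons_pair.
Qed.

Lemma measurable_eprod d' (S : measurableType d') (I : Type) (s : seq I)
    (P : pred I) (f : I -> S -> \bar R) :
  (forall i, measurable_fun setT (f i)) ->
  measurable_fun setT (fun x => \prod_(i <- s | P i) f i x).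
Proof.
move=> mf; elim: s => [|i s IH].
  by under eq_fun do rewrite big_nil; exact: measurable_cst.
under eq_fun do rewrite big_cons; case: (P i) => //.
exact: emeasurable_funM.
Qed.

Lemma measurable_tnth_comp d' (S : measurableType d') n (i : 'I_n) (f : T -> S) :
  measurable_fun setT f -> measurable_fun setT (fun t : n.-tuple T => f (tnth t i)).
Proof. by move=> mf; apply: (measurableT_comp mf); exact: measurable_tnth. Qed.

Lemma integral_mprod_prod (m : {sigma_finite_measure set T -> \bar R}) n
    (f : 'I_n -> T -> \bar R) :
  (forall i, measurable_fun setT (f i)) -> (forall i x, 0 <= f i x) ->
  \int[mprod m n]_t (\prod_(i < n) f i (tnth t i)) =
  \prod_(i < n) \int[m]_x f i x.
Proof.
elim: n f => [|n IH] f mf f0.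
  rewrite integral_mprod0 ?big_ord0//.
  by apply: measurable_eprod => i; exact: measurable_tnth_comp.
rewrite integral_mprodS; last 2 first.
- by apply: measurable_eprod => i; exact: measurable_tnth_comp.
- by move=> t; apply: prode_ge0.
rewrite big_ord_recl -ge0_integralZr//; last first.
  by apply: prode_ge0 => i _; apply: integral_ge0.
apply: eq_integral => x _; rewrite -IH//.
rewrite -ge0_integralZl//; last 2 first.
- by apply: measurable_eprod => i; exact: measurable_tnth_comp.
- by move=> t _; apply: prode_ge0.
apply: eq_integral => t _; rewrite big_ord_recl tnth0; congr (_ * _).
by apply: eq_bigr => i _; rewrite tnthS.
Qed.

Lemma prod_lift0 (n : nat) (p : 'I_n) (F : 'I_n.+1 -> \bar R) :
  \prod_(j < n.+1 | j != lift ord0 p) F j =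
  F ord0 * \prod_(j < n | j != p) F (lift ord0 j).
Proof.
rewrite big_mkcond big_ord_recl/=; congr (_ * _).
by rewrite [RHS]big_mkcond; apply: eq_bigr => j _; rewrite (inj_eq lift_inj).
Qed.

Lemma prod_neq0 (n : nat) (F : 'I_n.+1 -> \bar R) :
  \prod_(j < n.+1 | j != ord0) F j = \prod_(j < n) F (lift ord0 j).
Proof.
by rewrite big_mkcond big_ord_recl/= mul1e; apply: eq_bigr.
Qed.

(** Given the pivot coordinate [tnth t p], the other coordinates are
    independent, so a product over the star centred at p factorises. All the
    upper bounds on cliques below reduce a clique to one of its spanning stars
    and then use this identity. *)
Lemma integral_mprod_pivot (m : {sigma_finite_measure set T -> \bar R}) n
    (p : 'I_n) (psi : T -> \bar R) (phi : 'I_n -> T -> T -> \bar R) :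
  measurable_fun setT psi -> (forall x, 0 <= psi x) ->
  (forall j, measurable_fun setT (fun z : T * T => phi j z.1 z.2)) ->
  (forall j x y, 0 <= phi j x y) ->
  \int[mprod m n]_t (psi (tnth t p) *
     \prod_(j < n | j != p) phi j (tnth t p) (tnth t j)) =
  \int[m]_x (psi x * \prod_(j < n | j != p) \int[m]_y phi j x y).
Proof.
elim: n p psi phi => [[]//|n IH] p psi phi mpsi psi0 mphi phi0.
have mphi1 j x : measurable_fun setT (phi j x).
  exact: (measurable_fun_comp2 (f := cst x) (mphi j)).
have mint j : measurable_fun setT (fun x => \int[m]_y phi j x y).
  exact: measurable_integral_param.
rewrite integral_mprodS; last 2 first.
- apply: emeasurable_funM; first exact: measurable_tnth_comp.
  apply: measurable_eprod => j.
  by apply: measurable_fun_comp2 => //; exact: measurable_tnth.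
- by move=> t; rewrite mule_ge0//; apply: prode_ge0.
have [->|] := eqVneq p ord0; last (rewrite eq_sym => /unlift_some[q -> _]).
  apply: eq_integral => x _; rewrite prod_neq0.
  rewrite -integral_mprod_prod//.
  rewrite -ge0_integralZl//; last 2 first.
  - by apply: measurable_eprod => i; exact: measurable_tnth_comp.
  - by move=> t _; apply: prode_ge0.
  apply: eq_integral => t _; rewrite prod_neq0 tnth0; congr (_ * _).
  by apply: eq_bigr => i _; rewrite tnthS.
transitivity (\int[m]_x \int[m]_y (psi y * phi ord0 y x *
    \prod_(j < n | j != q) \int[m]_z phi (lift ord0 j) y z)).
  apply: eq_integral => x _.
  rewrite -(IH q (fun y => psi y * phi ord0 y x) (fun j => phi (lift ord0 j)))//.
  - apply: eq_integral => t _; rewrite prod_lift0 tnth0 tnthS muleA.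
    by congr (_ * _); apply: eq_bigr => i _; rewrite tnthS.
  - apply: emeasurable_funM => //.
    exact: measurable_fun_comp2.
  - by move=> y; rewrite mule_ge0.
have mF : measurable_fun setT (fun z : T * T => psi z.2 * phi ord0 z.2 z.1 *
    \prod_(j < n | j != q) \int[m]_t phi (lift ord0 j) z.2 t).
  apply: emeasurable_funM; first apply: emeasurable_funM.
  - exact: measurableT_comp.
  - exact: measurable_fun_comp2.
  - apply: measurable_eprod => j.
    exact: (measurableT_comp (mint (lift ord0 j))).
rewrite (@fubini_tonelli _ _ _ _ _ m m _ mF); last first.
  move=> z; rewrite mule_ge0// ?mule_ge0//; apply: prode_ge0 => j _.
  exact: integral_ge0.
apply: eq_integral => y _ /=; rewrite prod_lift0.
rewrite ge0_integralZr//; last 3 first.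
- exact: emeasurable_funM.
- by move=> x _; rewrite mule_ge0.
- by apply: prode_ge0 => j _; exact: integral_ge0.
by rewrite ge0_integralZl// muleA.
Qed.

End IterInt.

Section MoreIterInt.
Local Open Scope ereal_scope.
Context {R : realType}.

Lemma measurable_mktuple d d' (S : measurableType d) (T : measurableType d') n
    (f : 'I_n -> S -> T) : (forall i, measurable_fun setT (f i)) ->
  measurable_fun setT (fun x => [tuple f i x | i < n]).
Proof.
move=> mf; apply/measurable_fun_tnthP => i.
by rewrite (_ : _ \o _ = f i)//; apply/funext => x /=; rewrite tnth_mktuple.
Qed.

Lemma mktuple_cons T n (f : 'I_n.+1 -> T) :
  [tuple f i | i < n.+1] = [tuple of f ord0 :: [tuple f (lift ord0 i) | i < n]].
Proof.
apply: eq_from_tnth => i; rewrite tnth_mktuple.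
by case: (unliftP ord0 i) => [j ->|->]; rewrite ?tnth0// tnthS tnth_mktuple.
Qed.

Lemma eq_tuple_cons T n (x y : T) (s t : n.-tuple T) :
  x = y -> s = t -> [tuple of x :: s] = [tuple of y :: t].
Proof. by move=> -> ->. Qed.

Lemma tnth_tuple_eta T n (t : n.-tuple T) : [tuple tnth t i | i < n] = t.
Proof. by apply: eq_from_tnth => i; rewrite tnth_mktuple. Qed.

(** Coordinatewise change of variables: a one-dimensional rule (density h,
    substitution phi) that holds on each coordinate holds for the power. It is
    used for the dilation of weights, for the rescaling of positions around a
    base point and for the passage to the Pareto density. *)
Lemma integral_mprod_subst d d' (T : measurableType d) (T' : measurableType d')
    (m : {sigma_finite_measure set T -> \bar R})
    (m' : {sigma_finite_measure set T' -> \bar R}) n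
    (h : 'I_n -> T' -> \bar R) (phi : 'I_n -> T' -> T) :
  (forall i, measurable_fun setT (h i)) -> (forall i x, 0 <= h i x) ->
  (forall i, measurable_fun setT (phi i)) ->
  (forall i (f : T -> \bar R), measurable_fun setT f -> (forall x, 0 <= f x) ->
     \int[m]_x f x = \int[m']_x (h i x * f (phi i x))) ->
  forall F : n.-tuple T -> \bar R, measurable_fun setT F -> (forall t, 0 <= F t) ->
  \int[mprod m n]_t F t =
  \int[mprod m' n]_t ((\prod_(i < n) h i (tnth t i)) *
                      F [tuple phi i (tnth t i) | i < n]).
Proof.
elim: n h phi => [|n IH] h phi mh h0 mphi hphi F mF F0.
  rewrite !integral_mprod0//.
    by rewrite big_ord0 mul1e [in RHS]tuple0.
  apply: emeasurable_funM.
    by apply: measurable_eprod => i; exact: measurable_tnth_comp.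
  apply: (measurableT_comp mF); apply: measurable_mktuple => i.
  exact: measurable_tnth_comp.
have mI : measurable_fun setT (fun t : n.+1.-tuple T' =>
    (\prod_(i < n.+1) h i (tnth t i)) * F [tuple phi i (tnth t i) | i < n.+1]).
  apply: emeasurable_funM.
    by apply: measurable_eprod => i; exact: measurable_tnth_comp.
  apply: (measurableT_comp mF); apply: measurable_mktuple => i.
  exact: measurable_tnth_comp.
rewrite [RHS]integral_mprodS//; last first.
  by move=> t; rewrite mule_ge0//; apply: prode_ge0.
rewrite integral_mprodS// (hphi ord0)//; last 2 first.
- exact: measurable_integral_mprod_cons.
- by move=> x; exact: integral_ge0.
apply: eq_integral => x _.
rewrite (IH (fun i => h (lift ord0 i)) (fun i => phi (lift ord0 i)))//; last first.
- exact: measurable_fun_cons1.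
- by move=> i; exact: hphi.
rewrite -ge0_integralZl//; last 2 first.
- apply: emeasurable_funM.
    by apply: measurable_eprod => i; exact: measurable_tnth_comp.
  apply: (measurableT_comp (measurable_fun_cons1 (phi ord0 x) mF)).
  by apply: measurable_mktuple => i; exact: measurable_tnth_comp.
- by move=> t _; rewrite mule_ge0//; apply: prode_ge0.
apply: eq_integral => t _; rewrite big_ord_recl mktuple_cons tnth0 muleA.
congr (_ * _ * F _); first by apply: eq_bigr => i _; rewrite tnthS.
apply: eq_tuple_cons => //.
by apply: eq_from_tnth => i; rewrite !tnth_mktuple tnthS.
Qed.

(** The power of a product is the product of the powers; this separates the
    weights of a tuple of vertices from their positions. *)
Lemma integral_mprod_zip d1 d2 (T1 : measurableType d1) (T2 : measurableType d2)
    (m1 : {sigma_finite_measure set T1 -> \bar R})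
    (m2 : {sigma_finite_measure set T2 -> \bar R})
    (nu : {sigma_finite_measure set (T1 * T2)%type -> \bar R}) n :
  (forall f : T1 * T2 -> \bar R, measurable_fun setT f -> (forall x, 0 <= f x) ->
     \int[nu]_z f z = \int[m1]_x \int[m2]_y f (x, y)) ->
  forall F : n.-tuple (T1 * T2) -> \bar R,
  measurable_fun setT F -> (forall t, 0 <= F t) ->
  \int[mprod nu n]_t F t =
  \int[mprod m1 n]_xs \int[mprod m2 n]_ys
     F [tuple (tnth xs i, tnth ys i) | i < n].
Proof.
move=> nuE; elim: n => [|n IH] F mF F0.
  rewrite !integral_mprod0//; first by congr F; rewrite [RHS]tuple0.
    apply: (measurableT_comp mF); apply: measurable_mktuple => i.
    by apply: measurable_fun_pair => //; exact: measurable_tnth.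
  apply: measurable_integral_param => //.
  apply: (measurableT_comp mF); apply: measurable_mktuple => i.
  apply: measurable_fun_pair.
    exact: (measurableT_comp (measurable_tnth i) measurable_fst).
  exact: (measurableT_comp (measurable_tnth i) measurable_snd).
have mzip k : measurable_fun setT (fun z : k.-tuple T1 * k.-tuple T2 =>
    [tuple (tnth z.1 i, tnth z.2 i) | i < k]).
  apply: measurable_mktuple => i.
  apply: measurable_fun_pair.
    exact: (measurableT_comp (measurable_tnth i) measurable_fst).
  exact: (measurableT_comp (measurable_tnth i) measurable_snd).
have mG k (H : k.-tuple (T1 * T2) -> \bar R) : measurable_fun setT H ->
    measurable_fun setT (fun z : k.-tuple T1 * k.-tuple T2 =>
      H [tuple (tnth z.1 i, tnth z.2 i) | i < k]).
  by move=> mH; exact: (measurableT_comp mH (mzip k)).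
rewrite integral_mprodS// nuE; last 2 first.
- exact: measurable_integral_mprod_cons.
- by move=> z; exact: integral_ge0.
rewrite [RHS]integral_mprodS; last 2 first.
- by apply: measurable_integral_param => //; exact: mG.
- by move=> t; exact: integral_ge0.
apply: eq_integral => x _.
transitivity (\int[m2]_y \int[mprod m1 n]_xs \int[mprod m2 n]_ys
    F [tuple of (x, y) :: [tuple (tnth xs i, tnth ys i) | i < n]]).
  apply: eq_integral => y _.
  rewrite (IH (fun t => F [tuple of (x, y) :: t]))//.
  exact: measurable_fun_cons1.
have mH : measurable_fun setT (fun z : T2 * n.-tuple T1 * n.-tuple T2 =>
    F [tuple of (x, z.1.1) :: [tuple (tnth z.1.2 i, tnth z.2 i) | i < n]]).
  apply: (measurableT_comp mF); apply: measurable_cons.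
    apply: measurable_fun_pair => //.
    exact: (measurableT_comp measurable_fst measurable_fst).
  apply: (@measurableT_comp _ _ _ _ _ _ _ _ (fun z => (z.1.2, z.2)) (mzip n)).
  apply: measurable_fun_pair => //.
  exact: (measurableT_comp measurable_snd measurable_fst).
rewrite (@fubini_tonelli _ _ _ _ _ m2 (mprod m1 n) (fun z => \int[mprod m2 n]_ys
    F [tuple of (x, z.1) :: [tuple (tnth z.2 i, tnth ys i) | i < n]])); last 2 first.
- exact: (measurable_integral_param _ mH).
- by move=> z; exact: integral_ge0.
apply: eq_integral => xs _ /=.
rewrite integral_mprodS//; last first.
  exact: (measurableT_comp (mG _ _ mF) (pair1_measurable _)).
apply: eq_integral => y _; apply: eq_integral => ys _; congr F.
rewrite [RHS]mktuple_cons !tnth0; apply: eq_tuple_cons => //.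
by apply: eq_from_tnth => i; rewrite !tnth_mktuple !tnthS.
Qed.

(** Disjoint blocks of coordinates are independent; this is the source of the
    vanishing covariance of vertex-disjoint cliques. *)
Lemma integral_mprod_cat d (T : measurableType d)
    (m : {sigma_finite_measure set T -> \bar R}) n1 n2
    (F1 : n1.-tuple T -> \bar R) (F2 : n2.-tuple T -> \bar R) :
  measurable_fun setT F1 -> (forall t, 0 <= F1 t) ->
  measurable_fun setT F2 -> (forall t, 0 <= F2 t) ->
  \int[mprod m (n1 + n2)]_t (F1 [tuple tnth t (lshift n2 i) | i < n1] *
                             F2 [tuple tnth t (rshift n1 i) | i < n2]) =
  \int[mprod m n1]_t F1 t * \int[mprod m n2]_t F2 t.
Proof.
move=> + + mF2 F20; elim: n1 F1 => [|n1 IH] F1 mF1 F10.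
  rewrite integral_mprod0// -ge0_integralZl//.
  apply: eq_integral => t _; congr (F1 _ * F2 _); first by rewrite [LHS]tuple0.
  apply: eq_from_tnth => i; rewrite tnth_mktuple; congr tnth; exact/val_inj.
have mI : measurable_fun setT (fun t : (n1.+1 + n2).-tuple T =>
    F1 [tuple tnth t (lshift n2 i) | i < n1.+1] *
    F2 [tuple tnth t (rshift n1.+1 i) | i < n2]).
  apply: emeasurable_funM.
    by apply: (measurableT_comp mF1); apply: measurable_mktuple => i; exact: measurable_tnth.
  by apply: (measurableT_comp mF2); apply: measurable_mktuple => i; exact: measurable_tnth.
rewrite (integral_mprodS m (n := n1 + n2) mI); last by move=> t; rewrite mule_ge0.
rewrite integral_mprodS// -ge0_integralZr//; last 3 first.
- exact: measurable_integral_mprod_cons.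
- by move=> x _; exact: integral_ge0.
- exact: integral_ge0.
apply: eq_integral => x _.
rewrite -(IH (fun t => F1 [tuple of x :: t]))//; last exact: measurable_fun_cons1.
apply: eq_integral => t _; congr (F1 _ * F2 _).
  rewrite mktuple_cons; apply: eq_tuple_cons => //; apply: eq_from_tnth => i; rewrite !tnth_mktuple.
  by rewrite -[RHS](tnthS x); congr tnth; exact/val_inj.
apply: eq_from_tnth => i; rewrite !tnth_mktuple.
by rewrite -[RHS](tnthS x); congr tnth; exact/val_inj.
Qed.

(** Boxes with sides in a generating pi-system form a pi-system generating the
    product sigma-algebra, so the joint law of finitely many variables is
    determined by product events. *)
Lemma eq_measure_box d (T : measurableType d) n (G : set (set T))
    (M1 M2 : {measure set (n.-tuple T) -> \bar R}) :
  measurable = <<s G>> -> setI_closed G -> G setT -> M1 setT < +oo ->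
  (forall A : 'I_n -> set T, (forall i, G (A i)) ->
     M1 [set t | forall i, A i (tnth t i)] = M2 [set t | forall i, A i (tnth t i)]) ->
  forall E, measurable E -> M1 E = M2 E.
Proof.
move=> mG GI GT M1oo M12.
pose box (A : 'I_n -> set T) := [set t : n.-tuple T | forall i, A i (tnth t i)].
pose GG := [set E | exists2 A, forall i, G (A i) & E = box A].
have boxT : box (fun=> setT) = setT by apply/seteqP; split.
have GGT : GG setT by exists (fun=> setT) => //; rewrite boxT.
apply: (measure_unique GG (fun=> setT)) => //.
- apply/seteqP; split.
    apply: smallest_sub; first exact: smallest_sigma_algebra.
    rewrite -bigcup_seq => /= E [i _] [B mB <-].
    rewrite setTI.
    suff : <<s G>> `<=` image_set_system setT (fun t : n.-tuple T => tnth t i) <<s GG>>.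
      by move=> /(_ B); rewrite /image_set_system/= setTI; apply; rewrite -mG.
    apply: smallest_sub.
      by apply: sigma_algebra_image; exact: smallest_sigma_algebra.
    move=> A GA; rewrite /image_set_system/= setTI; apply: sub_sigma_algebra.
    (* the cylinder over A in coordinate i is a box *)
    exists (fun j => if j == i then A else setT); first by move=> j; case: ifP.
    apply/seteqP; split => t.
      by move=> At j; case: eqP => // ->.
    by move=> /(_ i); rewrite eqxx.
  apply: smallest_sub; first exact: sigma_algebra_measurable.
  move=> _ [A GA ->].
  rewrite (_ : box A = \bigcap_(i in [set: 'I_n]) ((fun t : n.-tuple T => tnth t i) @^-1` A i)).
    apply: fin_bigcap_measurable => // i _.
    rewrite -[X in measurable X]setTI; apply: measurable_tnth => //.
    by rewrite mG; exact: sub_sigma_algebra.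
  apply/seteqP; split => t; first by move=> tA i _; exact: tA.
  by move=> tA i; exact: tA.
- move=> _ _ [A GA ->] [B GB ->]; exists (fun i => A i `&` B i).
    by move=> i; exact: GI.
  apply/seteqP; split => t; first by move=> [tA tB] i; split.
  by move=> tAB; split => i; have [] := tAB i.
- by rewrite bigcup_const//; exists 0%N.
- by move=> _ [A GA ->]; exact: M12.
Qed.

End MoreIterInt.

(** * Integrals over the real line *)

Section OneDim.
Local Open Scope ereal_scope.
Context {R : realType}.
Local Notation leb := (@lebesgue_measure R).

Lemma integral_mrestr d (T : measurableType d) (m : {measure set T -> \bar R})
    (D : set T) (mD : measurable D) (f : T -> \bar R) :
  measurable_fun setT f -> (forall x, 0 <= f x) ->
  \int[mrestr m mD]_x f x = \int[m]_(x in D) f x.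
Proof.
move=> mf f0; rewrite -(setUv D) ge0_integral_setU//; last 3 first.
- exact: measurableC.
- exact: measurable_funTS.
- by apply/disj_setPS => x [].
rewrite [X in _ + X](_ : _ = 0) ?adde0.
  apply: eq_measure_integral => A mA AD.
  by rewrite [LHS]/= /mrestr setIidl.
apply: null_set_integral.
- exact: measurableC.
- exact: measurable_funTS.
- by rewrite [LHS]/= /mrestr setICl measure0.
Qed.

Section Affine.
Variables (a b : R) (a0 : (0 < a)%R).

Let aff (x : measurableTypeR R) : measurableTypeR R := (a * x + b)%R.

Let measurable_aff : measurable_fun setT aff.
Proof. by apply: measurable_funD => //; exact: measurable_funM. Qed.

Let aff_measure : set (measurableTypeR R) -> \bar R :=
  mscale (NngNum (ltW a0))
    (measure_function_pushforward__canonical__measure_function_Measure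
      leb measurable_aff).

HB.instance Definition _ := Measure.on aff_measure.

Let aff_measureE A : measurable A -> leb A = aff_measure A.
Proof.
apply: lebesgue_measure_unique => // _ [[u v] _ <-].
pose u' := ((u - b) / a)%R; pose v' := ((v - b) / a)%R.
transitivity (a%:E * leb `]u', v']%classic); last first.
  congr (_ * leb _).
  apply/seteqP; split => x; rewrite /aff /u' /v' /= !in_itv/=.
    by rewrite ltr_pdivrMr// ler_pdivlMr// ltrBlDr lerBrDr ![(x * a)%R]mulrC.
  by rewrite ltr_pdivrMr// ler_pdivlMr// ltrBlDr lerBrDr ![(x * a)%R]mulrC.
rewrite !lebesgue_measure_itv/= !lte_fin /u' /v' ltr_pM2r ?invr_gt0// ltrD2r.
case: ifPn => _; last by rewrite mule0.
rewrite -!EFinD -EFinM; congr EFin.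
by rewrite -mulrBl opprB addrA subrK mulrC divfK ?gt_eqF.
Qed.

(** The push-forward of Lebesgue measure by x |-> a x + b, scaled by a, gives
    every interval its length, hence is Lebesgue measure. *)
Lemma integral_affine (f : R -> \bar R) :
  measurable_fun setT f -> (forall x, 0 <= f x) ->
  \int[leb]_x f x = a%:E * \int[leb]_x f (a * x + b)%R.
Proof.
move=> mf f0.
transitivity (\int[aff_measure]_x f x).
  by apply: eq_measure_integral => A mA _; exact: aff_measureE.
rewrite ge0_integral_mscale//; congr (_ * _).
by rewrite ge0_integral_pushforward.
Qed.

End Affine.

Lemma integral_opp (f : R -> \bar R) :
  measurable_fun setT f -> (forall x, 0 <= f x) ->
  \int[leb]_x f x = \int[leb]_x f (- x)%R.
Proof.
move=> mf f0.
transitivity (\int[pushforward leb (-%R : _ -> measurableTypeR R)]_x f x).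
  apply: eq_measure_integral => A mA _; exact/esym/lebesgue_measureN.
by rewrite ge0_integral_pushforward.
Qed.

Lemma cvg_powR_pinfty0 (q : R) : (q < 0)%R -> (x `^ q @[x --> +oo] --> (0:R))%R.
Proof.
move=> q0; apply/cvgr0Pnorm_lt => e e0; near=> x.
have x0 : (0 < x)%R by near: x; exact: nbhs_pinfty_gt.
rewrite ger0_norm ?powR_ge0//.
have -> : e = ((e `^ q^-1) `^ q)%R.
  by rewrite -powRrM mulVf ?lt_eqF// powRr1// ltW.
have E (y : R) : (y `^ q = (y `^ (- q))^-1)%R by rewrite powRN invrK.
rewrite (E x) (E (e `^ q^-1)%R) ltf_pV2 ?posrE ?powR_gt0//.
apply: gt0_ltr_powR; rewrite ?oppr_gt0// ?nnegrE ?powR_ge0 ?ltW//.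
Unshelve. all: by end_near. Qed.

Lemma integral_powR_pinfty (p w : R) : (1 < p)%R -> (0 < w)%R ->
  \int[leb]_(x in `[w, +oo[) (x `^ (- p))%:E = (w `^ (1 - p) / (p - 1))%:E.
Proof.
move=> p1 w0.
have p10 : (p - 1 != 0)%R by rewrite subr_eq0 gt_eqF.
pose F (x : R) := (- (x `^ (1 - p) / (p - 1)))%R.
have dF (x : R) : (0 < x)%R -> is_derive x (1:R)%R F (x `^ (- p))%R.
  move=> x0; rewrite /F.
  have H := is_derive1_powR (1 - p) x0.
  have -> : (fun y : R => - (y `^ (1 - p) / (p - 1)))%R =
            (- (p - 1)^-1)%R \*: (powR (R := R) ^~ (1 - p)%R).
    by apply/funext => y /=; rewrite /GRing.scale/= mulNr mulrC.
  apply: is_derive_eq; rewrite /GRing.scale/=.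
  rewrite addrAC subrr sub0r mulrA.
  by have -> : (- (p - 1)^-1 * (1 - p) = 1)%R; [field | rewrite mul1r].
have cF (x : R) : (0 < x)%R -> {for x, continuous F}.
  by move=> x0; apply/differentiable_continuous/derivable1_diffP; have [] := dF _ x0.
have cf (x : R) : (0 < x)%R -> {for x, continuous (fun y : R => y `^ (- p))%R}.
  move=> x0; apply/differentiable_continuous/derivable1_diffP.
  by have [] := is_derive1_powR (- p) x0.
have := @ge0_continuous_FTC2y R (fun x => x `^ (- p))%R F w 0%R.
rewrite -EFinB sub0r opprK; apply.
- by move=> x _; exact: powR_ge0.
- apply: continuous_in_subspaceT => x; rewrite inE/= in_itv/= andbT => wx.
  exact/cf/(lt_le_trans w0).
- rewrite /F -oppr0; apply: cvgN; rewrite -(mul0r (p - 1)^-1%R).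
  by apply: cvgMr_tmp; apply: cvg_powR_pinfty0; rewrite subr_lt0.
- by move=> x wx; have [] := dF _ (lt_trans w0 wx).
- apply: cvg_at_right_filter; exact: cF.
- move=> x; rewrite in_itv/= andbT => wx; rewrite derive1E.
  by have [_ ->] := dF _ (lt_trans w0 wx).
Qed.

(** The fundamental theorem of calculus bounds the integral over [1/n, 1]
    uniformly in n >= 1, and these intervals increase to ]0, 1]. *)
Lemma integral_powR_01_lty (q : R) : (-1 < q)%R ->
  \int[leb]_(x in `]0%R, 1%R]) (x `^ q)%:E < +oo.
Proof.
move=> q1.
have q10 : (0 < q + 1)%R by rewrite -ltrBlDr sub0r.
pose u (n : nat) : R := (n.+1%:R^-1)%R.
have u0 n : (0 < u n)%R by rewrite /u invr_gt0.
pose D n := `[u n, 1%R]%classic.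
have DE : \bigcup_n D n = `]0%R, 1%R]%classic.
  apply/seteqP; split => x /=.
    move=> [n _]; rewrite /D /= !in_itv/= => /andP[ux ->]; rewrite andbT.
    exact: lt_le_trans ux.
  rewrite in_itv/= => /andP[x0 x1].
  exists (Num.truncn x^-1%R) => //; rewrite /D /= in_itv/= x1 andbT /u.
  by rewrite invf_ple ?posrE// ltW// truncnS_gt.
have cI := @ge0_nondecreasing_set_cvg_integral _ (measurableTypeR R) R D (fun x => (x `^ q)%:E) leb.
rewrite -DE.
apply: (@le_lt_trans _ _ ((q + 1)^-1)%:E); last exact: ltry.
pose F (x : R) := ((q + 1)^-1 * x `^ (q + 1))%R.
have dF (x : R) : (0 < x)%R -> is_derive x (1:R)%R F (x `^ q)%R.
  move=> x0; rewrite /F.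
  have H := is_derive1_powR (q + 1) x0.
  have -> : (fun y : R => (q + 1)^-1 * y `^ (q + 1))%R =
            ((q + 1)^-1)%R \*: (powR (R := R) ^~ (q + 1)%R) by [].
  apply: is_derive_eq; rewrite /GRing.scale/= addrK mulrA mulVf ?mul1r//.
  by rewrite gt_eqF.
have cF (x : R) : (0 < x)%R -> {for x, continuous F}.
  by move=> x0; apply/differentiable_continuous/derivable1_diffP; have [] := dF _ x0.
have cf (x : R) : (0 < x)%R -> {for x, continuous (fun y : R => y `^ q)%R}.
  move=> x0; apply/differentiable_continuous/derivable1_diffP.
  by have [] := is_derive1_powR q x0.
have IE n : \int[leb]_(x in D n) (x `^ q)%:E <= ((q + 1)^-1)%:E.
  have [->|n0] := eqVneq n 0%N.
    rewrite /D /u invr1 set_itv1 integral_set1 lee_fin invr_ge0 ltW//.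
  rewrite (@continuous_FTC2 R (fun x => x `^ q)%R F)//.
  - rewrite -EFinB lee_fin /F powR1 mulr1 lerBlDr lerDl mulr_ge0 ?powR_ge0//.
    by rewrite invr_ge0 ltW.
  - by rewrite /u invf_lt1// ltr1n ltnS lt0n.
  - apply: continuous_in_subspaceT => x; rewrite inE/= in_itv/= => /andP[ux _].
    exact/cf/(lt_le_trans (u0 n)).
  - split.
    + move=> x; rewrite in_itv/= => /andP[ux _].
      by have [] := dF _ (lt_trans (u0 n) ux).
    + by apply: cvg_at_right_filter; exact: cF.
    + by apply: cvg_at_left_filter; exact: cF.
  - move=> x; rewrite in_itv/= => /andP[ux _]; rewrite derive1E.
    by have [_ ->] := dF _ (lt_trans (u0 n) ux).
apply: (@cvge_le _ _ _ _ _ _ _ _ (cI _ _ _ _)) => //.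
- exact: nearW.
- move=> m n mn; apply/subsetPset => x; rewrite /D /= !in_itv/= => /andP[mx ->].
  rewrite andbT (le_trans _ mx)// /u lef_pV2 ?posrE//; last by rewrite ler_nat.
- by move=> n; exact: measurable_itv.
- by move=> n; apply: measurable_funTS; apply/measurable_EFinP.
- by move=> n x _; rewrite lee_fin powR_ge0.
Qed.

End OneDim.

(** * The connection function *)

Section Conn.
Context {R : realType}.
Implicit Types g a b c r t : R.
Local Notation leb := (@lebesgue_measure R).

Lemma conn_ge0 g a r : 0 <= conn g a r.
Proof. by rewrite /conn; case: ifP => // _; rewrite le_min powR_ge0 ler01. Qed.

Lemma conn_le1 g a r : conn g a r <= 1.
Proof. by rewrite /conn; case: ifP => // _; rewrite ge_min lexx orbT. Qed.

(** Only the ratio a / r matters. This gives the scale invariance behind both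
    regimes: multiplying all weights by b is the same as dividing n by b^2. *)
Lemma conn_scale g a c r : 0 < c -> conn g a (c * r) = conn g (a / c) r.
Proof.
move=> c0; rewrite /conn mulf_eq0 gt_eqF//=; case: ifP => // _.
by rewrite invfM mulrA.
Qed.

Lemma conn_nonpos g a r : 0 < a -> r <= 0 -> conn g a r = 1.
Proof.
move=> a0; rewrite /conn le_eqVlt => /predU1P[->|r0]; first by rewrite eqxx.
rewrite lt_eqF// lt0_powR1 ?minxx//.
by rewrite pmulr_rlt0// invr_lt0.
Qed.

Lemma conn_anti g a r r' : 0 <= g -> 0 < a -> r <= r' ->
  conn g a r' <= conn g a r.
Proof.
move=> g0 a0 rr'; have [r0|r0] := leP r 0.
  by rewrite (conn_nonpos _ a0 r0) conn_le1.
have r'0 := lt_le_trans r0 rr'.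
rewrite /conn !gt_eqF// le_min !ge_min lexx !orbT andbT.
apply/orP; left; apply: ge0_ler_powR => //.
- by rewrite nnegrE divr_ge0 ?ltW.
- by rewrite nnegrE divr_ge0 ?ltW.
- by rewrite ler_pM2l// lef_pV2.
Qed.

Lemma conn_expn g b r n : (0 < n)%N -> 0 <= b -> 0 <= r ->
  conn g (b ^+ n) (r ^+ n) = conn g b r ^+ n.
Proof.
move=> n0 b0 r0; rewrite /conn expf_eq0 n0/=; case: ifP => [_|/negbT rn0].
  by rewrite expr1n.
have rp : 0 < r by rewrite lt_neqAle eq_sym rn0.
rewrite -expr_div_n -(@powR_mulrn _ (b / r)) ?divr_ge0// powRAC powR_mulrn ?powR_ge0//.
set x := (b / r) `^ g; have x0 : 0 <= x by exact: powR_ge0.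
have [x1|x1] := leP x 1.
  by rewrite (min_idPl _)// exprn_ile1.
by rewrite (min_idPr _) ?expr1n//; apply: exprn_ege1; exact: ltW.
Qed.

Lemma measurable_inv : measurable_fun [set: R] (@GRing.inv R).
Proof.
rewrite (_ : GRing.inv = fun x : R => x * (x ^+ 2) `^ (-1)).
  apply: measurable_funM => //; apply: (measurableT_comp (measurable_powR _)).
  exact: measurable_funX.
apply/funext => x; rewrite powR_inv1 ?sqr_ge0//.
have [->|x0] := eqVneq x 0; first by rewrite mul0r invr0.
by rewrite expr2 invfM mulrA divff// mul1r.
Qed.

Lemma measurable_conn g : measurable_fun setT (fun z : R * R => conn g z.1 z.2).
Proof.
rewrite /conn; apply: measurable_fun_ifT => //.
  by apply: measurable_fun_eqr.
apply: measurable_minr => //.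
apply: (measurableT_comp (measurable_powR _)).
apply: measurable_funM => //.
exact: (measurableT_comp measurable_inv).
Qed.

Lemma measurable_rprod d (S : measurableType d) (I : Type) (s : seq I)
    (P : pred I) (f : I -> S -> R) :
  (forall i, measurable_fun setT (f i)) ->
  measurable_fun setT (fun x => \prod_(i <- s | P i) f i x).
Proof.
move=> mf; elim: s => [|i s IH].
  by under eq_fun do rewrite big_nil; exact: measurable_cst.
under eq_fun do rewrite big_cons; case: (P i) => //.
exact: measurable_funM.
Qed.

Lemma measurable_bigmax d (S : measurableType d) (I : Type) (s : seq I)
    (f : I -> S -> R) :
  (forall i, measurable_fun setT (f i)) ->
  measurable_fun setT (fun x => \big[Num.max/0]_(i <- s) f i x).
Proof.
move=> mf; elim: s => [|i s IH].
  by under eq_fun do rewrite big_nil; exact: measurable_cst.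
under eq_fun do rewrite big_cons.
exact: measurable_maxr.
Qed.

(** An upper bound of the integral of t |-> conn g 1 |t| over the line: twice
    the unit interval plus the tail of t^-g, integrable because g > 1. *)
Definition conn_mass g : R := 2 * (1 + (g - 1)^-1).

Lemma conn_mass_ge0 g : 1 < g -> 0 <= conn_mass g.
Proof.
by move=> g1; rewrite /conn_mass mulr_ge0// addr_ge0// invr_ge0 subr_ge0 ltW.
Qed.

Lemma measurable_conn1 g b d (S : measurableType d) (f : S -> R) :
  measurable_fun setT f ->
  measurable_fun setT (fun s => (conn g b (f s))%:E).
Proof.
move=> mf; apply/measurable_EFinP.
by apply: (measurable_fun_comp2 (f := cst b) (measurable_conn g)).
Qed.

(** On [0, b] bound the probability by 1; beyond b it is (b / t)^g. *)
Lemma integral_conn_pos g b : 1 < g -> 0 < b ->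
  (\int[leb]_(t in `[0%R, +oo[) (conn g b t)%:E <= (b * (1 + (g - 1)^-1))%:E)%E.
Proof.
move=> g1 b0.
rewrite (_ : `[0, +oo[%classic = `[0, b[%classic `|` `[b, +oo[%classic); last first.
  apply/seteqP; split => x /=; rewrite !in_itv/= ?andbT.
    by move=> ->; apply/orP; case: ltP.
  by move=> [/andP[]//|]; apply: le_trans; exact: ltW.
have mc : measurable_fun [set: R] (fun t => (conn g b t)%:E).
  exact: measurable_conn1.
rewrite ge0_integral_setU//=; last 3 first.
- exact: measurable_funTS.
- by move=> x _; rewrite lee_fin conn_ge0.
- apply/disj_setPS => x [] /=; rewrite !in_itv/= => /andP[_ xb] /andP[bx _].
  by move: (lt_le_trans xb bx); rewrite ltxx.
rewrite mulrDr mulr1 EFinD; apply: leeD.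
  apply: (@le_trans _ _ (\int[leb]_(t in `[0%R, b[) cst 1 t)%E).
    apply: ge0_le_integral => //.
    - by move=> x _; rewrite lee_fin conn_ge0.
    - exact: measurable_funTS.
    - by move=> x _; rewrite lee_fin conn_le1.
  by rewrite integral_cst//= mul1e lebesgue_measure_itv/= lte_fin b0 sube0.
apply: (@le_trans _ _ (\int[leb]_(t in `[b, +oo[) ((b `^ g)%:E * (t `^ (- g))%:E))%E).
  apply: ge0_le_integral => //.
  - by move=> x _; rewrite lee_fin conn_ge0.
  - exact: measurable_funTS.
  - apply: emeasurable_funM => //; apply: measurable_funTS; apply/measurable_EFinP.
    exact: measurable_powR.
  - move=> x /=; rewrite in_itv/= andbT => bx; have x0 := lt_le_trans b0 bx.
    rewrite /conn gt_eqF// lee_fin ge_min; apply/orP; left.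
    by rewrite powRM ?invr_ge0 ?(ltW b0) ?(ltW x0)// -powR_inv1 ?(ltW x0)// -powRrM mulN1r.
rewrite ge0_integralZl//; last 3 first.
- by apply: measurable_funTS; apply/measurable_EFinP; exact: measurable_powR.
- by move=> x _; rewrite lee_fin powR_ge0.
- by rewrite lee_fin powR_ge0.
rewrite integral_powR_pinfty// -EFinM lee_fin mulrA -powRD.
  by rewrite addrC subrK powRr1// ltW.
by apply/implyP => _; rewrite gt_eqF.
Qed.

Lemma integral_conn g b : 1 < g -> 0 < b ->
  (\int[leb]_t (conn g b `|t|)%:E <= (conn_mass g * b)%:E)%E.
Proof.
move=> g1 b0.
have mc : measurable_fun [set: R] (fun t => (conn g b `|t|)%:E).
  exact: measurable_conn1.
have c0 t : (0 <= (conn g b `|t|)%:E)%E by rewrite lee_fin conn_ge0.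
have pos : (\int[leb]_(t in `[0%R, +oo[) (conn g b `|t|)%:E <=
    (b * (1 + (g - 1)^-1))%:E)%E.
  apply: le_trans (integral_conn_pos g1 b0).
  rewrite le_eqVlt; apply/orP; left; apply/eqP; apply: eq_integral => x.
  by rewrite inE/= in_itv/= andbT => x0; rewrite ger0_norm.
rewrite -(setUv `[0, +oo[%classic) ge0_integral_setU//=; last 3 first.
- exact: measurableC.
- exact: measurable_funTS.
- by apply/disj_setPS => x [].
have -> : conn_mass g * b = b * (1 + (g - 1)^-1) + b * (1 + (g - 1)^-1).
  by rewrite /conn_mass mulrC mulrCA mulr_natl mulr2n.
rewrite EFinD; apply: leeD => //.
apply: le_trans pos.
rewrite [leLHS]integral_mkcond [leRHS]integral_mkcond integral_opp; last 2 first.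
- by apply/(measurable_restrictT _ _).1; [exact: measurableC|exact: measurable_funTS].
- by move=> x; apply: erestrict_ge0.
apply: ge0_le_integral => //.
- by move=> x _; apply: erestrict_ge0.
- apply: (@measurableT_comp _ _ _ _ _ _ ((fun t => (conn g b `|t|)%:E) \_ (~` `[0, +oo[%classic))) => //.
  by apply/(measurable_restrictT _ _).1; [exact: measurableC|exact: measurable_funTS].
- by apply/(measurable_restrictT _ _).1 => //; exact: measurable_funTS.
- move=> x _; rewrite /patch; case: ifPn => [|_]; last by case: ifP.
  rewrite inE/= in_itv/= andbT => /negP; rewrite -ltNge oppr_lt0 => x0.
  by rewrite mem_set ?normrN//= in_itv/= andbT ltW.
Qed.

End Conn.

(** * Lebesgue measure restricted to a set *)

Section LebR.
Context {R : realType}.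
Local Notation leb := (@lebesgue_measure R).

(** Lebesgue measure lives on an alias of R whose measurable structure is
    generated by half-open intervals; pushing it forward along this identity
    gives a measure on R itself, which can be multiplied with other measures. *)
Definition borel_id (x : measurableTypeR R) : R := x.

Lemma measurable_borel_id : measurable_fun setT borel_id.
Proof. by move=> _ Y mY; rewrite setTI. Qed.

Section LebOn.
Variables (D : set R) (mD : measurable D).

(** Restricting the measure rather than the domain of integration makes
    integrals over D^k plain integrals with respect to a power [mprod]. *)
Definition leb_on : set R -> \bar R :=
  pushforward (mrestr leb (mD : measurable (D : set (measurableTypeR R)))) borel_id.

HB.instance Definition _ := Measure.copy leb_on
  (measure_function_pushforward__canonical__measure_function_Measure
    (mrestr leb (mD : measurable (D : set (measurableTypeR R)))) measurable_borel_id).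

Let leb_on_sigma_finite : sigma_finite setT leb_on.
Proof.
have [F FT Foo] := sigma_finiteT leb.
exists F => // i; have [mF Fi] := Foo i; split => //.
by apply: le_lt_trans Fi; apply: le_measure; rewrite ?inE//; exact: measurableI.
Qed.

HB.instance Definition _ := Measure_isSigmaFinite.Build _ _ _ leb_on
  leb_on_sigma_finite.

Lemma integral_leb_on (f : R -> \bar R) :
  measurable_fun setT f -> (forall x, 0 <= f x)%E ->
  (\int[leb_on]_x f x = \int[leb]_(x in D) f x)%E.
Proof.
move=> mf f0; rewrite ge0_integral_pushforward//; last exact: measurable_borel_id.
by rewrite preimage_setT integral_mrestr.
Qed.

Lemma integral_leb_on_indic (f : R -> \bar R) :
  measurable_fun setT f -> (forall x, 0 <= f x)%E ->
  (\int[leb_on]_x f x = \int[leb_on]_x ((\1_D x)%:E * f x))%E.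
Proof.
move=> mf f0; rewrite !integral_leb_on//.
- by apply: eq_integral => x xD; rewrite indicE xD mul1e.
- by apply: emeasurable_funM => //; apply/measurable_EFinP; exact: measurable_indic.
- by move=> x; rewrite mule_ge0// lee_fin.
Qed.

End LebOn.

Definition lebT : {sigma_finite_measure set R -> \bar R} := leb_on measurableT.

Lemma integral_lebT (f : R -> \bar R) :
  measurable_fun setT f -> (forall x, 0 <= f x)%E ->
  (\int[lebT]_x f x = \int[leb]_x f x)%E.
Proof. exact: integral_leb_on. Qed.

Lemma integral_leb_on_lebT (D : set R) (mD : measurable D) (f : R -> \bar R) :
  measurable_fun setT f -> (forall x, 0 <= f x)%E ->
  (\int[leb_on mD]_x f x = \int[lebT]_x ((\1_D x)%:E * f x))%E.
Proof.
move=> mf f0; rewrite integral_leb_on// integral_lebT.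
- rewrite integral_mkcond; apply: eq_integral => x _.
  by rewrite /patch indicE; case: ifP; rewrite ?mul1e ?mul0e.
- by apply: emeasurable_funM => //; apply/measurable_EFinP; exact: measurable_indic.
- by move=> x; rewrite mule_ge0// lee_fin.
Qed.

End LebR.

(** * Measures carried by a set; the unit cube *)

Section Support.
Context {R : realType}.
Local Open Scope ereal_scope.

(** The measure m is carried by D. Stating this through integrals makes
    it stable under powers, where only iterated integrals are accessible. *)
Definition supported d (T : measurableType d) (m : {measure set T -> \bar R})
    (D : set T) :=
  measurable D /\ forall f : T -> \bar R, measurable_fun setT f ->
    (forall x, 0 <= f x) -> \int[m]_x f x = \int[m]_x ((\1_D x)%:E * f x).

Lemma measurable_EFin_indic d (T : measurableType d) (D : set T) :
  measurable D -> measurable_fun setT (fun x => (\1_D x)%:E : \bar R).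
Proof. by move=> mD; apply/measurable_EFinP; exact: measurable_indic. Qed.

Lemma le_integral_supported d (T : measurableType d) (m : {measure set T -> \bar R})
    (D : set T) (f h : T -> \bar R) :
  supported m D -> measurable_fun setT f -> measurable_fun setT h ->
  (forall x, 0 <= f x) -> (forall x, 0 <= h x) ->
  (forall x, D x -> f x <= h x) -> \int[m]_x f x <= \int[m]_x h x.
Proof.
move=> [mD mE] mf mh f0 h0 fh; rewrite (mE f)// (mE h)//.
apply: ge0_le_integral => //.
- by move=> x _; rewrite mule_ge0// lee_fin.
- by apply: emeasurable_funM => //; exact: measurable_EFin_indic.
- by apply: emeasurable_funM => //; exact: measurable_EFin_indic.
- move=> x _; rewrite indicE; have [xD|xD] := boolP (x \in D).
    by rewrite !mul1e fh//; exact: set_mem.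
  by rewrite !mul0e.
Qed.

Lemma eq_integral_supported d (T : measurableType d) (m : {measure set T -> \bar R})
    (D : set T) (f h : T -> \bar R) :
  supported m D -> measurable_fun setT f -> measurable_fun setT h ->
  (forall x, 0 <= f x) -> (forall x, 0 <= h x) ->
  (forall x, D x -> f x = h x) -> \int[m]_x f x = \int[m]_x h x.
Proof.
move=> sD mf mh f0 h0 fh; apply/eqP; rewrite eq_le.
by apply/andP; split; apply: (le_integral_supported sD) => // x /fh ->.
Qed.

Lemma prod_indic n T (D : set T) (t : n.-tuple T) :
  \prod_(i < n) (\1_D (tnth t i))%:E =
  (\1_[set t : n.-tuple T | forall i, D (tnth t i)] t)%:E :> \bar R.
Proof.
rewrite [in RHS]indicE; case: (boolP (t \in _)) => [/set_mem tD|tD].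
  by rewrite big1// => i _; rewrite indicE mem_set//; exact: tD.
have [i Di] : exists i, ~ D (tnth t i).
  by apply/existsNP => tD'; move/negP: tD; apply; exact: mem_set.
by rewrite (bigD1 i)//= indicE memNset// mul0e.
Qed.

Lemma supported_mprod d (T : measurableType d)
    (m : {sigma_finite_measure set T -> \bar R}) (D : set T) n :
  supported m D ->
  supported (mprod m n) [set t : n.-tuple T | forall i, D (tnth t i)].
Proof.
move=> [mD mE]; split.
  rewrite (_ : mkset _ = \bigcap_(i in [set: 'I_n]) ((fun t : n.-tuple T => tnth t i) @^-1` D)).
    apply: fin_bigcap_measurable => // i _.
    by rewrite -[X in measurable X]setTI; exact: measurable_tnth.
  apply/seteqP; split => t; first by move=> tA i _; exact: tA.
  by move=> tA i; exact: tA.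
move=> f mf f0.
rewrite (integral_mprod_subst (m' := m) (h := fun=> (fun x => (\1_D x)%:E)) (phi := fun=> id))//.
- by apply: eq_integral => t _; rewrite prod_indic tnth_tuple_eta.
- by move=> _; exact: measurable_EFin_indic.
Qed.

Lemma integral_mprod1 d (T : measurableType d)
    (m : {sigma_finite_measure set T -> \bar R}) n :
  \int[m]_x 1 = 1 -> \int[mprod m n]_t 1 = 1.
Proof.
move=> m1; transitivity (\prod_(i < n) \int[m]_x (1 : \bar R)); last by rewrite big1.
rewrite -(integral_mprod_prod m (f := fun (_ : 'I_n) _ => 1))//.
by apply: eq_integral => t _; rewrite big1_eq.
Qed.

End Support.

Section Cube.
Context {R : realType}.
Implicit Types g a b : R.

Definition leb01 : {sigma_finite_measure set R -> \bar R} :=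
  leb_on (measurable_itv `[0%R, 1%R] : measurable (`[0%R, 1%R]%classic : set R)).

Definition cube d := mprod leb01 d.
Definition space d := mprod (@lebT R) d.

Definition in_cube d : set (d.-tuple R) := [set t | forall i, `[0, 1]%classic (tnth t i)].

Lemma supported_leb01 : supported leb01 `[0, 1]%classic.
Proof. by split => // f mf f0; exact: integral_leb_on_indic. Qed.

Lemma supported_cube d : supported (cube d) (in_cube (d := d)).
Proof. exact: supported_mprod supported_leb01. Qed.

Lemma leb01_mass : (\int[leb01]_x 1 = 1)%E.
Proof.
rewrite integral_leb_on// integral_cst//= mul1e lebesgue_measure_itv/= lte_fin.
by rewrite ltr01 oppr0 adde0.
Qed.

Lemma cube_mass d : (\int[cube d]_x 1 = 1)%E.
Proof. exact/integral_mprod1/leb01_mass. Qed.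

Lemma measurable_linf_dist d :
  measurable_fun setT (fun z : d.-tuple R * d.-tuple R => linf_dist z.1 z.2).
Proof.
apply: measurable_bigmax => i; apply: measurableT_comp => //.
apply: measurable_funB.
  exact: (measurableT_comp (measurable_tnth i) measurable_fst).
exact: (measurableT_comp (measurable_tnth i) measurable_snd).
Qed.

Lemma measurable_circle_dist :
  measurable_fun setT (fun z : R * R => circle_dist z.1 z.2).
Proof.
have mn : measurable_fun setT (fun z : R * R => `|z.1 - z.2|).
  by apply: measurableT_comp => //; exact: measurable_funB.
by apply: measurable_minr => //; exact: measurable_funB.
Qed.

Lemma measurable_torus_dist d :
  measurable_fun setT (fun z : d.-tuple R * d.-tuple R => torus_dist z.1 z.2).
Proof.
apply: measurable_bigmax => i.
apply: (measurable_fun_comp2 measurable_circle_dist).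
  exact: (measurableT_comp (measurable_tnth i) measurable_fst).
exact: (measurableT_comp (measurable_tnth i) measurable_snd).
Qed.

Lemma linf_dist_ge0 d (x y : d.-tuple R) : 0 <= linf_dist x y.
Proof. by rewrite /linf_dist; elim/big_ind: _ => // u v u0 v0; rewrite le_max u0. Qed.

Lemma torus_dist_ge0 d (x y : d.-tuple R) : 0 <= torus_dist x y.
Proof.
rewrite /torus_dist; elim: (index_enum _) => [|i s IH]; first by rewrite big_nil.
by rewrite big_cons le_max IH orbT.
Qed.

Lemma circle_distC (a b : R) : circle_dist a b = circle_dist b a.
Proof. by rewrite /circle_dist distrC. Qed.

Lemma torus_distC d (x y : d.-tuple R) : torus_dist x y = torus_dist y x.
Proof. by apply: eq_bigr => i _; rewrite circle_distC. Qed.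

(** Since conn decreases with the distance and commutes with d-th powers, a
    function of the maximum norm is bounded by a product over the coordinates,
    which can be integrated one coordinate at a time. *)
Lemma conn_expn_le_prod g b r d (z : 'I_d -> R) : 0 <= g -> 0 < b -> (0 < d)%N ->
  0 <= r -> (forall i, z i <= r) ->
  conn g (b ^+ d) (r ^+ d) <= \prod_(i < d) conn g b (z i).
Proof.
move=> g0 b0 d0 r0 zr; rewrite conn_expn ?(ltW b0)//.
have -> : conn g b r ^+ d = \prod_(i < d) conn g b r by rewrite prodr_const card_ord.
apply: ler_prod => i _.
by rewrite conn_ge0 conn_anti.
Qed.

Lemma dth_root a d : (0 < d)%N -> 0 < a -> exists2 b : R, 0 < b & b ^+ d = a.
Proof.
move=> d0 a0; exists (a `^ (d%:R^-1)); first by rewrite powR_gt0.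
rewrite -powR_mulrn ?powR_ge0// -powRrM mulVf ?powRr1 ?ltW//.
by rewrite pnatr_eq0 -lt0n.
Qed.

Lemma prod_EFin_le (n : nat) (f : 'I_n -> \bar R) (c : R) :
  (forall i, (0 <= f i <= c%:E)%E) -> (\prod_(i < n) f i <= (c ^+ n)%:E)%E.
Proof.
elim: n f => [|n IH] f fc; first by rewrite big_ord0 expr0.
rewrite big_ord_recl exprS EFinM; have /andP[f0 f1] := fc ord0.
apply: lee_pmul => //; first by apply: prode_ge0 => i _; have /andP[] := fc (lift ord0 i).
by apply: IH => i.
Qed.

(** With b the d-th root of a, the probability is at most a product of
    one-dimensional ones, and each of these has mass at most conn_mass g * b. *)
Lemma integral_space_conn g a d (s : d.-tuple R) : 1 < g -> 0 < a -> (0 < d)%N ->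
  (\int[space d]_z (conn g a (linf_dist s z ^+ d))%:E <=
   (conn_mass g ^+ d * a)%:E)%E.
Proof.
move=> g1 a0 d0; have [b b0 bE] := dth_root d0 a0.
have g0 : 0 <= g by rewrite (le_trans _ (ltW g1)).
have mc i : measurable_fun setT (fun x : R => (conn g b `|tnth s i - x|)%:E).
  by apply: measurable_conn1; apply: measurableT_comp => //; exact: measurable_funB.
apply: (@le_trans _ _ (\int[space d]_z (\prod_(i < d) (conn g b `|tnth s i - tnth z i|)%:E))%E).
  apply: ge0_le_integral => //.
  - by move=> z _; rewrite lee_fin conn_ge0.
  - apply: measurable_conn1; apply: measurable_funX.
    by apply: (measurable_fun_comp2 (f := cst s) (@measurable_linf_dist d)).
  - apply: measurable_eprod => i.
    exact: (measurable_tnth_comp i (mc i)).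
  - move=> z _; rewrite prodEFin lee_fin -bE.
    apply: conn_expn_le_prod => //; first exact: linf_dist_ge0.
    by move=> i; rewrite /linf_dist; apply: (le_bigmax _ (fun h => `|tnth s h - tnth z h|)).
rewrite (integral_mprod_prod lebT (f := fun i x => (conn g b `|tnth s i - x|)%:E))//; last first.
  by move=> i x; rewrite lee_fin conn_ge0.
rewrite -bE -exprMn; apply: prod_EFin_le => i; rewrite integral_ge0/=; last first.
  by move=> x _; rewrite lee_fin conn_ge0.
rewrite integral_lebT//; last by move=> x; rewrite lee_fin conn_ge0.
have -> : (\int[lebesgue_measure]_x (conn g b `|tnth s i - x|)%:E =
   \int[@lebesgue_measure R]_x (conn g b `|x|)%:E)%E.
  rewrite (@integral_affine R 1 (- tnth s i) ltr01 (fun x => (conn g b `|x|)%:E)); last 2 first.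
  - by apply: measurable_conn1.
  - by move=> x; rewrite lee_fin conn_ge0.
  by rewrite mul1e; apply: eq_integral => x _; rewrite mul1r distrC.
exact: integral_conn.
Qed.

(** The distance on the circle is the least of the distances of x to s and to
    s + 1 or s - 1, so the probability is at most the sum of three translates
    of the one on the line; hence the factor 3. *)
Lemma integral_circle_conn g b (s : R) : 1 < g -> 0 < b -> 0 <= s <= 1 ->
  (\int[leb01]_x (conn g b (circle_dist s x))%:E <= (3 * (conn_mass g * b))%:E)%E.
Proof.
move=> g1 b0 /andP[s0 s1].
have g0 : 0 <= g by rewrite (le_trans _ (ltW g1)).
pose f (u x : R) : \bar R := (conn g b `|x - u|)%:E.
have mf u : measurable_fun setT (f u).
  by apply: measurable_conn1; apply: measurableT_comp => //; exact: measurable_funB.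
have f0 u x : (0 <= f u x)%E by rewrite lee_fin conn_ge0.
have fI u : (\int[lebT]_x f u x <= (conn_mass g * b)%:E)%E.
  rewrite integral_lebT//; apply: le_trans (integral_conn g1 b0).
  rewrite (@integral_affine R 1 (- u) ltr01 (fun x => (conn g b `|x|)%:E)); last 2 first.
  - by apply: measurable_conn1.
  - by move=> x; rewrite lee_fin conn_ge0.
  by rewrite mul1e le_eqVlt; apply/orP; left; apply/eqP; apply: eq_integral => x _; rewrite mul1r.
have mc : measurable_fun setT (fun x => (conn g b (circle_dist s x))%:E).
  apply: measurable_conn1.
  by apply: (measurable_fun_comp2 (f := cst s) measurable_circle_dist).
apply: (@le_trans _ _ (\int[lebT]_x (f s x + f (s + 1)%R x + f (s - 1)%R x))%E).
  rewrite integral_leb_on_lebT//; last by move=> x; rewrite lee_fin conn_ge0.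
  apply: ge0_le_integral => //.
  - by move=> x _; rewrite mule_ge0// lee_fin// conn_ge0.
  - by apply: emeasurable_funM => //; exact: measurable_EFin_indic.
  - by apply: emeasurable_funD => //; exact: emeasurable_funD.
  - move=> x _; rewrite indicE; have [|_] := boolP (x \in _); last first.
      by rewrite mul0e !adde_ge0.
    rewrite inE/= in_itv/= mul1e => /andP[x0 x1].
    rewrite /f -!EFinD lee_fin /circle_dist.
    have c0 := conn_ge0 g b.
    have [_|_] := leP `|s - x| (1 - `|s - x|).
      by rewrite distrC -addrA lerDl addr_ge0.
    have [sx|sx] := leP s x.
      have -> : 1 - `|s - x| = `|x - (s + 1)|.
        by rewrite distrC ger0_norm ?subr_ge0// ler0_norm; lra.
      by rewrite -addrA addrCA lerDl addr_ge0.
    have -> : 1 - `|s - x| = `|x - (s - 1)|.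
      by rewrite gtr0_norm ?subr_gt0// ger0_norm; lra.
    by rewrite lerDr addr_ge0.
rewrite ge0_integralD//; last 2 first.
- by move=> x _; rewrite adde_ge0.
- exact: emeasurable_funD.
rewrite ge0_integralD//.
have -> : 3 * (conn_mass g * b) = conn_mass g * b + conn_mass g * b + conn_mass g * b.
  by ring.
by rewrite !EFinD; apply: leeD; [apply: leeD|].
Qed.

Lemma integral_cube_conn g a d (s : d.-tuple R) : 1 < g -> 0 < a -> (0 < d)%N ->
  in_cube s ->
  (\int[cube d]_z (conn g a (torus_dist s z ^+ d))%:E <=
   ((3 * conn_mass g) ^+ d * a)%:E)%E.
Proof.
move=> g1 a0 d0 sc; have [b b0 bE] := dth_root d0 a0.
have g0 : 0 <= g by rewrite (le_trans _ (ltW g1)).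
have mc i : measurable_fun setT (fun x : R => (conn g b (circle_dist (tnth s i) x))%:E).
  apply: measurable_conn1.
  by apply: (measurable_fun_comp2 (f := cst (tnth s i)) measurable_circle_dist).
apply: (@le_trans _ _ (\int[cube d]_z (\prod_(i < d) (conn g b (circle_dist (tnth s i) (tnth z i)))%:E))%E).
  apply: ge0_le_integral => //.
  - by move=> z _; rewrite lee_fin conn_ge0.
  - apply: measurable_conn1; apply: measurable_funX.
    by apply: (measurable_fun_comp2 (f := cst s) (@measurable_torus_dist d)).
  - apply: measurable_eprod => i.
    exact: (measurable_tnth_comp i (mc i)).
  - move=> z _; rewrite prodEFin lee_fin -bE.
    apply: conn_expn_le_prod => //; first exact: torus_dist_ge0.
    by move=> i; rewrite /torus_dist; apply: (le_bigmax _ (fun h => circle_dist (tnth s h) (tnth z h))).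
rewrite (integral_mprod_prod leb01 (f := fun i x => (conn g b (circle_dist (tnth s i) x))%:E))//; last first.
  by move=> i x; rewrite lee_fin conn_ge0.
rewrite -bE -exprMn -mulrA; apply: prod_EFin_le => i; rewrite integral_ge0/=; last first.
  by move=> x _; rewrite lee_fin conn_ge0.
by apply: integral_circle_conn => //; have := sc i; rewrite /= in_itv.
Qed.

Lemma integral_cube_conn_le1 g a d (s : d.-tuple R) :
  (\int[cube d]_z (conn g a (torus_dist s z ^+ d))%:E <= 1)%E.
Proof.
rewrite -(cube_mass d); apply: ge0_le_integral => //.
- by move=> z _; rewrite lee_fin conn_ge0.
- apply: measurable_conn1; apply: measurable_funX.
  by apply: (measurable_fun_comp2 (f := cst s) (@measurable_torus_dist d)).
- by move=> z _; rewrite lee_fin conn_le1.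
Qed.

End Cube.

(** * Unrolling the circle *)

Section Wrap.
Context {R : realType}.
Implicit Types (s t u v rho : R).

(** Reduction modulo 1 on [-1, 2[, which contains all the points s + u with s
    in the unit interval and |u| at most 1/2. *)
Definition wrap v : R := if v < 0 then v + 1 else if v < 1 then v else v - 1.

Lemma measurable_wrap : measurable_fun setT wrap.
Proof.
apply: measurable_fun_ifT.
- by apply: measurable_fun_ltr.
- exact: measurable_funD.
- apply: measurable_fun_ifT => //; first exact: measurable_fun_ltr.
  exact: measurable_funB.
Qed.

Lemma circle_dist_add1 a b a' b' : a - b = (a' - b' : R) + 1 -> -1 <= a' - b' <= 0 ->
  circle_dist a b = circle_dist a' b'.
Proof.
rewrite /circle_dist => -> /andP[t1 t0].
have -> : `|a' - b' + 1| = 1 + (a' - b') by rewrite ger0_norm; lra.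
have -> : `|a' - b'| = - (a' - b') by rewrite ler0_norm.
by rewrite minC; congr Num.min; lra.
Qed.

(** Reducing modulo 1 changes u - v by -1, 0 or 1, and the circle distance is
    invariant under such a change when |u - v| < 1. *)
Lemma circle_dist_wrap u v : `|u - v| < 1 ->
  circle_dist (wrap u) (wrap v) = circle_dist u v.
Proof.
move=> uv; have /andP[uv1 uv2] : -1 < u - v < 1 by rewrite -ltr_norml.
rewrite /wrap.
have E1 a b : a - b = u - v -> circle_dist a b = circle_dist u v.
  by rewrite /circle_dist => ->.
have E2 a b : a - b = u - v + 1 -> u - v <= 0 -> circle_dist a b = circle_dist u v.
  by move=> ab t0; apply: circle_dist_add1 => //; lra.
have E3 a b : a - b = u - v - 1 -> 0 <= u - v -> circle_dist a b = circle_dist u v.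
  by move=> ab t0; apply/esym/circle_dist_add1 => //; lra.
have [u0|u0] := ltP u 0; have [v0|v0] := ltP v 0.
- by apply: E1; lra.
- have [v1|v1] := ltP v 1; [by apply: E2; lra|lra].
- have [u1|u1] := ltP u 1; [by apply: E3; lra|lra].
have [u1|u1] := ltP u 1; have [v1|v1] := ltP v 1.
- by apply: E1; lra.
- by apply: E2; lra.
- by apply: E3; lra.
- by apply: E1; lra.
Qed.

Lemma circle_dist_wrapl s u : 0 <= s <= 1 -> -1 / 2 <= u <= 1 / 2 ->
  circle_dist s (wrap (s + u)) = `|u|.
Proof.
move=> /andP[s0 s1] /andP[u1 u2].
have E0 : circle_dist s (s + u) = `|u|.
  rewrite /circle_dist; have -> : s - (s + u) = - u by lra.
  rewrite normrN; apply: min_l.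
  have : `|u| <= 1 / 2 by rewrite ler_norml; lra.
  by lra.
rewrite -E0 /wrap; have [su|su] := ltP (s + u) 0.
  apply/esym/circle_dist_add1; last by lra.
  by lra.
have [su1|su1] := ltP (s + u) 1; first by [].
by apply: circle_dist_add1; lra.
Qed.

Definition half_open_box rho : set R := `[- (rho / 2), rho / 2[%classic.

Lemma indic_co (a b x : R) : \1_(`[a, b[%classic) x = (a <= x < b)%R%:R :> R.
Proof. by rewrite indicE mem_setE in_itv. Qed.

(** The circle seen from the point s is the interval of length 1 centred at s,
    and z = rho (x - s) is the blown-up coordinate around s: this is the change
    of variables x = s + z / rho mod 1. *)
Lemma integral_wrap rho s (f : R -> \bar R) : 0 < rho -> 0 <= s <= 1 ->
  measurable_fun setT f -> (forall x, 0 <= f x)%E ->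
  (\int[leb01]_x f x =
   \int[lebT]_z ((rho^-1 * \1_(half_open_box rho) z)%:E * f (wrap (s + z / rho))%R))%E.
Proof.
move=> r0 /andP[s0 s1] mf f0.
pose G v : \bar R := ((\1_(`[(s - 1/2)%R, (s + 1/2)%R[%classic) v)%:E * f (wrap v))%E.
have mi (a b : R) : measurable_fun setT (fun x : R => (\1_(`[a, b[%classic) x)%:E : \bar R).
  by apply: measurable_EFin_indic; exact: measurable_itv.
have i0 (D : set R) x : (0 <= (\1_D x)%:E :> \bar R)%E by rewrite lee_fin.
have mG : measurable_fun setT G.
  by apply: emeasurable_funM => //; apply: measurableT_comp => //; exact: measurable_wrap.
have G0 v : (0 <= G v)%E by rewrite mule_ge0.
transitivity (\int[lebT]_v G v)%E; last first.
  rewrite !integral_lebT//; last 2 first.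
  - apply: emeasurable_funM.
      by apply/measurable_EFinP; apply: measurable_funM => //; apply: measurable_indic; exact: measurable_itv.
    apply: measurableT_comp => //; apply: (measurableT_comp measurable_wrap).
    by apply: measurable_funD => //; exact: measurable_funM.
  - by move=> z; rewrite mule_ge0// lee_fin mulr_ge0// invr_ge0 ltW.
  have ri : 0 < rho^-1 by rewrite invr_gt0.
  rewrite (integral_affine s ri mG G0) -ge0_integralZl//; last 2 first.
  - have maff : measurable_fun setT (fun x : R => rho^-1 * x + s).
      by apply: measurable_funD => //; exact: measurable_funM.
    exact: (measurableT_comp mG maff).
  - by rewrite lee_fin ltW.
  apply: eq_integral => z _; rewrite EFinM -muleA; congr (_ * _)%E.
  have -> : rho^-1 * z + s = s + z / rho by rewrite mulrC addrC.
  rewrite /G !indic_co; congr ((_%:R)%:E * _)%E.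
  rewrite -[s - 1/2]/(s + - (1/2)) lerD2l ltrD2l -!(mulrC rho^-1) ler_pdivlMl// ltr_pdivrMl//.
  by rewrite mulrN div1r.
(* the window [s - 1/2, s + 1/2[ meets at most three unit intervals; A1, A2 and A3 are
   the pieces of [0, 1[ onto which its parts in [-1, 0[, [0, 1[ and [1, 2[ are moved *)
pose A1 (x : R) : \bar R := ((\1_(`[(s + 1/2)%R, 1%R[%classic) x)%:E * f x)%E.
pose A2 (x : R) : \bar R :=
  ((\1_(`[Num.max 0 (s - 1/2)%R, Num.min 1 (s + 1/2)%R[%classic) x)%:E * f x)%E.
pose A3 (x : R) : \bar R := ((\1_(`[0%R, (s - 1/2)%R[%classic) x)%:E * f x)%E.
have mA1 : measurable_fun setT A1 by apply: emeasurable_funM.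
have mA2 : measurable_fun setT A2 by apply: emeasurable_funM.
have mA3 : measurable_fun setT A3 by apply: emeasurable_funM.
have A10 x : (0 <= A1 x)%E by rewrite mule_ge0.
have A20 x : (0 <= A2 x)%E by rewrite mule_ge0.
have A30 x : (0 <= A3 x)%E by rewrite mule_ge0.
have GE v : G v = (A1 (v + 1)%R + A2 v + A3 (v - 1)%R)%E.
  rewrite /G /A1 /A2 /A3 !indic_co ge_max lt_min /wrap.
  have [vI|vI] := boolP (s - 1/2 <= v < s + 1/2).
    move/andP: vI => [v1 v2].
    have [v0|v0] := ltP v 0.
      rewrite (_ : (s + 1/2 <= v + 1) && _); last by apply/andP; split; lra.
      rewrite (_ : (0 <= v - 1) && _ = false); last by apply/negbTE/negP => /andP[]; lra.
      by rewrite !mul1e/= !mul0e !adde0.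
    rewrite (_ : (s + 1/2 <= v + 1) && _ = false); last by apply/negbTE/negP => /andP[]; lra.
    rewrite v1 v2/= andbT; have [v3|v3] := ltP v 1.
      rewrite (_ : (0 <= v - 1) && _ = false); last by apply/negbTE/negP => /andP[]; lra.
      by rewrite !mul1e/= !mul0e adde0 add0e.
    rewrite (_ : (0 <= v - 1) && _); last by apply/andP; split; lra.
    by rewrite !mul1e/= !mul0e !add0e.
  rewrite (_ : (s + 1/2 <= v + 1) && _ = false); last first.
    by apply/negbTE; move: vI; apply: contra => /andP[v1 v2]; apply/andP; split; lra.
  rewrite (_ : (0 <= v - 1) && _ = false); last first.
    by apply/negbTE; move: vI; apply: contra => /andP[v1 v2]; apply/andP; split; lra.
  rewrite (_ : [&& _, _ & _] = false); last first.
    by apply/negbTE; move: vI; apply: contra => /andP[/andP[v1 v2] /andP[v3 v4]]; apply/andP; split; lra.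
  by rewrite !mul0e !adde0.
have mA1s : measurable_fun setT (fun v => A1 (v + 1)).
  by apply: measurableT_comp => //; exact: measurable_funD.
have mA3s : measurable_fun setT (fun v => A3 (v - 1)).
  by apply: measurableT_comp => //; exact: measurable_funB.
rewrite [RHS](eq_integral (fun v => A1 (v + 1)%R + A2 v + A3 (v - 1)%R)%E); last by move=> v _; exact: GE.
rewrite [RHS]ge0_integralD//; last 2 first.
- by move=> x _; rewrite adde_ge0.
- exact: emeasurable_funD.
rewrite [X in _ = (X + _)%E]ge0_integralD//.
have shift (h : R -> \bar R) (b : R) : measurable_fun setT h -> (forall x, 0 <= h x)%E ->
    (\int[lebT]_v h (v + b)%R = \int[lebT]_v h v)%E.
  move=> mh h0; rewrite !integral_lebT//; last first.
    by apply: measurableT_comp => //; exact: measurable_funD.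
  rewrite [RHS](integral_affine b ltr01 mh h0) mul1e.
  by apply: eq_integral => x _; rewrite mul1r.
rewrite !shift// -ge0_integralD// -ge0_integralD//; last 2 first.
- by move=> x _; rewrite adde_ge0.
- exact: emeasurable_funD.
transitivity (\int[lebT]_x ((\1_(`[0%R, 1%R[%classic) x)%:E * f x))%E.
  rewrite integral_leb_on// -integral_itv_bndo_bndc; last exact: measurable_funTS.
  rewrite -(integral_leb_on (D := `[0%R, 1%R[%classic) (measurable_itv _))//.
  by rewrite integral_leb_on_lebT.
apply: eq_integral => x _; rewrite /A1 /A2 /A3 !indic_co ge_max lt_min.
have [xI|xI] := boolP (0 <= x < 1); last first.
  rewrite (_ : (s + 1/2 <= x) && _ = false); last first.
    by apply/negbTE; move: xI; apply: contra => /andP[v1 v2]; apply/andP; split; lra.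
  rewrite (_ : (0 <= x) && (x < s - 1/2) = false); last first.
    by apply/negbTE; move: xI; apply: contra => /andP[v1 v2]; apply/andP; split; lra.
  rewrite (_ : [&& _, _ & _] = false); last first.
    by apply/negbTE; move: xI; apply: contra => /andP[/andP[v1 v2] /andP[v3 v4]]; apply/andP; split; lra.
  by rewrite !mul0e !adde0.
move/andP: xI => [x0 x1]; rewrite x0 x1 andbT /=.
have [x2|x2] := leP (s + 1/2) x.
  rewrite (_ : x < s - 1/2 = false); last by apply/negbTE; rewrite -leNgt; lra.
  by rewrite andbF !mul0e !adde0.
have [x3|x3] := leP (s - 1/2) x.
  by rewrite !(mul0e, add0e, adde0).
by rewrite !(mul0e, add0e, adde0).
Qed.

End Wrap.

(** * Clique probabilities for given weights *)

Section CliqueProd.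
Context {R : realType}.
Implicit Types (g a : R).

Lemma iter_int_mprod d (T : measurableType d)
    (m : {sigma_finite_measure set T -> \bar R}) (I : (T -> \bar R) -> \bar R) n :
  (forall f, measurable_fun setT f -> (forall x, 0 <= f x)%E -> I f = \int[m]_x f x)%E ->
  forall F : n.-tuple T -> \bar R,
  measurable_fun setT F -> (forall t, 0 <= F t)%E ->
  (iter_int I F = \int[mprod m n]_t F t)%E.
Proof.
move=> IE; elim: n => [|n IH] F mF F0; first by rewrite integral_mprod0.
rewrite integral_mprodS//= -IE; last 2 first.
- exact: measurable_integral_mprod_cons.
- by move=> x; exact: integral_ge0.
congr I; apply/funext => x; rewrite IH//.
exact: measurable_fun_cons1.
Qed.

Lemma prod_EFin_le_cond (n : nat) (P : pred 'I_n) (f : 'I_n -> \bar R) (c : 'I_n -> R) :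
  (forall i, P i -> (0 <= f i <= (c i)%:E)%E) ->
  (\prod_(i < n | P i) f i <= (\prod_(i < n | P i) c i)%:E)%E.
Proof.
move=> fc; suff : (0 <= \prod_(i < n | P i) f i)%E /\
    (\prod_(i < n | P i) f i <= (\prod_(i < n | P i) c i)%:E)%E by case.
elim/big_ind2: _ => // [x1 x2 y1 y2 [x10 x12] [y10 y12]|i /fc/andP[]//].
by split; [exact: mule_ge0|rewrite EFinM; exact: lee_pmul].
Qed.

(** Keep only the star of edges at p. *)
Lemma prod_pairs_le_pivot n (c : 'I_n -> 'I_n -> R) (p : 'I_n) :
  (forall i j, 0 <= c i j <= 1) -> (forall i j, c i j = c j i) ->
  \prod_(i < n) \prod_(j < n | (i < j)%N) c i j <= \prod_(j < n | j != p) c p j.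
Proof.
move=> c01 cC.
have c0 i j : 0 <= c i j by case/andP: (c01 i j).
have c1 i j : c i j <= 1 by case/andP: (c01 i j).
rewrite (bigD1 p)//= [leRHS](bigID (fun j : 'I_n => (p < j)%N))/=.
have E : \prod_(j < n | (j != p) && (p < j)%N) c p j = \prod_(j < n | (p < j)%N) c p j.
  by apply: eq_bigl => j; case: (ltngtP p j) => pj; rewrite ?andbF// ?andbT -?val_eqE//=; lia.
rewrite E; apply: ler_wpM2l; first exact: prodr_ge0.
rewrite (bigID (fun j : 'I_n => (p < j)%N))/= -[leRHS]mul1r.
apply: ler_pM.
- by apply: prodr_ge0 => i _; exact: prodr_ge0.
- by apply: prodr_ge0 => i _; exact: prodr_ge0.
- by apply: prodr_ile1 => i _; rewrite prodr_ge0//= prodr_ile1.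
apply: ler_prod => i /andP[ip pi]; rewrite prodr_ge0//=.
rewrite (bigD1 p)/=; last by move: ip pi; rewrite -val_eqE/=; lia.
by rewrite cC -[leRHS]mulr1 ler_wpM2l//; apply: prodr_ile1.
Qed.

(** The conditional probability that k vertices of weights y at positions x
    form a clique, for a distance [dist] that has absorbed the power d and the
    factor n mu. *)
Definition clique_prod g d k (dist : d.-tuple R -> d.-tuple R -> R)
    (y : k.-tuple R) (x : k.-tuple (d.-tuple R)) : R :=
  \prod_(i < k) \prod_(j < k | (i < j)%N)
     conn g (tnth y i * tnth y j) (dist (tnth x i) (tnth x j)).

Lemma clique_prod_ge0 g d k (dist : d.-tuple R -> d.-tuple R -> R) (y : k.-tuple R) x :
  0 <= clique_prod g dist y x.
Proof. by apply: prodr_ge0 => i _; apply: prodr_ge0 => j _; exact: conn_ge0. Qed.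

Lemma clique_prod_pivot g d k (dist : d.-tuple R -> d.-tuple R -> R) (y : k.-tuple R) x
    (p : 'I_k) : (forall u v, dist u v = dist v u) ->
  clique_prod g dist y x <=
  \prod_(j < k | j != p) conn g (tnth y p * tnth y j) (dist (tnth x p) (tnth x j)).
Proof.
move=> distC; apply: prod_pairs_le_pivot => i j; first by rewrite conn_ge0 conn_le1.
by rewrite mulrC distC.
Qed.

Lemma measurable_clique_prod g d k (dist : d.-tuple R -> d.-tuple R -> R) :
  measurable_fun setT (fun z : d.-tuple R * d.-tuple R => dist z.1 z.2) ->
  measurable_fun setT (fun z : k.-tuple R * k.-tuple (d.-tuple R) =>
    clique_prod g dist z.1 z.2).
Proof.
move=> mdist.
have m1 i : measurable_fun setT (fun z : k.-tuple R * k.-tuple (d.-tuple R) => tnth z.1 i).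
  exact: (measurableT_comp (measurable_tnth i) measurable_fst).
have m2 i : measurable_fun setT (fun z : k.-tuple R * k.-tuple (d.-tuple R) => tnth z.2 i).
  exact: (measurableT_comp (measurable_tnth i) measurable_snd).
apply: measurable_rprod => i; apply: measurable_rprod => j.
apply: (measurable_fun_comp2 (measurable_conn g)); first exact: measurable_funM.
exact: (measurable_fun_comp2 mdist).
Qed.

Lemma measurable_clique_prod_pos g d k (dist : d.-tuple R -> d.-tuple R -> R) (y : k.-tuple R) :
  measurable_fun setT (fun z : d.-tuple R * d.-tuple R => dist z.1 z.2) ->
  measurable_fun setT (fun x => (clique_prod g dist y x)%:E).
Proof.
move=> mdist; apply/measurable_EFinP.
by apply: (measurable_fun_comp2 (f := cst y) (measurable_clique_prod (k := k) g mdist)).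
Qed.

Definition torus_scaled a d (u v : d.-tuple R) := a * torus_dist u v ^+ d.

Lemma measurable_torus_scaled a d :
  measurable_fun setT (fun z : d.-tuple R * d.-tuple R => torus_scaled a z.1 z.2).
Proof.
by apply: measurable_funM => //; apply: measurable_funX; exact: measurable_torus_dist.
Qed.

Lemma torus_scaledC a d (u v : d.-tuple R) : torus_scaled a u v = torus_scaled a v u.
Proof. by rewrite /torus_scaled torus_distC. Qed.

(** The clique probability for given weights y, averaged over uniform positions
    on the torus; a stands for n mu. *)
Definition torus_clique g d k a (y : k.-tuple R) : \bar R :=
  (\int[mprod (@cube R d) k]_x (clique_prod g (@torus_scaled a d) y x)%:E)%E.

Lemma torus_clique_ge0 g d k a (y : k.-tuple R) : (0 <= torus_clique g d a y)%E.
Proof. by apply: integral_ge0 => x _; rewrite lee_fin clique_prod_ge0. Qed.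

Lemma measurable_torus_clique g d k a :
  measurable_fun setT (torus_clique (k := k) g d a).
Proof.
apply: measurable_integral_param.
  by apply/measurable_EFinP; apply: measurable_clique_prod; exact: measurable_torus_scaled.
by move=> y x; rewrite lee_fin clique_prod_ge0.
Qed.

(** Dilating the weights by a is compensated by replacing n mu with a^2. *)
Lemma torus_clique_scale g d k a (y : k.-tuple R) : 0 < a ->
  torus_clique g d (a ^+ 2) [tuple a * tnth y i | i < k] = torus_clique g d 1 y.
Proof.
move=> a0; apply: eq_integral => x _; congr EFin.
apply: eq_bigr => i _; apply: eq_bigr => j _.
rewrite /torus_scaled !tnth_mktuple conn_scale ?exprn_gt0// mul1r; congr conn.
by rewrite mulrACA -expr2 mulrAC divff ?mul1r// expf_neq0// gt_eqF.
Qed.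

Definition conn_const g d : R := (3 * conn_mass g) ^+ d.

Lemma conn_const_ge0 g d : 1 < g -> 0 <= conn_const g d.
Proof. by move=> g1; rewrite exprn_ge0// mulr_ge0// conn_mass_ge0. Qed.

(** Given the position of the pivot p, the other endpoints of its star are
    independent, and each is joined to p with probability at most the minimum
    of 1 and C y_p y_j / a. *)
Lemma torus_clique_pivot g d k a (y : k.-tuple R) (p : 'I_k) :
  1 < g -> (0 < d)%N -> 0 < a -> (forall i, 0 < tnth y i) ->
  (torus_clique g d a y <=
   (\prod_(j < k | j != p)
      Num.min 1 (conn_const g d * (tnth y p * tnth y j / a)))%:E)%E.
Proof.
move=> g1 d0 a0 y0.
pose phi (j : 'I_k) (s x : d.-tuple R) : \bar R :=
  (conn g (tnth y p * tnth y j) (torus_scaled a s x))%:E.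
have phi0 j s x : (0 <= phi j s x)%E by rewrite lee_fin conn_ge0.
have mphi j : measurable_fun setT (fun z : d.-tuple R * d.-tuple R => phi j z.1 z.2).
  by apply: measurable_conn1; exact: measurable_torus_scaled.
have mphi1 j s : measurable_fun setT (phi j s).
  exact: (measurable_fun_comp2 (f := cst s) (mphi j)).
have mI j : measurable_fun setT (fun s => (\int[cube d]_x phi j s x)%E).
  exact: measurable_integral_param.
apply: (@le_trans _ _ (\int[mprod (cube d) k]_x
    (1 * \prod_(j < k | j != p) phi j (tnth x p) (tnth x j)))%E).
  apply: ge0_le_integral => //.
  - by move=> x _; rewrite lee_fin clique_prod_ge0.
  - by apply: measurable_clique_prod_pos; exact: measurable_torus_scaled.
  - apply: emeasurable_funM => //; apply: measurable_eprod => j.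
    by apply: (measurable_fun_comp2 (mphi j)); exact: measurable_tnth.
  - move=> x _; rewrite mul1e prodEFin lee_fin; apply: clique_prod_pivot.
    exact: torus_scaledC.
rewrite (@integral_mprod_pivot _ _ _ (cube d) k p (cst 1%E) phi)//.
set c := (\prod_(j < k | j != p) _)%R.
have c0 : 0 <= c.
  apply: prodr_ge0 => j _; rewrite le_min ler01/= mulr_ge0 ?conn_const_ge0//.
  by rewrite divr_ge0 ?ltW// mulr_gt0.
apply: (@le_trans _ _ (\int[cube d]_s c%:E)%E).
  apply: (le_integral_supported (supported_cube d)) => //.
  - by apply: emeasurable_funM => //; apply: measurable_eprod.
  - by move=> s; rewrite mule_ge0//; apply: prode_ge0 => j _; exact: integral_ge0.
  - move=> s sc; rewrite mul1e; apply: prod_EFin_le_cond => j _.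
    rewrite integral_ge0//= /phi /torus_scaled.
    under eq_integral do rewrite conn_scale//.
    have [_|_] := leP 1 (conn_const g d * (tnth y p * tnth y j / a)).
      exact: integral_cube_conn_le1.
    by apply: integral_cube_conn => //; rewrite divr_gt0// mulr_gt0.
rewrite -[leRHS]mule1 -(cube_mass d) -ge0_integralZl//.
by apply: ge0_le_integral => // s _; rewrite ?mule1.
Qed.

End CliqueProd.

(** * From the torus to Euclidean space *)

Section SpaceLimit.
Context {R : realType}.
Implicit Types (g rho : R).

(** The torus blown up by the factor rho and cut open opposite to the base
    point. *)
Definition box rho d : set (d.-tuple R) := [set z | forall h, half_open_box rho (tnth z h)].
Arguments box : clear implicits.

(** The point of the torus with blown-up coordinates z around s. *)
Definition shift rho d (s z : d.-tuple R) : d.-tuple R :=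
  [tuple wrap (tnth s h + tnth z h / rho) | h < d].

(** The torus distance measured at the blown-up scale. It agrees with the
    maximum norm between points at distance at most rho / 2. *)
Definition rescaled_torus_dist rho d (u v : d.-tuple R) : R :=
  \big[Num.max/0]_(h < d) (rho * circle_dist (tnth u h / rho) (tnth v h / rho)).

Lemma mulr_bigmax (I : Type) (s : seq I) (f : I -> R) rho : 0 <= rho ->
  rho * \big[Num.max/0]_(i <- s) f i = \big[Num.max/0]_(i <- s) (rho * f i).
Proof.
move=> r0; elim: s => [|i s IH]; first by rewrite !big_nil mulr0.
by rewrite !big_cons maxr_pMr// IH.
Qed.

Lemma measurable_box rho d : measurable (box rho d).
Proof.
rewrite (_ : box _ _ = \bigcap_(i in [set: 'I_d]) ((fun t : d.-tuple R => tnth t i) @^-1` half_open_box rho)).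
  apply: fin_bigcap_measurable => // i _.
  by rewrite -[X in measurable X]setTI; apply: measurable_tnth => //; exact: measurable_itv.
apply/seteqP; split => t; first by move=> tA i _; exact: tA.
by move=> tA i; exact: tA.
Qed.

Lemma measurable_shift rho d (s : d.-tuple R) : measurable_fun setT (shift rho s).
Proof.
apply: measurable_mktuple => i; apply: (measurableT_comp measurable_wrap).
apply: measurable_funD => //; apply: measurable_funM => //; exact: measurable_tnth.
Qed.

Lemma measurable_rescaled_torus_dist rho d :
  measurable_fun setT (fun z : d.-tuple R * d.-tuple R => rescaled_torus_dist rho z.1 z.2).
Proof.
apply: measurable_bigmax => i; apply: measurable_funM => //.
apply: (measurable_fun_comp2 measurable_circle_dist); apply: measurable_funM => //.
  exact: (measurableT_comp (measurable_tnth i) measurable_fst).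
exact: (measurableT_comp (measurable_tnth i) measurable_snd).
Qed.

Lemma integral_cube_shift rho d (s : d.-tuple R) (f : d.-tuple R -> \bar R) :
  0 < rho -> in_cube s -> measurable_fun setT f -> (forall x, 0 <= f x)%E ->
  (\int[cube d]_x f x =
   \int[space d]_z (((rho ^- d) * \1_(box rho d) z)%:E * f (shift rho s z)))%E.
Proof.
move=> r0 sc mf f0.
rewrite (integral_mprod_subst (m' := lebT)
  (h := fun=> (fun z => (rho^-1 * \1_(half_open_box rho) z)%:E))
  (phi := fun h z => wrap (tnth s h + z / rho)))//.
- apply: eq_integral => z _; congr (_ * _)%E.
  rewrite prodEFin big_split/= prodr_const card_ord exprVn EFinM.
  by rewrite -[X in (_ * X)%E]prodEFin prod_indic.
- by move=> _; apply/measurable_EFinP; apply: measurable_funM => //; apply: measurable_indic; exact: measurable_itv.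
- by move=> _ x; rewrite lee_fin mulr_ge0// invr_ge0 ltW.
- move=> h; apply: (measurableT_comp measurable_wrap); apply: measurable_funD => //.
  exact: measurable_funM.
- move=> h u mu u0; apply: integral_wrap => //.
  by have := sc h; rewrite /= in_itv.
Qed.

Definition origin d : d.-tuple R := [tuple 0 | _ < d].

Lemma half_open_boxP rho x : 0 < rho -> half_open_box rho x -> -1 / 2 <= x / rho < 1 / 2.
Proof.
move=> r0; rewrite /half_open_box /= in_itv/= => /andP[x1 x2].
by rewrite ler_pdivlMr// ltr_pdivrMr//; lra.
Qed.

Lemma shift_dist_origin rho d (s z : d.-tuple R) : 0 < rho -> in_cube s -> box rho d z ->
  rho * torus_dist s (shift rho s z) = rescaled_torus_dist rho (origin d) z.
Proof.
move=> r0 sc zb; rewrite /torus_dist mulr_bigmax ?ltW//; apply: eq_bigr => h _.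
congr (_ * _); rewrite !tnth_mktuple.
have sh : 0 <= tnth s h <= 1 by have := sc h; rewrite /= in_itv.
have /andP[zh1 zh2] := half_open_boxP r0 (zb h).
rewrite circle_dist_wrapl//; last by rewrite zh1 ltW.
rewrite /circle_dist mul0r sub0r normrN min_l//.
have : `|tnth z h / rho| <= 1 / 2 by rewrite ler_norml; lra.
by lra.
Qed.

Lemma shift_dist rho d (s u v : d.-tuple R) : 0 < rho -> in_cube s ->
  box rho d u -> box rho d v ->
  rho * torus_dist (shift rho s u) (shift rho s v) = rescaled_torus_dist rho u v.
Proof.
move=> r0 sc ub vb; rewrite /torus_dist mulr_bigmax ?ltW//; apply: eq_bigr => h _.
congr (_ * _); rewrite !tnth_mktuple.
have /andP[u1 u2] := half_open_boxP r0 (ub h).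
have /andP[v1 v2] := half_open_boxP r0 (vb h).
rewrite circle_dist_wrap /circle_dist; last by rewrite ltr_norml; lra.
by have -> : tnth s h + tnth u h / rho - (tnth s h + tnth v h / rho) =
  tnth u h / rho - tnth v h / rho by lra.
Qed.

Lemma clique_prod_shift g rho d k (y : k.+1.-tuple R) (s : d.-tuple R)
    (z : k.-tuple (d.-tuple R)) : 0 < rho -> in_cube s ->
  (forall j, box rho d (tnth z j)) ->
  clique_prod g (@torus_scaled R (rho ^+ d) d) y
    [tuple of s :: [tuple shift rho s (tnth z j) | j < k]] =
  clique_prod g (fun u v => rescaled_torus_dist rho u v ^+ d) y
    [tuple of origin d :: z].
Proof.
move=> r0 sc zb; apply: eq_bigr => i _; apply: eq_bigr => j ij; congr conn.
rewrite /torus_scaled -exprMn; congr (_ ^+ _).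
case: (unliftP ord0 j) ij => [j' ->|-> //] ij.
rewrite !tnthS tnth_mktuple.
case: (unliftP ord0 i) ij => [i' ->|->] _.
  by rewrite !tnthS tnth_mktuple shift_dist.
by rewrite !tnth0 shift_dist_origin.
Qed.

Definition boxed_clique g rho d k (y : k.+1.-tuple R) (z : k.-tuple (d.-tuple R)) : \bar R :=
  ((\1_[set z : k.-tuple (d.-tuple R) | forall j, box rho d (tnth z j)] z)%:E *
   (clique_prod g (fun u v => rescaled_torus_dist rho u v ^+ d) y
     [tuple of origin d :: z])%:E)%E.

Lemma measurable_boxes rho d k :
  measurable [set z : k.-tuple (d.-tuple R) | forall j, box rho d (tnth z j)].
Proof.
rewrite (_ : mkset _ = \bigcap_(i in [set: 'I_k]) ((fun t : k.-tuple (d.-tuple R) => tnth t i) @^-1` box rho d)).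
  apply: fin_bigcap_measurable => // i _.
  by rewrite -[X in measurable X]setTI; apply: measurable_tnth => //; exact: measurable_box.
apply/seteqP; split => t; first by move=> tA i _; exact: tA.
by move=> tA i; exact: tA.
Qed.

Lemma measurable_boxed_clique g rho d k (y : k.+1.-tuple R) :
  measurable_fun setT (boxed_clique g rho (d := d) y).
Proof.
apply: emeasurable_funM; first by apply: measurable_EFin_indic; exact: measurable_boxes.
apply: (measurable_fun_cons1 (f := fun x => (clique_prod g (fun u v => rescaled_torus_dist rho u v ^+ d) y x)%:E)).
apply: measurable_clique_prod_pos; apply: measurable_funX.
exact: measurable_rescaled_torus_dist.
Qed.

Lemma boxed_clique_ge0 g rho d k (y : k.+1.-tuple R) z :
  (0 <= boxed_clique g rho (d := d) y z)%E.
Proof. by rewrite mule_ge0// lee_fin// clique_prod_ge0. Qed.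

(** Take the first vertex as the base point. By translation invariance its
    position integrates to 1, and each of the k others contributes the
    Jacobian rho^-d. *)
Lemma torus_clique_shift g rho d k (y : k.+1.-tuple R) : 0 < rho ->
  torus_clique g d (rho ^+ d) y =
  (((rho ^+ d) ^- k)%:E * \int[mprod (space d) k]_z boxed_clique g rho y z)%E.
Proof.
move=> r0.
set F := fun x => (clique_prod g (@torus_scaled R (rho ^+ d) d) y x)%:E.
have mF : measurable_fun setT F.
  by apply: measurable_clique_prod_pos; exact: measurable_torus_scaled.
have F0 x : (0 <= F x)%E by rewrite lee_fin clique_prod_ge0.
have rd0 : 0 < rho ^+ d by rewrite exprn_gt0.
have rdk0 : 0 <= (rho ^+ d) ^- k by rewrite invr_ge0 exprn_ge0// ltW.
have mb := @measurable_boxed_clique g rho d k y.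
have b0 := @boxed_clique_ge0 g rho d k y.
rewrite /torus_clique -/F integral_mprodS//.
rewrite -[RHS]mule1 -(cube_mass d) -ge0_integralZl//; last first.
  by rewrite mule_ge0// integral_ge0.
apply: (eq_integral_supported (supported_cube d)) => //.
- exact: (@measurable_integral_mprod_cons _ _ _ (cube d) k F).
- by move=> x; apply: integral_ge0 => t _; exact: F0.
- by move=> _; rewrite mule1 mule_ge0// integral_ge0.
(* s is the position of the first vertex; the inner integral does not depend on it *)
move=> s sc; rewrite mule1.
rewrite (integral_mprod_subst (m' := space d)
  (h := fun=> (fun z => ((rho ^- d) * \1_(box rho d) z)%:E))
  (phi := fun _ z => shift rho s z)); last 6 first.
- move=> _; apply/measurable_EFinP; apply: measurable_funM => //.
  by apply: measurable_indic; exact: measurable_box.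
- by move=> _ x; rewrite lee_fin mulr_ge0// invr_ge0 ltW.
- by move=> _; exact: measurable_shift.
- by move=> _ f mf f0; exact: integral_cube_shift.
- exact: (measurable_fun_cons1 s mF).
- by move=> t; exact: F0.
rewrite -ge0_integralZl//; apply: eq_integral => z _.
rewrite prodEFin big_split/= prodr_const card_ord exprVn EFinM -muleA.
congr (_ * _)%E; rewrite -prodEFin prod_indic /boxed_clique /F.
rewrite indicE; case: (boolP (z \in _)) => [/set_mem zb|_]; last by rewrite !mul0e.
by rewrite !mul1e clique_prod_shift.
Qed.

(** The inner integral of J_G: the clique probability for weights y when one
    vertex sits at the origin and the others are spread over R^d with Lebesgue
    intensity. *)
Definition space_clique g d k (y : k.+1.-tuple R) : \bar R :=
  (\int[mprod (space d) k]_z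
    (clique_prod g (fun u v => linf_dist u v ^+ d) y [tuple of origin d :: z])%:E)%E.

Lemma rescaled_torus_dist_linf rho d (u v : d.-tuple R) : 0 < rho ->
  (forall h, `|tnth u h - tnth v h| <= rho / 2) ->
  rescaled_torus_dist rho u v = linf_dist u v.
Proof.
move=> r0 uv; apply: eq_bigr => h _; rewrite /circle_dist -mulrBl normrM.
rewrite (gtr0_norm (x := rho^-1)) ?invr_gt0//.
have h2 : `|tnth u h - tnth v h| / rho <= 1 / 2.
  by rewrite ler_pdivrMr//; have := uv h; lra.
rewrite min_l; last by lra.
by rewrite mulrCA divff ?mulr1// gt_eqF.
Qed.

(** Bound by the star centred at the base point, where the torus distance to
    the origin is exactly the maximum norm inside the box. The bound does not
    depend on rho. *)
Lemma boxed_clique_le g rho d k (y : k.+1.-tuple R) z : 0 < rho ->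
  (boxed_clique g rho (d := d) y z <=
   \prod_(j < k) (conn g (thead y * tnth y (lift ord0 j))
      (linf_dist (origin d) (tnth z j) ^+ d))%:E)%E.
Proof.
move=> r0; rewrite /boxed_clique indicE.
case: (boolP (z \in _)) => [/set_mem zb|_]; last first.
  by rewrite mul0e; apply: prode_ge0 => j _; rewrite lee_fin conn_ge0.
rewrite mul1e prodEFin lee_fin.
apply: (le_trans (@clique_prod_pivot _ g d _ _ y _ ord0 _)).
  move=> u v; rewrite /rescaled_torus_dist; congr (_ ^+ _).
  by apply: eq_bigr => h _; rewrite circle_distC.
rewrite big_mkcond big_ord_recl/= mul1r; apply: ler_prod => j _ /=.
rewrite conn_ge0 !tnth0 tnthS rescaled_torus_dist_linf//; first exact: lexx.
move=> h; rewrite tnth_mktuple sub0r normrN.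
have /andP[z1 z2] := half_open_boxP r0 (zb j h).
by move: z1 z2; rewrite ler_pdivlMr// ltr_pdivrMr// => z1 z2; rewrite ler_norml; lra.
Qed.

(** For fixed z, all the points and their differences lie well inside the box
    once rho is large, and then the torus does not differ from R^d. *)
Lemma boxed_clique_eventually g d k (y : k.+1.-tuple R) (z : k.-tuple (d.-tuple R)) :
  exists M : R, forall rho, M < rho -> boxed_clique g rho y z =
    (clique_prod g (fun u v => linf_dist u v ^+ d) y [tuple of origin d :: z])%:E.
Proof.
pose zz := [tuple of origin d :: z].
pose S := \sum_(j < k.+1) \sum_(h < d) `|tnth (tnth zz j) h|.
have zS j h : `|tnth (tnth zz j) h| <= S.
  rewrite /S (bigD1 j)//= (bigD1 h)//= -addrA lerDl addr_ge0//.
    exact: sumr_ge0.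
  by apply: sumr_ge0 => i _; exact: sumr_ge0.
have S0 : 0 <= S by apply: sumr_ge0 => i _; exact: sumr_ge0.
(* all coordinates are at most S in absolute value, and their differences at most 2 * S *)
exists (4 * S) => rho Sr.
have r0 : 0 < rho by lra.
have zb j : box rho d (tnth z j).
  move=> h; rewrite /half_open_box/= in_itv/=.
  have := zS (lift ord0 j) h; rewrite tnthS ler_norml; lra.
rewrite /boxed_clique indicE mem_set// mul1e; congr EFin.
apply: eq_bigr => i _; apply: eq_bigr => j _; congr (conn _ _ (_ ^+ _)).
apply: rescaled_torus_dist_linf => // h.
have := zS i h; have := zS j h; rewrite -/zz.
have := ler_normB (tnth (tnth zz i) h) (tnth (tnth zz j) h); lra.
Qed.

(** Blow up by rho = a^(1/d). The rescaled integrand is eventually constant at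
    each point, and dominated by the star product at the base point, which is
    integrable because the one-edge probability is (this is where g > 1
    enters). *)
Lemma cvg_torus_clique g d k (y : k.+1.-tuple R) (a : R^nat) :
  1 < g -> (0 < d)%N -> (forall i, 0 < tnth y i) ->
  (forall n, 0 < a n) -> a @ \oo --> +oo ->
  ((a n ^+ k)%:E * torus_clique g d (a n) y)%E @[n --> \oo] --> space_clique g d y.
Proof.
move=> g1 d0 y0 a0 aoo.
pose rho n := a n `^ (d%:R^-1).
have r0 n : 0 < rho n by rewrite powR_gt0.
have rE n : rho n ^+ d = a n.
  rewrite -powR_mulrn ?powR_ge0// -powRrM mulVf ?powRr1 ?ltW//.
  by rewrite pnatr_eq0 -lt0n.
have -> : (fun n => (a n ^+ k)%:E * torus_clique g d (a n) y)%E =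
    (fun n => \int[mprod (space d) k]_z boxed_clique g (rho n) y z)%E.
  apply/funext => n; rewrite -[in torus_clique _ _ _ _](rE n) torus_clique_shift// rE.
  by rewrite muleA -EFinM divff ?mul1e// expf_neq0// gt_eqF.
pose D (z : k.-tuple (d.-tuple R)) := (\prod_(j < k) (conn g (thead y * tnth y (lift ord0 j))
      (linf_dist (origin d) (tnth z j) ^+ d))%:E)%E.
have mc j : measurable_fun setT (fun u : d.-tuple R =>
    (conn g (thead y * tnth y (lift ord0 j)) (linf_dist (origin d) u ^+ d))%:E).
  apply: measurable_conn1; apply: measurable_funX.
  by apply: (measurable_fun_comp2 (f := cst (origin d)) (@measurable_linf_dist R d)).
have mD : measurable_fun setT D.
  by apply: measurable_eprod => j; exact: (measurable_tnth_comp j (mc j)).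
have D0 z : (0 <= D z)%E by apply: prode_ge0 => j _; rewrite lee_fin conn_ge0.
have iD : (mprod (space d) k).-integrable setT D.
  apply/integrableP; split => //.
  under eq_integral do rewrite gee0_abs//.
  rewrite (integral_mprod_prod (space d) (f := fun j u =>
    (conn g (thead y * tnth y (lift ord0 j)) (linf_dist (origin d) u ^+ d))%:E))//; last first.
    by move=> j u; rewrite lee_fin conn_ge0.
  apply: le_lt_trans (ltry _).
  apply: (prod_EFin_le_cond (c := fun j => conn_mass g ^+ d * (thead y * tnth y (lift ord0 j)))).
  move=> j _; rewrite integral_ge0/=; last by move=> u _; rewrite lee_fin conn_ge0.
  by apply: integral_space_conn => //; apply: mulr_gt0; exact: y0.
have rhoM (M : R) : \forall n \near \oo, M < rho n.
  have M0 : 0 <= Num.max M 0 by rewrite le_max lexx orbT.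
  have /cvgryPgt/(_ (Num.max M 0 ^+ d)) := aoo.
  apply: filterS => n.
  rewrite -(rE n) ltr_pXn2r ?nnegrE ?(ltW (r0 n))//.
  by rewrite gt_max => /andP[].
have mf n : measurable_fun setT (boxed_clique g (rho n) (d := d) y).
  exact: measurable_boxed_clique.
have mF : measurable_fun setT (fun z : k.-tuple (d.-tuple R) =>
    (clique_prod g (fun u v => linf_dist u v ^+ d) y [tuple of origin d :: z])%:E).
  apply: (measurable_fun_cons1 (f := fun x => (clique_prod g (fun u v => linf_dist u v ^+ d) y x)%:E)).
  apply: measurable_clique_prod_pos; apply: measurable_funX.
  exact: measurable_linf_dist.
pose F (z : k.-tuple (d.-tuple R)) :=
  (clique_prod g (fun u v => linf_dist u v ^+ d) y [tuple of origin d :: z])%:E.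
have cv z : boxed_clique g (rho n) y z @[n --> \oo] --> F z.
  apply: cvg_near_cst; have [M HM] := boxed_clique_eventually g y z.
  by apply: filterS (rhoM M) => n; exact: HM.
have dom z n : (`|boxed_clique g (rho n) y z| <= D z)%E.
  by rewrite gee0_abs; [exact: boxed_clique_le|exact: boxed_clique_ge0].
have [_ _] := @dominated_convergence _ _ R (mprod (space d) k) setT measurableT
  (fun n => boxed_clique g (rho n) y) F D mf mF
  (aeW _ (fun z _ => cv z)) iD (aeW _ (fun z n _ => dom z n)).
exact.
Qed.

End SpaceLimit.

(** * Dominating functions: stars around the vertex of least weight *)

Section Weights.
Context {R : realType}.
Implicit Types (g tau : R).

Lemma dominated_convergence_supported d (T : measurableType d)
    (m : {measure set T -> \bar R}) (S : set T) (f_ : (T -> \bar R)^nat)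
    (f h : T -> \bar R) :
  supported m S ->
  (forall n, measurable_fun setT (f_ n)) -> measurable_fun setT f ->
  measurable_fun setT h ->
  (forall n x, 0 <= f_ n x)%E -> (forall x, 0 <= f x)%E -> (forall x, 0 <= h x)%E ->
  (\int[m]_x h x < +oo)%E ->
  (forall n x, S x -> f_ n x <= h x)%E ->
  (forall x, S x -> f_ n x @[n --> \oo] --> f x)%E ->
  (\int[m]_x f x < +oo)%E /\
  (\int[m]_x f_ n x)%E @[n --> \oo] --> (\int[m]_x f x)%E.
Proof.
move=> [mS mE] mf_ mf mh f_0 f0 h0 hoo f_h cf.
have mEr (u : T -> \bar R) : measurable_fun setT u -> (forall x, 0 <= u x)%E ->
    (\int[m]_x u x = \int[m]_(x in S) u x)%E.
  move=> mu u0; rewrite mE// [RHS]integral_mkcond; apply: eq_integral => x _.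
  by rewrite /patch indicE; case: ifP; rewrite ?mul1e ?mul0e.
rewrite mEr//; have -> : (fun n => \int[m]_x f_ n x)%E = (fun n => \int[m]_(x in S) f_ n x)%E.
  by apply/funext => n; rewrite mEr.
have ih : m.-integrable S h.
  apply/integrableP; split; first exact: measurable_funTS.
  by under eq_integral do rewrite gee0_abs//; rewrite -mEr.
have [iF _ cF] := @dominated_convergence _ _ R m S mS f_ f h
  (fun n => measurable_funTS (mf_ n)) (measurable_funTS mf)
  (aeW _ (fun x Sx => cf x Sx)) ih
  (aeW _ (fun x n Sx => etrans (congr1 (fun u => (u <= h x)%E) (gee0_abs (f_0 n x))) (f_h n x Sx))).
split => //.
by move/integrableP : iF => [_]; under eq_integral do rewrite gee0_abs//.
Qed.

Section Argmin.
Variables (k : nat) (tau : R) (beta : R -> R -> R).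
Hypothesis mbeta : measurable_fun setT (fun z : R * R => beta z.1 z.2).
Hypothesis beta0 : forall s t, 0 <= beta s t.

(** The contribution of a vertex of weight t to a star centred at a vertex of
    weight s <= t. *)
Definition argmin_factor (s t : R) : \bar R :=
  ((if s <= t then t `^ (- tau) * beta s t else 0)%:E).

(** The sum over the k possible positions p of the least weight. Each summand
    is a product over a star, so its integral factorises given y_p. *)
Definition argmin_bound (y : k.-tuple R) : \bar R :=
  (\sum_(p < k) ((tnth y p `^ (- tau))%:E *
     \prod_(j < k | j != p) argmin_factor (tnth y p) (tnth y j)))%E.

Lemma argmin_factor_ge0 s t : (0 <= argmin_factor s t)%E.
Proof. by rewrite lee_fin; case: ifP => // _; rewrite mulr_ge0// powR_ge0. Qed.

Lemma measurable_argmin_factor :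
  measurable_fun setT (fun z : R * R => argmin_factor z.1 z.2).
Proof.
apply/measurable_EFinP; apply: measurable_fun_ifT => //.
  exact: measurable_fun_ler.
by apply: measurable_funM => //; apply: (measurableT_comp (measurable_powR _)).
Qed.

Lemma argmin_bound_ge0 y : (0 <= argmin_bound y)%E.
Proof.
apply: sume_ge0 => p _; rewrite mule_ge0 ?lee_fin ?powR_ge0//.
by apply: prode_ge0 => j _; exact: argmin_factor_ge0.
Qed.

Let measurable_term p : measurable_fun setT (fun y : k.-tuple R =>
  ((tnth y p `^ (- tau))%:E *
     \prod_(j < k | j != p) argmin_factor (tnth y p) (tnth y j))%E).
Proof.
apply: emeasurable_funM.
  apply/measurable_EFinP; apply: (measurableT_comp (measurable_powR _)).
  exact: measurable_tnth.
apply: measurable_eprod => j.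
by apply: (measurable_fun_comp2 measurable_argmin_factor); exact: measurable_tnth.
Qed.

Lemma measurable_argmin_bound : measurable_fun setT argmin_bound.
Proof. by apply: emeasurable_sum => p; exact: measurable_term. Qed.

Lemma prod_powR (y : k.-tuple R) : (forall i, 0 < tnth y i) ->
  (\prod_(i < k) tnth y i) `^ (- tau) = \prod_(i < k) (tnth y i `^ (- tau)).
Proof.
move=> y0; suff : 0 <= \prod_(i < k) tnth y i /\
  (\prod_(i < k) tnth y i) `^ (- tau) = \prod_(i < k) (tnth y i `^ (- tau)) by case.
elim/big_rec2: _ => [|i u v _ [v0 IH]]; first by rewrite powR1.
split; first by rewrite mulr_ge0// ltW.
by rewrite powRM// ?IH// ltW.
Qed.

(** A clique is dominated by its star centred at the vertex of least weight, for
    which all the other weights t satisfy t >= s. This restriction makes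
    the integrals over the other weights converge near 0, where t^-tau alone is
    not integrable. *)
Lemma le_argmin_bound (h : \bar R) (y : k.-tuple R) : (0 < k)%N ->
  (forall i, 0 < tnth y i) -> (0 <= h)%E ->
  (forall p, h <= (\prod_(j < k | j != p) beta (tnth y p) (tnth y j))%:E)%E ->
  (((\prod_(i < k) tnth y i) `^ (- tau))%:E * h <= argmin_bound y)%E.
Proof.
move=> k0 y0 h0 hb.
pose p := [arg min_(i < (Ordinal k0)) tnth y i]%O.
have pmin j : tnth y p <= tnth y j.
  by rewrite /p; case: arg_minP => // i _ /(_ j); exact.
apply: (@le_trans _ _ ((tnth y p `^ (- tau))%:E *
     \prod_(j < k | j != p) argmin_factor (tnth y p) (tnth y j))%E); last first.
  rewrite [leRHS](bigD1 p)//= leeDl// sume_ge0// => q _.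
  rewrite mule_ge0 ?lee_fin ?powR_ge0//.
  by apply: prode_ge0 => j _; exact: argmin_factor_ge0.
rewrite prod_powR// (bigD1 p)//= EFinM -muleA lee_pmul2l//; last first.
  by rewrite lte_fin powR_gt0.
apply: (@le_trans _ _ ((\prod_(i < k | i != p) tnth y i `^ (- tau))%:E *
  (\prod_(j < k | j != p) beta (tnth y p) (tnth y j))%:E)%E).
  by rewrite lee_pmul// lee_fin prodr_ge0// => i _; rewrite powR_ge0.
rewrite -EFinM -big_split/= prodEFin lee_fin le_eqVlt; apply/orP; left; apply/eqP.
by apply: eq_bigr => j _; rewrite pmin.
Qed.

Lemma integral_argmin_bound (M : {sigma_finite_measure set R -> \bar R}) :
  (\int[mprod M k]_y argmin_bound y =
   \sum_(p < k) \int[M]_s ((s `^ (- tau))%:E *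
     \prod_(j < k | j != p) \int[M]_t argmin_factor s t))%E.
Proof.
rewrite ge0_integral_sum//; last first.
  move=> p y _; rewrite mule_ge0 ?lee_fin ?powR_ge0//.
  by apply: prode_ge0 => j _; exact: argmin_factor_ge0.
apply: eq_bigr => p _.
rewrite (@integral_mprod_pivot _ _ _ M k p (fun s => (s `^ (- tau))%:E)
  (fun=> argmin_factor))//.
- by apply/measurable_EFinP; exact: measurable_powR.
- by move=> x; rewrite lee_fin powR_ge0.
- by move=> _; exact: measurable_argmin_factor.
- by move=> _; exact: argmin_factor_ge0.
Qed.

End Argmin.

Lemma integral_leb_on_tail (D : set R) (mD : measurable D) (p s c : R) :
  1 < p -> 0 < s -> 0 <= c ->
  (\int[leb_on mD]_t (if s <= t then c * t `^ (- p) else 0)%:E <=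
   (c * (s `^ (1 - p) / (p - 1)))%:E)%E.
Proof.
move=> p1 s0 c0.
have c0' t : (0 <= (if s <= t then c * t `^ (- p) else 0)%:E)%E.
  by rewrite lee_fin; case: ifP => // _; rewrite mulr_ge0// powR_ge0.
have mc : measurable_fun setT (fun t : R => (if s <= t then c * t `^ (- p) else 0)%:E).
  apply/measurable_EFinP; apply: measurable_fun_ifT => //; first exact: measurable_fun_ler.
  by apply: measurable_funM => //; exact: measurable_powR.
apply: (@le_trans _ _ (\int[lebesgue_measure]_t (if s <= t then c * t `^ (- p) else 0)%:E)%E).
  rewrite integral_leb_on_lebT// -integral_lebT//.
  apply: ge0_le_integral => //.
  - by move=> t _; rewrite mule_ge0// lee_fin.
  - by apply: emeasurable_funM => //; exact: measurable_EFin_indic.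
  - move=> t _; rewrite -[leRHS]mul1e lee_wpmul2r// lee_fin indicE.
    by case: (_ \in _).
rewrite EFinM -integral_powR_pinfty// -ge0_integralZl//; last 2 first.
- by apply: measurable_funTS; apply/measurable_EFinP; exact: measurable_powR.
- by move=> t _; rewrite lee_fin powR_ge0.
rewrite [leRHS]integral_mkcond le_eqVlt; apply/orP; left; apply/eqP.
apply: eq_integral => t _; rewrite /patch mem_setE in_itv/= andbT.
by case: ifP.
Qed.

End Weights.

(** * Finiteness of the dominating integrals *)

Section Limits.
Context {R : realType}.
Implicit Types (g tau C s t : R).

Definition leb_pos : {sigma_finite_measure set R -> \bar R} :=
  leb_on (measurable_itv `]0%R, +oo[ : measurable (`]0%R, +oo[%classic : set R)).

Definition leb_ge (w0 : R) : {sigma_finite_measure set R -> \bar R} :=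
  leb_on (measurable_itv `[w0, +oo[ : measurable (`[w0, +oo[%classic : set R)).

(** Upper bounds for the probability of an edge between weights s and t, with
    the factor n mu scaled away: [abs_prod] is used when the weights stay bounded and
    [abs_prod1], cut off at 1, when they are of order sqrt (n mu). The absolute
    value makes them nonnegative on the whole line. *)
Definition abs_prod C s t := C * `|s * t|.
Definition abs_prod1 C s t := Num.min 1 (C * `|s * t|).

Lemma abs_prod_ge0 C s t : 0 <= C -> 0 <= abs_prod C s t.
Proof. by move=> C0; rewrite mulr_ge0. Qed.

Lemma abs_prod1_ge0 C s t : 0 <= C -> 0 <= abs_prod1 C s t.
Proof. by move=> C0; rewrite le_min ler01 mulr_ge0. Qed.

Lemma measurable_abs_prod C : measurable_fun setT (fun z : R * R => abs_prod C z.1 z.2).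
Proof.
by apply: measurable_funM => //; apply: measurableT_comp => //; exact: measurable_funM.
Qed.

Lemma measurable_abs_prod1 C : measurable_fun setT (fun z : R * R => abs_prod1 C z.1 z.2).
Proof. by apply: measurable_minr => //; exact: measurable_abs_prod. Qed.

Section Tail.
Variables (D : set R) (mD : measurable D) (tau C : R).
Hypotheses (tau2 : 2 < tau) (C0 : 0 <= C).

Lemma powR_mull s q : 0 < s -> s `^ q * s = s `^ (q + 1).
Proof.
move=> s0; rewrite powRD ?powRr1 ?ltW//.
by apply/implyP => _; rewrite gt_eqF.
Qed.

Lemma argmin_factor_prod_tail (beta : R -> R -> R) s : 0 < s ->
  measurable_fun setT (fun z : R * R => beta z.1 z.2) ->
  (forall s t, 0 <= beta s t) -> (forall s t, beta s t <= abs_prod C s t) ->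
  (\int[leb_on mD]_t argmin_factor tau beta s t <=
    ((C / (tau - 2)) * s `^ (3 - tau))%:E)%E.
Proof.
move=> s0 mb b0 bC; have h2 := tau2.
have C1 : 0 <= C * s by rewrite mulr_ge0// ltW.
have p1 : 1 < tau - 1 by lra.
have := integral_leb_on_tail mD p1 s0 C1.
have -> : C * s * (s `^ (1 - (tau - 1)) / (tau - 1 - 1)) = C / (tau - 2) * s `^ (3 - tau).
  have -> : 3 - tau = (1 - (tau - 1)) + 1 by lra.
  have -> : tau - 1 - 1 = tau - 2 by lra.
  by rewrite -powR_mull//; ring.
apply: le_trans; apply: ge0_le_integral => //.
- by move=> t _; rewrite argmin_factor_ge0.
- exact: (measurable_fun_comp2 (f := cst s) (measurable_argmin_factor tau mb)).
- apply/measurable_EFinP; apply: measurable_fun_ifT => //; first exact: measurable_fun_ler.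
  by apply: measurable_funM => //; exact: measurable_powR.
- move=> t _; rewrite /argmin_factor lee_fin; case: ifP => // st.
  have t0 : 0 < t := lt_le_trans s0 st.
  have -> : - (tau - 1) = - tau + 1 by lra.
  rewrite -powR_mull// mulrC -mulrA.
  apply: (@le_trans _ _ (C * (s * t) * t `^ (- tau))).
    rewrite ler_wpM2r ?powR_ge0//; apply: (le_trans (bC _ _)).
    by rewrite /abs_prod ger0_norm// mulr_ge0// ltW.
  by rewrite -!mulrA (mulrC t).
Qed.

Lemma argmin_factor_one_tail s : 0 < s ->
  (\int[leb_on mD]_t argmin_factor tau (abs_prod1 C) s t <=
    ((tau - 1)^-1 * s `^ (1 - tau))%:E)%E.
Proof.
move=> s0; have h2 := tau2.
have p1 : 1 < tau by lra.
have := integral_leb_on_tail mD p1 s0 ler01.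
rewrite mul1r (mulrC (s `^ _)).
apply: le_trans; apply: ge0_le_integral => //.
- by move=> t _; rewrite argmin_factor_ge0//; move=> *; exact: abs_prod1_ge0.
- exact: (measurable_fun_comp2 (f := cst s) (measurable_argmin_factor tau (measurable_abs_prod1 C))).
- apply/measurable_EFinP; apply: measurable_fun_ifT => //; first exact: measurable_fun_ler.
  by apply: measurable_funM => //; exact: measurable_powR.
- move=> t _; rewrite /argmin_factor lee_fin; case: ifP => // st.
  by rewrite mul1r -[leRHS]mulr1 ler_wpM2l ?powR_ge0// ge_min lexx.
Qed.

End Tail.

Lemma powR_exprn (s q : R) n : 0 < s -> (s `^ q) ^+ n = s `^ (q * n%:R).
Proof. by move=> s0; rewrite -powR_mulrn ?powR_ge0// powRrM. Qed.

Lemma prod_neq_const (k : nat) (p : 'I_k) (c : R) :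
  \prod_(j < k | j != p) c = c ^+ k.-1.
Proof. by rewrite prodr_const cardC1 card_ord. Qed.

Lemma argmin_term_le tau K e s (k : nat) (p : 'I_k) (Phi : \bar R) :
  0 < s -> (0 <= Phi)%E -> (Phi <= (K * s `^ e)%:E)%E ->
  ((s `^ (- tau))%:E * \prod_(j < k | j != p) Phi <=
   (K ^+ k.-1)%:E * (s `^ (- tau + e * k.-1%:R))%:E)%E.
Proof.
move=> s0 Phi0 PhiK.
apply: (@le_trans _ _ ((s `^ (- tau))%:E * (\prod_(j < k | j != p) (K * s `^ e))%:E)%E).
  by apply: lee_wpmul2l; rewrite ?lee_fin ?powR_ge0//; apply: prod_EFin_le_cond => j _; rewrite Phi0.
rewrite prod_neq_const exprMn powR_exprn// -!EFinM lee_fin mulrCA -powRD//.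
by apply/implyP => _; rewrite gt_eqF.
Qed.

Lemma measurable_argmin_term tau (beta : R -> R -> R)
    (M : {sigma_finite_measure set R -> \bar R}) (k : nat) (p : 'I_k) :
  measurable_fun setT (fun z : R * R => beta z.1 z.2) ->
  (forall s t, 0 <= beta s t) ->
  measurable_fun setT (fun s => (s `^ (- tau))%:E *
     \prod_(j < k | j != p) \int[M]_t argmin_factor tau beta s t)%E.
Proof.
move=> mb b0; apply: emeasurable_funM.
  by apply/measurable_EFinP; exact: measurable_powR.
apply: measurable_eprod => j; apply: measurable_integral_param.
  exact: measurable_argmin_factor.
by move=> *; exact: argmin_factor_ge0.
Qed.

Lemma argmin_term_ge0 tau (beta : R -> R -> R)
    (M : {sigma_finite_measure set R -> \bar R}) (k : nat) (p : 'I_k) s :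
  (forall s t, 0 <= beta s t) ->
  (0 <= (s `^ (- tau))%:E *
     \prod_(j < k | j != p) \int[M]_t argmin_factor tau beta s t)%E.
Proof.
move=> b0; rewrite mule_ge0 ?lee_fin ?powR_ge0//; apply: prode_ge0 => j _.
by apply: integral_ge0 => t _; exact: argmin_factor_ge0.
Qed.

Lemma measurable_cst_powR (D : set R) (c q : R) : measurable D ->
  measurable_fun D (fun s : R => (c%:E * (s `^ q)%:E)%E).
Proof.
move=> mD; apply: measurable_funTS; apply: emeasurable_funM => //.
by apply/measurable_EFinP; exact: measurable_powR.
Qed.

(** With the other weights integrated over [s, +oo[, the least weight s carries
    the exponent -tau + (3 - tau)(k - 1) = (3 - tau) k - 3, which is below -1
    exactly when (3 - tau) k < 2. *)
Lemma argmin_bound_ge_lty tau w0 C k : 2 < tau -> 0 < w0 -> 0 <= C -> (0 < k)%N ->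
  (3 - tau) * k%:R < 2 ->
  (\int[mprod (leb_ge w0) k]_y argmin_bound tau (abs_prod C) y < +oo)%E.
Proof.
move=> tau2 w00 C0 k0 kt.
have b0 s t := abs_prod_ge0 s t C0.
rewrite integral_argmin_bound//; last exact: measurable_abs_prod.
apply: lte_sum_pinfty => p _.
rewrite integral_leb_on//; last 2 first.
- by apply: measurable_argmin_term => //; exact: measurable_abs_prod.
- by move=> s; exact: argmin_term_ge0.
set K := C / (tau - 2).
have E : - tau + (3 - tau) * k.-1%:R = - (3 - (3 - tau) * k%:R).
  by rewrite -{2}(prednK k0) -natr1; ring.
have p1 : 1 < 3 - (3 - tau) * k%:R by lra.
apply: (@le_lt_trans _ _ (\int[lebesgue_measure]_(s in `[w0, +oo[)
   ((K ^+ k.-1)%:E * (s `^ (- (3 - (3 - tau) * k%:R)))%:E))%E).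
  apply: ge0_le_integral => //.
  - by move=> s _; exact: argmin_term_ge0.
  - by apply: measurable_funTS; apply: measurable_argmin_term => //; exact: measurable_abs_prod.
  - exact: measurable_cst_powR.
  - move=> s; rewrite /= in_itv/= andbT => w0s; have s0 := lt_le_trans w00 w0s.
    rewrite -E; apply: argmin_term_le => //.
      by apply: integral_ge0 => t _; exact: argmin_factor_ge0.
    by apply: argmin_factor_prod_tail => //; exact: measurable_abs_prod.
rewrite ge0_integralZl//; last 3 first.
- by apply: measurable_funTS; apply/measurable_EFinP; exact: measurable_powR.
- by move=> s _; rewrite lee_fin powR_ge0.
- by rewrite lee_fin exprn_ge0// divr_ge0// subr_ge0 ltW.
by rewrite integral_powR_pinfty// -EFinM ltry.
Qed.

(** Near 0 the least weight carries the exponent (3 - tau) k - 3 as in the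
    previous case, now integrable because (3 - tau) k > 2. Near infinity the
    edge probabilities are bounded by 1 and the exponent is
    -tau - (tau - 1)(k - 1) < -1. *)
Lemma argmin_bound_pos_lty tau C k : 2 < tau -> 0 <= C -> (0 < k)%N ->
  2 < (3 - tau) * k%:R ->
  (\int[mprod leb_pos k]_y argmin_bound tau (abs_prod1 C) y < +oo)%E.
Proof.
move=> tau2 C0 k0 kt.
have b0 s t := abs_prod1_ge0 s t C0.
rewrite integral_argmin_bound//; last exact: measurable_abs_prod1.
apply: lte_sum_pinfty => p _.
set F := fun s => _.
have mF : measurable_fun setT F.
  by apply: measurable_argmin_term => //; exact: measurable_abs_prod1.
have F0 s : (0 <= F s)%E by exact: argmin_term_ge0.
have I0 s : (0 <= \int[leb_pos]_t argmin_factor tau (abs_prod1 C) s t)%E.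
  by apply: integral_ge0 => t _; exact: argmin_factor_ge0.
rewrite integral_leb_on//.
have -> : `]0, +oo[%classic = `]0, 1]%classic `|` `]1, +oo[%classic :> set R.
  apply/seteqP; split => x /=; rewrite !in_itv/= ?andbT.
    by move=> ->; apply/orP; case: leP.
  by move=> [/andP[]//|]; exact: lt_trans.
have dis : [disjoint (`]0, 1]%classic : set R) & `]1, +oo[%classic].
  apply/disj_setPS => x [] /=; rewrite !in_itv/= andbT => /andP[_ x1] x2.
  by move: (le_lt_trans x1 x2); rewrite ltxx.
rewrite (@ge0_integral_setU _ (measurableTypeR R) R lebesgue_measure _ _
  (measurable_itv _) (measurable_itv _) F (measurable_funTS mF) (fun x _ => F0 x) dis).
(* first the integral over ]0, 1], then the one over ]1, +oo[ *)
apply: lte_add_pinfty.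
  set K := C / (tau - 2).
  have E : - tau + (3 - tau) * k.-1%:R = (3 - tau) * k%:R - 3.
    by rewrite -{2}(prednK k0) -natr1; ring.
  apply: (@le_lt_trans _ _ (\int[lebesgue_measure]_(s in `]0%R, 1%R])
     ((K ^+ k.-1)%:E * (s `^ ((3 - tau) * k%:R - 3))%:E))%E).
    apply: ge0_le_integral => //.
    - exact: measurable_funTS.
    - exact: measurable_cst_powR.
    - move=> s; rewrite /= in_itv/= => /andP[s0 _].
      rewrite -E; apply: argmin_term_le => //.
      apply: argmin_factor_prod_tail => //; first exact: measurable_abs_prod1.
      by move=> u v; rewrite /abs_prod1 ge_min lexx orbT.
  rewrite ge0_integralZl//; last 3 first.
  - by apply: measurable_funTS; apply/measurable_EFinP; exact: measurable_powR.
  - by move=> s _; rewrite lee_fin powR_ge0.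
  - by rewrite lee_fin exprn_ge0// divr_ge0// subr_ge0 ltW.
  rewrite lte_mul_pinfty ?lee_fin// ?exprn_ge0// ?divr_ge0// ?subr_ge0 ?(ltW tau2)//.
  by apply: integral_powR_01_lty; lra.
have E : - tau + (1 - tau) * k.-1%:R = - (tau + (tau - 1) * k.-1%:R) by ring.
have p1 : 1 < tau + (tau - 1) * k.-1%:R.
  apply: (@lt_le_trans _ _ tau); first lra.
  by rewrite lerDl mulr_ge0//; lra.
apply: (@le_lt_trans _ _ (\int[lebesgue_measure]_(s in `[1%R, +oo[)
   (((tau - 1)^-1 ^+ k.-1)%:E * (s `^ (- (tau + (tau - 1) * k.-1%:R)))%:E))%E).
  apply: (@le_trans _ _ (\int[lebesgue_measure]_(s in `[1%R, +oo[) F s)%E).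
    apply: ge0_subset_integral => //; first exact: measurable_funTS.
    by move=> x /=; rewrite !in_itv/= !andbT => /ltW.
  apply: ge0_le_integral => //.
  - exact: measurable_funTS.
  - exact: measurable_cst_powR.
  - move=> s; rewrite /= in_itv/= andbT => s1; have s0 := lt_le_trans ltr01 s1.
    rewrite -E; apply: argmin_term_le => //.
    exact: argmin_factor_one_tail.
rewrite ge0_integralZl//; last 3 first.
- by apply: measurable_funTS; apply/measurable_EFinP; exact: measurable_powR.
- by move=> s _; rewrite lee_fin powR_ge0.
- by rewrite lee_fin exprn_ge0// invr_ge0; lra.
by rewrite integral_powR_pinfty// -EFinM ltry.
Qed.

End Limits.

(** * Mean number of cliques: bounded weights dominate *)

Section JIntegrals.
Context {R : realType}.
Implicit Types (g tau a b : R).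

Lemma int_cubeE d (D : set R) (mD : measurable D) (f : d.-tuple R -> \bar R) :
  measurable_fun setT f -> (forall x, 0 <= f x)%E ->
  (int_cube D f = \int[mprod (leb_on mD) d]_x f x)%E.
Proof.
move=> mf f0; apply: iter_int_mprod => // u mu u0.
by rewrite /int_on integral_leb_on.
Qed.

Definition pow_weight tau k (y : k.-tuple R) : R := (\prod_(i < k) tnth y i) `^ (- tau).

Lemma measurable_pow_weight tau k :
  measurable_fun setT (fun y : k.-tuple R => (pow_weight tau y)%:E).
Proof.
apply/measurable_EFinP; apply: (measurableT_comp (measurable_powR _)).
by apply: measurable_rprod => i; exact: measurable_tnth.
Qed.

Lemma pow_weight_ge0 tau k (y : k.-tuple R) : (0 <= (pow_weight tau y)%:E)%E.
Proof. by rewrite lee_fin powR_ge0. Qed.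

Lemma J_NGE tau g d k :
  J_NG tau g d k = (\int[mprod leb_pos k]_y
    ((pow_weight tau y)%:E * torus_clique g d 1 y))%E.
Proof.
pose F (y : k.-tuple R) : \bar R := ((pow_weight tau y)%:E * torus_clique g d 1 y)%E.
have mF : measurable_fun setT F.
  apply: emeasurable_funM; first exact: measurable_pow_weight.
  exact: measurable_torus_clique.
have F0 y : (0 <= F y)%E by rewrite mule_ge0 ?pow_weight_ge0 ?torus_clique_ge0.
transitivity (iter_int (int_on `]0%R, +oo[) F); last first.
  by apply: iter_int_mprod => // f mf f0; rewrite integral_leb_on.
rewrite /J_NG; congr iter_int; apply/funext => y.
have mc : measurable_fun setT (fun x : k.-tuple (d.-tuple R) =>
    (clique_prod g (@torus_scaled R 1 d) y x)%:E).
  by apply: measurable_clique_prod_pos; exact: measurable_torus_scaled.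
have JE x : J_integrand tau g (@torus_dist R d) y x =
    ((pow_weight tau y)%:E * (clique_prod g (@torus_scaled R 1 d) y x)%:E)%E.
  rewrite /J_integrand -EFinM; congr (_ * _)%:E.
  by apply: eq_bigr => i _; apply: eq_bigr => j _; rewrite /torus_scaled mul1r.
rewrite (iter_int_mprod (m := cube d)); last 3 first.
- by move=> f mf f0; rewrite (int_cubeE (measurable_itv `[0%R, 1%R])).
- by rewrite (funext JE); apply: emeasurable_funM.
- by move=> x; rewrite JE mule_ge0 ?pow_weight_ge0// lee_fin clique_prod_ge0.
rewrite (eq_integral _ _ (fun x _ => JE x)) ge0_integralZl//; last 2 first.
- by move=> x _; rewrite lee_fin clique_prod_ge0.
- exact: pow_weight_ge0.
Qed.

Lemma measurable_space_clique g d k :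
  measurable_fun setT (space_clique (k := k) g d).
Proof.
apply: measurable_integral_param.
  apply/measurable_EFinP.
  apply: (measurable_fun_comp2 (measurable_clique_prod (k := k.+1) g
    (dist := fun u v => linf_dist u v ^+ d) _)) => //.
    by apply: measurable_funX; exact: measurable_linf_dist.
  by apply: measurable_cons.
by move=> y x; rewrite lee_fin clique_prod_ge0.
Qed.

Lemma space_clique_ge0 g d k (y : k.+1.-tuple R) : (0 <= space_clique g d y)%E.
Proof. by apply: integral_ge0 => z _; rewrite lee_fin clique_prod_ge0. Qed.

Lemma J_GE tau (w0 : R) g d k :
  J_G tau w0 g d k.+1 = (\int[mprod (leb_ge w0) k.+1]_w
    ((pow_weight tau w)%:E * space_clique g d w))%E.
Proof.
pose F (y : k.+1.-tuple R) : \bar R := ((pow_weight tau y)%:E * space_clique g d y)%E.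
have mF : measurable_fun setT F.
  apply: emeasurable_funM; first exact: measurable_pow_weight.
  exact: measurable_space_clique.
have F0 y : (0 <= F y)%E by rewrite mule_ge0 ?pow_weight_ge0 ?space_clique_ge0.
transitivity (iter_int (int_on `[w0, +oo[) F); last first.
  by apply: iter_int_mprod => // f mf f0; rewrite integral_leb_on.
rewrite /J_G; congr iter_int; apply/funext => y.
have mc : measurable_fun setT (fun z : k.-tuple (d.-tuple R) =>
    (clique_prod g (fun u v => linf_dist u v ^+ d) y [tuple of origin d :: z])%:E).
  apply: (measurable_fun_cons1 (f := fun x => (clique_prod g (fun u v => linf_dist u v ^+ d) y x)%:E)).
  apply: measurable_clique_prod_pos; apply: measurable_funX.
  exact: measurable_linf_dist.
have JE (z : k.-tuple (d.-tuple R)) :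
    J_integrand tau g (@linf_dist R d) y [tuple of origin d :: z] =
    ((pow_weight tau y)%:E *
     (clique_prod g (fun u v => linf_dist u v ^+ d) y [tuple of origin d :: z])%:E)%E.
  by rewrite /J_integrand -EFinM.
rewrite (iter_int_mprod (m := space d)); last 3 first.
- by move=> f mf f0; rewrite (int_cubeE measurableT).
- by rewrite (funext JE); apply: emeasurable_funM.
- by move=> x; rewrite JE mule_ge0 ?pow_weight_ge0// lee_fin clique_prod_ge0.
rewrite (eq_integral _ _ (fun x _ => JE x)) ge0_integralZl//; last 2 first.
- by move=> x _; rewrite lee_fin clique_prod_ge0.
- exact: pow_weight_ge0.
Qed.

(** Up to the factor pareto_const ^+ k, the probability that k given vertices
    form a clique with all weights in B, when n mu = a. The set B expresses the
    truncation of the weights. *)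
Definition weight_integral tau (w0 : R) g d k a (B : set R) : \bar R :=
  (\int[mprod (leb_ge w0) k]_w
    ((\prod_(i < k) (tnth w i `^ (- tau) * \1_B (tnth w i)))%:E *
     torus_clique g d a w))%E.

Lemma measurable_weight_factor tau k (B : set R) (c : R) : measurable B ->
  measurable_fun setT (fun w : k.-tuple R =>
    (\prod_(i < k) (tnth w i `^ (- tau) * \1_B (c * tnth w i)))%:E).
Proof.
move=> mB; apply/measurable_EFinP; apply: measurable_rprod => i.
apply: measurable_funM.
  by apply: (measurableT_comp (measurable_powR _)); exact: measurable_tnth.
apply: (measurableT_comp (measurable_indic mB)).
by apply: measurable_funM => //; exact: measurable_tnth.
Qed.

Lemma prod_powR_indic_le tau k (B : set R) (f w : k.-tuple R) :
  (forall i, 0 < tnth w i) ->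
  \prod_(i < k) (tnth w i `^ (- tau) * \1_B (tnth f i)) <= pow_weight tau w.
Proof.
move=> w0; rewrite /pow_weight prod_powR//; apply: ler_prod => i _.
rewrite mulr_ge0 ?powR_ge0//=.
by rewrite -[leRHS]mulr1 ler_wpM2l ?powR_ge0// indicE; case: (_ \in _).
Qed.

Lemma prod_powR_indic_ge0 tau k (B : set R) (f w : k.-tuple R) :
  (0 <= (\prod_(i < k) (tnth w i `^ (- tau) * \1_B (tnth f i)))%:E)%E.
Proof. by rewrite lee_fin prodr_ge0// => i _; rewrite mulr_ge0// powR_ge0. Qed.

Lemma near_forall_ord (k : nat) (P : 'I_k -> nat -> Prop) :
  (forall i, \forall n \near \oo, P i n) -> \forall n \near \oo, forall i, P i n.
Proof.
move=> H.
have H' (i : 'I_k) : exists N : nat, forall n, (N <= n)%N -> P i n.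
  by have [N _ HN] := H i; exists N => n Nn; exact: HN.
have [N HN] := choice H'.
exists (\max_i N i) => // n /= Nn i; apply: HN.
exact: (leq_trans (leq_bigmax i)).
Qed.

Lemma supported_leb_ge (w0 : R) k : supported (mprod (leb_ge w0) k)
  [set t : k.-tuple R | forall i, `[w0, +oo[%classic (tnth t i)].
Proof. by apply: supported_mprod; split => // f mf f0; exact: integral_leb_on_indic. Qed.

Lemma supported_leb_pos k : supported (mprod (@leb_pos R) k)
  [set t : k.-tuple R | forall i, `]0, +oo[%classic (tnth t i)].
Proof. by apply: supported_mprod; split => // f mf f0; exact: integral_leb_on_indic. Qed.

(** For small k the main contribution to the mean comes from k vertices of
    bounded weight at mutual distance of order a^(-1/d), the scale at which the
    torus looks like R^d. Any truncation that keeps every fixed weight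
    eventually leaves the limit unchanged. *)
Lemma geometric_limit tau (w0 : R) g d k (a : R^nat) (B : nat -> set R) :
  1 < g -> (0 < d)%N -> 2 < tau < 3 -> 0 < w0 -> (3 - tau) * k.+1%:R < 2 ->
  (forall n, 0 < a n) -> a @ \oo --> +oo ->
  (forall n, measurable (B n)) ->
  (forall w, w0 <= w -> \forall n \near \oo, B n w) ->
  (J_G tau w0 g d k.+1 < +oo)%E /\
  ((a n ^+ k)%:E * weight_integral tau w0 g d k.+1 (a n) (B n))%E @[n --> \oo]
    --> J_G tau w0 g d k.+1.
Proof.
move=> g1 d0 /andP[tau2 tau3] w00 kt a0 aoo mB cB.
have C0 := conn_const_ge0 d g1.
set C := conn_const g d.
have mbeta := measurable_abs_prod C.
have beta0 s t := abs_prod_ge0 s t C0.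
have ak0 n : 0 <= a n ^+ k by rewrite exprn_ge0// ltW.
pose f_ n (w : k.+1.-tuple R) : \bar R := ((a n ^+ k)%:E *
  ((\prod_(i < k.+1) (tnth w i `^ (- tau) * \1_(B n) (tnth w i)))%:E *
   torus_clique g d (a n) w))%E.
have mfac n : measurable_fun setT (fun w : k.+1.-tuple R =>
    (\prod_(i < k.+1) (tnth w i `^ (- tau) * \1_(B n) (tnth w i)))%:E).
  have := measurable_weight_factor (k := k.+1) tau 1 (mB n).
  by under eq_fun do under eq_bigr do rewrite mul1r.
have fac0 n (w : k.+1.-tuple R) := prod_powR_indic_ge0 tau (B n) w w.
rewrite J_GE (_ : (fun n => _) = (fun n => \int[mprod (leb_ge w0) k.+1]_w f_ n w)%E); last first.
  apply/funext => n; rewrite /weight_integral -ge0_integralZl//.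
  - by apply: emeasurable_funM => //; exact: measurable_torus_clique.
  - by move=> w _; rewrite mule_ge0// torus_clique_ge0.
  - by rewrite lee_fin.
apply: (@dominated_convergence_supported _ _ _ _ _ f_
  (fun w => (pow_weight tau w)%:E * space_clique g d w)%E
  (argmin_bound tau (abs_prod C)) (supported_leb_ge w0 k.+1)).
- move=> n; apply: emeasurable_funM => //; apply: emeasurable_funM => //.
  exact: measurable_torus_clique.
- apply: emeasurable_funM; first exact: measurable_pow_weight.
  exact: measurable_space_clique.
- exact: measurable_argmin_bound.
- move=> n w; apply: mule_ge0; first by rewrite lee_fin.
  by apply: mule_ge0 => //; exact: torus_clique_ge0.
- by move=> w; rewrite mule_ge0 ?pow_weight_ge0 ?space_clique_ge0.
- by move=> w; exact: argmin_bound_ge0.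
- exact: argmin_bound_ge_lty.
- move=> n w /= Sw.
  have wpos i : 0 < tnth w i.
    by have := Sw i; rewrite /= in_itv/= andbT; exact: lt_le_trans.
  rewrite /f_ muleCA; apply: (@le_trans _ _ ((pow_weight tau w)%:E *
      ((a n ^+ k)%:E * torus_clique g d (a n) w))%E).
    apply: lee_wpmul2r; first by apply: mule_ge0; rewrite ?lee_fin//; exact: torus_clique_ge0.
    by rewrite lee_fin; exact: prod_powR_indic_le.
  apply: le_argmin_bound => // [|p].
    by apply: mule_ge0; rewrite ?lee_fin//; exact: torus_clique_ge0.
  have := torus_clique_pivot p g1 d0 (a0 n) wpos => H.
  apply: (le_trans (lee_wpmul2l _ H)); first by rewrite lee_fin.
  rewrite -EFinM lee_fin.
  (* distribute the k factors a n over the k edges of the star *)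
  have -> : a n ^+ k = \prod_(j < k.+1 | j != p) a n by rewrite prod_neq_const.
  rewrite -big_split/=; apply: ler_prod => j _; apply/andP; split.
    rewrite mulr_ge0 ?(ltW (a0 n))// le_min ler01/= mulr_ge0//.
    by rewrite divr_ge0 ?(ltW (a0 n))// mulr_ge0 ?(ltW (wpos _)).
  apply: (@le_trans _ _ (a n * (C * (tnth w p * tnth w j / a n)))).
    by rewrite ler_wpM2l ?(ltW (a0 n))// ge_min lexx orbT.
  rewrite /abs_prod gtr0_norm ?mulr_gt0// mulrCA; apply: ler_wpM2l => //.
  by rewrite mulrCA divff ?mulr1// gt_eqF.
- move=> w /= Sw.
  have wge i : w0 <= tnth w i by have := Sw i; rewrite /= in_itv/= andbT.
  have wpos i : 0 < tnth w i by exact: lt_le_trans (wge i).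
  have cT := cvg_torus_clique g1 d0 wpos a0 aoo.
  have E : \forall n \near \oo, ((pow_weight tau w)%:E *
      ((a n ^+ k)%:E * torus_clique g d (a n) w) = f_ n w)%E.
    have := near_forall_ord (fun i => cB _ (wge i)); apply: filterS => n Bn.
    rewrite /f_ muleCA; congr (_ * (_ * _))%E; congr EFin.
    rewrite /pow_weight prod_powR//; apply: eq_bigr => i _.
    by rewrite indicE mem_set ?mulr1.
  apply: cvg_trans (near_eq_cvg E) _.
  apply: cvgeZl => //.
Qed.

End JIntegrals.

(** * Mean number of cliques: weights of order sqrt n dominate *)

Section NonGeometric.
Context {R : realType}.
Implicit Types (g tau a b : R).

Lemma leb_ge_scale (w0 : R) b (f : R -> \bar R) : 0 < w0 -> 0 < b ->
  measurable_fun setT f -> (forall x, 0 <= f x)%E ->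
  (\int[leb_ge w0]_w f w =
   \int[leb_pos]_y ((b * \1_(`[w0, +oo[%classic) (b * y))%:E * f (b * y)%R))%E.
Proof.
move=> w00 b0 mf f0.
have mi (D : set R) : measurable D -> measurable_fun setT (fun x : R => (\1_D x)%:E : \bar R).
  exact: measurable_EFin_indic.
have mby : measurable_fun setT (fun y : R => b * y) by exact: measurable_funM.
have mI : measurable_fun setT (fun y : R => (\1_(`[w0, +oo[%classic) (b * y))%:E : \bar R).
  apply/measurable_EFinP; apply: (measurableT_comp (measurable_indic _) mby).
  exact: measurable_itv.
have mh : measurable_fun setT (fun y : R =>
    ((b * \1_(`[w0, +oo[%classic) (b * y))%:E * f (b * y)%R)%E).
  apply: emeasurable_funM; last exact: (measurableT_comp mf mby).
  by apply/measurable_EFinP; apply: measurable_funM => //; exact/measurable_EFinP.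
have mF : measurable_fun setT (fun x : R => ((\1_(`[w0, +oo[%classic) x)%:E * f x)%E).
  by apply: emeasurable_funM => //; apply: mi; exact: measurable_itv.
rewrite integral_leb_on_lebT// [RHS]integral_leb_on_lebT//; last first.
  by move=> y; rewrite mule_ge0// lee_fin mulr_ge0// ltW.
rewrite integral_lebT// ?[RHS]integral_lebT//; last 3 first.
- by apply: emeasurable_funM => //; apply: mi; exact: measurable_itv.
- by move=> y; rewrite mule_ge0 ?lee_fin// mule_ge0// lee_fin mulr_ge0// ltW.
- by move=> y; rewrite mule_ge0 ?lee_fin.
have Fge x : (0 <= (\1_(`[w0, +oo[%classic) x)%:E * f x)%E by rewrite mule_ge0 ?lee_fin.
rewrite (integral_affine 0 b0 mF Fge) -ge0_integralZl//; last 2 first.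
- have maff : measurable_fun setT (fun y : R => b * y + 0) by exact: measurable_funD.
  exact: (measurableT_comp mF maff).
- by rewrite lee_fin ltW.
apply: eq_integral => y _; rewrite addr0 EFinM.
have [y0|y0] := boolP (y \in `]0, +oo[%classic); first by rewrite [\1_(`]0, +oo[%classic) y]indicE y0 mul1e -muleA.
rewrite [\1_(`]0, +oo[%classic) y]indicE (negbTE y0) mul0e.
rewrite indicE memNset ?mul0e ?mule0//=.
move: y0; rewrite mem_setE !in_itv/= !andbT -leNgt => y0 wby.
by have := lt_le_trans w00 wby; rewrite pmulr_rgt0// ltNge y0.
Qed.

(** Substitute w = b y: each weight contributes b * b^-tau, and the positions
    see no change because b^2 plays the role of n mu. *)
Lemma weight_integral_scale tau (w0 : R) g d k b (B : set R) : 0 < w0 -> 0 < b ->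
  measurable B ->
  weight_integral tau w0 g d k (b ^+ 2) B =
  (((b `^ (1 - tau)) ^+ k)%:E *
   \int[mprod leb_pos k]_y ((\prod_(i < k) (tnth y i `^ (- tau) *
      \1_(`[w0, +oo[%classic `&` B) (b * tnth y i)))%:E * torus_clique g d 1 y))%E.
Proof.
move=> w00 b0 mB.
have mB' : measurable (`[w0, +oo[%classic `&` B) by apply: measurableI => //; exact: measurable_itv.
have mfac : measurable_fun setT (fun w : k.-tuple R =>
    (\prod_(i < k) (tnth w i `^ (- tau) * \1_B (tnth w i)))%:E).
  have := measurable_weight_factor (k := k) tau 1 mB.
  by under eq_fun do under eq_bigr do rewrite mul1r.
have mF : measurable_fun setT (fun w : k.-tuple R =>
    ((\prod_(i < k) (tnth w i `^ (- tau) * \1_B (tnth w i)))%:E *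
     torus_clique g d (b ^+ 2) w)%E).
  by apply: emeasurable_funM => //; exact: measurable_torus_clique.
rewrite /weight_integral.
rewrite (integral_mprod_subst (m' := leb_pos)
  (h := fun=> (fun y => (b * \1_(`[w0, +oo[%classic) (b * y))%:E))
  (phi := fun _ y => b * y)); last 6 first.
- move=> _; apply/measurable_EFinP; apply: measurable_funM => //.
  apply: (measurableT_comp (measurable_indic _)); first exact: measurable_itv.
  exact: measurable_funM.
- by move=> _ y; rewrite lee_fin mulr_ge0// ltW.
- by move=> _; exact: measurable_funM.
- by move=> _ f mf f0; exact: leb_ge_scale.
- exact: mF.
- move=> w; apply: mule_ge0; last exact: torus_clique_ge0.
  exact: prod_powR_indic_ge0.
rewrite -[RHS]ge0_integralZl; last 4 first.
- exact: measurableT.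
- apply: emeasurable_funM; last exact: measurable_torus_clique.
  exact: measurable_weight_factor.
- move=> y _; apply: mule_ge0; last exact: torus_clique_ge0.
  by rewrite lee_fin prodr_ge0// => i _; rewrite mulr_ge0// powR_ge0.
- by rewrite lee_fin exprn_ge0// powR_ge0.
apply: (eq_integral_supported (supported_leb_pos k)).
- apply: emeasurable_funM.
    apply: measurable_eprod => i.
    apply: (measurable_tnth_comp i (f := fun y => (b * \1_(`[w0, +oo[%classic) (b * y))%:E)).
    apply/measurable_EFinP; apply: measurable_funM => //.
    apply: (measurableT_comp (measurable_indic _)); first exact: measurable_itv.
    exact: measurable_funM.
  have mt : measurable_fun setT (fun y : k.-tuple R => [tuple b * tnth y i | i < k]).
    by apply: measurable_mktuple => i; apply: measurable_funM => //; exact: measurable_tnth.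
  exact: (measurableT_comp mF mt).
- apply: (emeasurable_funM (measurable_cst _)).
  apply: emeasurable_funM; last exact: measurable_torus_clique.
  exact: measurable_weight_factor.
- move=> y; apply: mule_ge0.
    by apply: prode_ge0 => i _; rewrite lee_fin mulr_ge0// ltW.
  apply: mule_ge0; last exact: torus_clique_ge0.
  exact: prod_powR_indic_ge0.
- move=> y; apply: mule_ge0; first by rewrite lee_fin exprn_ge0// powR_ge0.
  apply: mule_ge0; last exact: torus_clique_ge0.
  by rewrite lee_fin prodr_ge0// => i _; rewrite mulr_ge0// powR_ge0.
move=> y /= Sy; rewrite torus_clique_scale// !muleA; congr (_ * _)%E.
rewrite prodEFin -!EFinM; congr EFin.
have -> : (b `^ (1 - tau)) ^+ k = \prod_(i < k) b `^ (1 - tau).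
  by rewrite prodr_const card_ord.
rewrite -!big_split/=.
apply: eq_bigr => i _; rewrite tnth_mktuple.
have yi : 0 < tnth y i by have := Sy i; rewrite /= in_itv/= andbT.
rewrite powRM ?(ltW b0) ?(ltW yi)// indicI.
have -> : b `^ (1 - tau) = b * b `^ (- tau).
  by rewrite mulrC powR_mull// addrC.
by rewrite /=; ring.
Qed.

(** For large k the main contribution comes from weights y b with b of order
    sqrt (n mu), for which the edge probabilities no longer depend on n. The
    lower cutoff w0 / b on y tends to 0, as does that of any admissible
    truncation, so dominated convergence over ]0, +oo[ gives J_NG. *)
Lemma nongeometric_limit tau (w0 : R) g d k (b : R^nat) (B : nat -> set R) :
  1 < g -> (0 < d)%N -> 2 < tau < 3 -> 0 < w0 -> (0 < k)%N -> 2 < (3 - tau) * k%:R ->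
  (forall n, 0 < b n) -> b @ \oo --> +oo ->
  (forall n, measurable (B n)) ->
  (forall y, 0 < y -> \forall n \near \oo, B n (b n * y)) ->
  (J_NG tau g d k < +oo)%E /\
  (((b n `^ (tau - 1)) ^+ k)%:E * weight_integral tau w0 g d k (b n ^+ 2) (B n))%E
     @[n --> \oo] --> J_NG tau g d k.
Proof.
move=> g1 d0 /andP[tau2 tau3] w00 k0 kt b0 boo mB cB.
have C0 := conn_const_ge0 d g1.
set C := conn_const g d.
have mbeta := measurable_abs_prod1 C.
have beta0 s t := abs_prod1_ge0 s t C0.
have mB' n : measurable (`[w0, +oo[%classic `&` B n).
  by apply: measurableI => //; exact: measurable_itv.
pose f_ n (y : k.-tuple R) : \bar R := ((\prod_(i < k) (tnth y i `^ (- tau) *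
      \1_(`[w0, +oo[%classic `&` B n) (b n * tnth y i)))%:E * torus_clique g d 1 y)%E.
rewrite J_NGE (_ : (fun n => _) = (fun n => \int[mprod leb_pos k]_w f_ n w)%E); last first.
  apply/funext => n; rewrite weight_integral_scale// muleA -EFinM -exprMn -powRD.
    by rewrite addrA subrK subrr powRr0 expr1n mul1e.
  by apply/implyP => _; rewrite gt_eqF.
have f_0 n y : (0 <= f_ n y)%E.
  apply: mule_ge0; last exact: torus_clique_ge0.
  by rewrite lee_fin prodr_ge0// => i _; rewrite mulr_ge0// powR_ge0.
apply: (@dominated_convergence_supported _ _ _ _ _ f_
  (fun y => (pow_weight tau y)%:E * torus_clique g d 1 y)%E
  (argmin_bound tau (abs_prod1 C)) (supported_leb_pos k)) => //.
- move=> n; apply: emeasurable_funM; last exact: measurable_torus_clique.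
  exact: measurable_weight_factor.
- apply: emeasurable_funM; first exact: measurable_pow_weight.
  exact: measurable_torus_clique.
- exact: measurable_argmin_bound.
- by move=> y; apply: mule_ge0; [exact: pow_weight_ge0|exact: torus_clique_ge0].
- by move=> y; exact: argmin_bound_ge0.
- exact: argmin_bound_pos_lty.
- move=> n y /= Sy.
  have ypos i : 0 < tnth y i by have := Sy i; rewrite /= in_itv/= andbT.
  apply: (@le_trans _ _ ((pow_weight tau y)%:E * torus_clique g d 1 y)%E).
    apply: lee_wpmul2r; first exact: torus_clique_ge0.
    rewrite lee_fin.
    have := @prod_powR_indic_le _ tau k (`[w0, +oo[%classic `&` B n)
      [tuple b n * tnth y i | i < k] y ypos.
    by under eq_bigr do rewrite tnth_mktuple.
  apply: le_argmin_bound => // [|p]; first exact: torus_clique_ge0.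
  apply: (le_trans (torus_clique_pivot p g1 d0 ltr01 ypos)).
  rewrite lee_fin; apply: ler_prod => j _; apply/andP; split.
    by rewrite le_min ler01/= mulr_ge0// divr1 mulr_ge0 ?(ltW (ypos _)).
  by rewrite /abs_prod1 divr1 gtr0_norm ?mulr_gt0.
- move=> y /= Sy.
  have ypos i : 0 < tnth y i by have := Sy i; rewrite /= in_itv/= andbT.
  apply: cvg_near_cst.
  have bw i : \forall n \near \oo, w0 <= b n * tnth y i.
    have /cvgryPge/(_ (w0 / tnth y i)) := boo.
    by apply: filterS => n; rewrite ler_pdivrMr.
  have H i : \forall n \near \oo, B n (b n * tnth y i) /\ w0 <= b n * tnth y i.
    by apply: filterI; [exact: cB|exact: bw].
  have := near_forall_ord H.
  apply: filterS => n Bn; rewrite /f_; congr (_ * _)%E; congr EFin.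
  rewrite /pow_weight prod_powR//; apply: eq_bigr => i _.
  have [Bi bi] := Bn i.
  by rewrite indicE mem_set ?mulr1//; split => //=; rewrite in_itv/= bi.
Qed.

End NonGeometric.

(** * Products, densities and uniqueness of measures *)

Section ProductSigmaFinite.
Context {R : realType} {d1 d2 : measure_display}
  {T1 : measurableType d1} {T2 : measurableType d2}.
Variables (m1 : {sigma_finite_measure set T1 -> \bar R})
  (m2 : {sigma_finite_measure set T2 -> \bar R}).

(** The product measure, packaged with its sigma-finiteness so that its powers
    can be formed. *)
Definition prod_measure : set (T1 * T2) -> \bar R := (m1 \x m2)%E.

HB.instance Definition _ := Measure.copy prod_measure
  (lebesgue_integral_fubini_product_measure1__canonical__measure_function_Measure m1 m2).

Let prod_measure_sigma_finite : sigma_finite setT prod_measure.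
Proof.
have /sigma_finiteP[F [FT ndF Foo]] := sigma_finiteT m1.
have /sigma_finiteP[G [GT ndG Goo]] := sigma_finiteT m2.
exists (fun i => F i `*` G i).
  apply/seteqP; split => // -[x y] _.
  have [i _ Fi] : (\bigcup_i F i) x by rewrite -FT.
  have [j _ Gj] : (\bigcup_i G i) y by rewrite -GT.
  exists (maxn i j) => //; split => /=.
    by move: Fi; exact/subsetPset/ndF/leq_maxl.
  by move: Gj; exact/subsetPset/ndG/leq_maxr.
move=> i; have [mF Fi] := Foo i; have [mG Gi] := Goo i; split.
  exact: measurableX.
by rewrite /prod_measure product_measure1E// lte_mul_pinfty// ge0_fin_numE.
Qed.

HB.instance Definition _ := Measure_isSigmaFinite.Build _ _ _ prod_measure
  prod_measure_sigma_finite.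

Lemma integral_prod_measure (f : T1 * T2 -> \bar R) :
  measurable_fun setT f -> (forall z, 0 <= f z)%E ->
  (\int[prod_measure]_z f z = \int[m1]_x \int[m2]_y f (x, y))%E.
Proof. by move=> mf f0; exact: fubini_tonelli1. Qed.

End ProductSigmaFinite.

Section Density.
Context {R : realType} {d : measure_display} {T : measurableType d}.
Variables (m : {sigma_finite_measure set T -> \bar R}) (h : T -> R).
Hypotheses (mh : measurable_fun setT h) (h0 : forall x, 0 <= h x)
  (h1 : (\int[m]_x (h x)%:E < +oo)%E).

Definition subgraph : set (T * R) := [set z | 0 <= z.2 < h z.1].

Lemma measurable_subgraph : measurable subgraph.
Proof.
have m1 : measurable_fun setT (fun z : T * R => 0 <= z.2) by exact: measurable_fun_ler.
have m2 : measurable_fun setT (fun z : T * R => z.2 < h z.1).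
  by apply: measurable_fun_ltr => //; exact: measurableT_comp.
have := measurable_and m1 m2.
move=> /(_ measurableT [set true]).
rewrite setTI => H; rewrite (_ : subgraph = (fun z => (0 <= z.2) && (z.2 < h z.1)) @^-1` [set true]).
  exact: H.
by apply/seteqP; split => z /=.
Qed.

(** The measure with density h with respect to m, realised as the area under
    the graph of h. Countable additivity is then inherited, and finiteness
    follows from that of the integral of h. *)
Definition density (_ : forall x, 0 <= h x) (_ : (\int[m]_x (h x)%:E < +oo)%E) :
    set T -> \bar R :=
  pushforward (mrestr (prod_measure m lebT) measurable_subgraph) fst.

HB.instance Definition _ := Measure.copy (density h0 h1)
  (measure_function_pushforward__canonical__measure_function_Measure
    (mrestr (prod_measure m lebT) measurable_subgraph) measurable_fst).

Let integral_density_measure (f : T -> \bar R) : measurable_fun setT f ->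
  (forall x, 0 <= f x)%E -> (\int[density h0 h1]_x f x = \int[m]_x ((h x)%:E * f x))%E.
Proof.
move=> mf f0; rewrite ge0_integral_pushforward//.
rewrite preimage_setT integral_mrestr//; last 2 first.
- exact: (measurableT_comp mf measurable_fst).
- by move=> x; exact: f0.
have mi : measurable_fun setT (fun z : T * R => (\1_subgraph z)%:E * f z.1)%E.
  apply: emeasurable_funM; last exact: (measurableT_comp mf measurable_fst).
  by apply: measurable_EFin_indic; exact: measurable_subgraph.
transitivity (\int[prod_measure m lebT]_z ((\1_subgraph z)%:E * f z.1))%E.
  rewrite integral_mkcond; apply: eq_integral => z _ /=.
  by rewrite /patch indicE; case: ifP => _; rewrite ?mul1e ?mul0e.
rewrite integral_prod_measure//; last by move=> z; rewrite mule_ge0// lee_fin.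
apply: eq_integral => x _ /=.
have ico : measurable_fun setT (fun t : R => (\1_(`[0%R, h x[%classic) t)%:E : \bar R).
  by apply: measurable_EFin_indic; exact: measurable_itv.
transitivity (\int[lebT]_t ((\1_(`[0%R, h x[%classic) t)%:E * f x))%E.
  apply: eq_integral => t _; congr (_ * _)%E; congr EFin; rewrite !indicE; congr (_%:R).
rewrite ge0_integralZr//; congr (_ * _)%E.
rewrite integral_lebT// integral_indic//= setIT lebesgue_measure_itv/= lte_fin.
case: ltP => [_|hx]; first by rewrite oppr0 adde0.
by congr EFin; apply/eqP; rewrite eq_le hx h0.
Qed.

Let density_finite : fin_num_fun (density h0 h1).
Proof.
apply: lty_fin_num_fun.
have := integral_density_measure (f := cst 1%E) (measurable_cst _) (fun=> lee01).
rewrite integral_cst//= mul1e => ->.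
by under eq_integral do rewrite mule1.
Qed.

HB.instance Definition _ := Measure_isFinite.Build _ _ _ (density h0 h1) density_finite.

Lemma integral_density (f : T -> \bar R) : measurable_fun setT f ->
  (forall x, 0 <= f x)%E -> (\int[density h0 h1]_x f x = \int[m]_x ((h x)%:E * f x))%E.
Proof. exact: integral_density_measure. Qed.

End Density.

Section Uniqueness.
Context {R : realType}.
Local Open Scope ereal_scope.

Lemma mprod_box d (T : measurableType d)
    (m : {sigma_finite_measure set T -> \bar R}) n (A : 'I_n -> set T) :
  (forall i, measurable (A i)) ->
  mprod m n [set t | forall i, A i (tnth t i)] = \prod_(i < n) m (A i).
Proof.
move=> mA.
have mbox : measurable [set t : n.-tuple T | forall i, A i (tnth t i)].
  rewrite (_ : mkset _ = \bigcap_(i in [set: 'I_n]) ((fun t : n.-tuple T => tnth t i) @^-1` A i)).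
    apply: fin_bigcap_measurable => // i _.
    by rewrite -[X in measurable X]setTI; exact: measurable_tnth.
  apply/seteqP; split => t; first by move=> tA i _; exact: tA.
  by move=> tA i; exact: tA.
transitivity (\int[mprod m n]_t
    (\1_[set t : n.-tuple T | forall i, A i (tnth t i)] t)%:E).
  by rewrite integral_indic// setIT.
transitivity (\int[mprod m n]_t \prod_(i < n) (\1_(A i) (tnth t i))%:E).
  apply: eq_integral => t _; rewrite indicE.
  case: (boolP (t \in _)) => [/set_mem tA|tA].
    by rewrite big1// => i _; rewrite indicE mem_set//; exact: tA.
  have [i Ai] : exists i, ~ A i (tnth t i).
    by apply/existsNP => tA'; move/negP: tA; apply; exact: mem_set.
  by rewrite (bigD1 i)//= indicE memNset// mul0e.
rewrite (integral_mprod_prod m (f := fun i x => (\1_(A i) x)%:E))//; last first.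
  by move=> i; exact: measurable_EFin_indic.
by apply: eq_bigr => i _; rewrite integral_indic// setIT.
Qed.

(** The half-lines ]w, +oo[ together with R form a pi-system generating the
    Borel sets, so a law is determined by its tail function. *)
Lemma eq_measure_halfline (m1 m2 : {measure set R -> \bar R}) :
  m1 setT = m2 setT -> m1 setT < +oo ->
  (forall w, m1 `]w, +oo[%classic = m2 `]w, +oo[%classic) ->
  forall A, measurable A -> m1 A = m2 A.
Proof.
move=> m12T m1oo m12.
pose G : set (set R) := [set A | A = setT \/ exists x, A = `]x, +oo[%classic].
apply: (measure_unique G (fun=> setT)) => //.
- apply/seteqP; split => A.
    rewrite [X in X A -> _](@RGenOInfty.measurableE R).
    apply: smallest_sub; first exact: smallest_sigma_algebra.
    by move=> _ [x ->]; apply: sub_sigma_algebra; right; exists x.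
  apply: smallest_sub; first exact: sigma_algebra_measurable.
  by move=> _ [->//|[x ->]]; exact: measurable_itv.
- move=> _ _ [->|[x ->]] [->|[y ->]]; rewrite ?setTI ?setIT; [by left|by right; exists y|by right; exists x|].
  right; exists (Num.max x y); apply/seteqP; split => z /=; rewrite !in_itv/= !andbT gt_max.
    by move=> [-> ->].
  by move=> /andP[].
- by move=> _; left.
- by rewrite bigcup_const//; exists 0%N.
- by move=> _ [->|[x ->]].
Qed.

End Uniqueness.

(** * The Pareto law *)

Section ParetoLaw.
Context {R : realType}.
Variables (tau w0 : R).
Hypotheses (tau2 : 2 < tau) (w00 : 0 < w0).

Definition pareto_density (x : R) : R := pareto_const tau w0 * x `^ (- tau).

Lemma pareto_const_gt0 : 0 < pareto_const tau w0.
Proof. by rewrite mulr_gt0 ?powR_gt0// subr_gt0 (lt_trans _ tau2)// ltr1n. Qed.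

Lemma pareto_density_ge0 x : 0 <= pareto_density x.
Proof. by rewrite mulr_ge0 ?powR_ge0// ltW// pareto_const_gt0. Qed.

Lemma measurable_pareto_density : measurable_fun setT pareto_density.
Proof. by apply: measurable_funM => //; exact: measurable_powR. Qed.

Lemma integral_pareto_tail w : w0 <= w ->
  (\int[lebesgue_measure]_(x in `[w, +oo[) (pareto_density x)%:E =
   ((w0 / w) `^ (tau - 1))%:E)%E.
Proof.
move=> w0w; have wpos := lt_le_trans w00 w0w.
have t1 : 1 < tau by rewrite (lt_trans _ tau2)// ltr1n.
under eq_integral do rewrite /pareto_density EFinM.
rewrite ge0_integralZl//; last 3 first.
- by apply: measurable_funTS; apply/measurable_EFinP; exact: measurable_powR.
- by move=> x _; rewrite lee_fin powR_ge0.
- by rewrite lee_fin ltW// pareto_const_gt0.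
rewrite integral_powR_pinfty// -EFinM; congr EFin.
rewrite powRM ?invr_ge0 ?(ltW w00) ?(ltW wpos)//.
rewrite -(powR_inv1 (ltW wpos)) -powRrM mulN1r opprB /pareto_const.
have t10 : tau - 1 != 0 by rewrite subr_eq0 gt_eqF.
by rewrite mulrCA (mulrAC (tau - 1)) -mulrA; field.
Qed.

Lemma pareto_density_mass : (\int[leb_ge w0]_x (pareto_density x)%:E = 1)%E.
Proof.
rewrite integral_leb_on; last 2 first.
- by apply/measurable_EFinP; exact: measurable_pareto_density.
- by move=> x; rewrite lee_fin pareto_density_ge0.
by rewrite integral_pareto_tail// divff ?powR1// gt_eqF.
Qed.

Lemma pareto_density_lty : (\int[leb_ge w0]_x (pareto_density x)%:E < +oo)%E.
Proof. by rewrite pareto_density_mass ltry. Qed.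

Definition pareto_law : {sigma_finite_measure set R -> \bar R} :=
  density measurable_pareto_density pareto_density_ge0 pareto_density_lty.

Lemma integral_pareto (f : R -> \bar R) : measurable_fun setT f ->
  (forall x, 0 <= f x)%E ->
  (\int[pareto_law]_x f x = \int[leb_ge w0]_x ((pareto_density x)%:E * f x))%E.
Proof. exact: integral_density. Qed.

Lemma pareto_mass : (pareto_law setT = 1)%E.
Proof.
have := integral_pareto (f := cst 1%E) (measurable_cst _) (fun=> lee01).
rewrite integral_cst//= mul1e => ->.
by under eq_integral do rewrite mule1; exact: pareto_density_mass.
Qed.

Lemma pareto_tail w : w0 <= w ->
  (pareto_law `]w, +oo[%classic = ((w0 / w) `^ (tau - 1))%:E)%E.
Proof.
move=> w0w; rewrite -integral_pareto_tail//.
have mi : measurable (`]w, +oo[%classic : set R) by exact: measurable_itv.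
transitivity (\int[pareto_law]_x (\1_(`]w, +oo[%classic : set R) x)%:E)%E.
  by rewrite integral_indic// setIT.
rewrite integral_pareto//; last exact: measurable_EFin_indic.
have md : measurable_fun setT (fun x => (pareto_density x)%:E).
  by apply/measurable_EFinP; exact: measurable_pareto_density.
rewrite integral_leb_on; last 2 first.
- by apply: emeasurable_funM => //; exact: measurable_EFin_indic.
- by move=> x; rewrite mule_ge0 ?lee_fin ?pareto_density_ge0//.
rewrite -[RHS]integral_itv_obnd_cbnd; last exact: (measurable_funTS md).
rewrite [LHS]integral_mkcond [RHS]integral_mkcond; apply: eq_integral => x _.
rewrite /patch indicE !mem_setE !in_itv/= !andbT.
have [wx|wx] := ltP w x.
  by rewrite (le_trans w0w (ltW wx)) mule1.
by rewrite mule0; case: ifP.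
Qed.

Lemma pareto_tail_below w : w < w0 -> (pareto_law `]w, +oo[%classic = 1)%E.
Proof.
move=> ww0; apply/eqP; rewrite eq_le; apply/andP; split.
  rewrite -pareto_mass; apply: le_measure; rewrite ?inE//; exact: measurable_itv.
have <- : (pareto_law `]w0, +oo[%classic = 1)%E.
  by rewrite pareto_tail// divff ?powR1// gt_eqF.
apply: le_measure; rewrite ?inE; [exact: measurable_itv|exact: measurable_itv|].
by move=> x /=; rewrite !in_itv/= !andbT; exact: lt_trans.
Qed.

End ParetoLaw.

Lemma pareto_mean_gt0 (R : realType) (tau w0 : R) : 2 < tau -> 0 < w0 -> 0 < pareto_mean tau w0.
Proof.
move=> tau2 w00; rewrite mulr_gt0// divr_gt0// subr_gt0//.
by rewrite (lt_trans _ tau2)// ltr1n.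
Qed.

(** * The joint law of several vertices *)

Section Laws.
Context {R : realType}.
Variables (tau w0 g : R) (d n : nat) (disp : measure_display)
  (Omega : measurableType disp) (P : probability Omega R)
  (G : girg tau w0 g d n P).
Hypotheses (tau2 : 2 < tau) (w00 : 0 < w0).

Local Notation pareto := (pareto_law tau2 w00).

Definition vertex_law : {sigma_finite_measure set (R * d.-tuple R)%type -> \bar R} :=
  prod_measure pareto (cube d).

Definition vertex (i : 'I_n) (om : Omega) : R * d.-tuple R :=
  (weight G i om, position G i om).

Lemma measurable_preimage d' (T : measurableType d') (X : Omega -> T) (A : set T) :
  measurable_fun setT X -> measurable A -> measurable [set om | A (X om)].
Proof. by move=> mX mA; rewrite -[X in measurable X]setTI; exact: mX. Qed.

Lemma measurable_weight i : measurable_fun setT (weight G i).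
Proof. exact: measurable_funPT. Qed.

Lemma measurable_position i : measurable_fun setT (position G i).
Proof. exact: measurable_funPT. Qed.

Lemma measurable_vertex i : measurable_fun setT (vertex i).
Proof.
apply: measurable_fun_pair; [exact: measurable_weight|exact: measurable_position].
Qed.

Lemma weight_law (i : 'I_n) (A : set R) : measurable A ->
  P [set om | A (weight G i om)] = pareto A.
Proof.
move=> mA; apply: (@eq_measure_halfline _ (distribution P (weight G i)) pareto) => //.
- by rewrite [LHS]probability_setT; exact/esym/pareto_mass.
- by rewrite [ltLHS]probability_setT ltry.
move=> w; have itvE v : distribution P (weight G i) `]v, +oo[%classic =
    P [set om | v < weight G i om].
  by congr (P _); apply/seteqP; split => om /=; rewrite in_itv/= andbT.
transitivity (P [set om | w < weight G i om]); first exact: itvE.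
have [ww0|w0w] := ltP w w0; last first.
  by rewrite weight_pareto//; exact/esym/pareto_tail.
rewrite [RHS]pareto_tail_below//.
have mt v : measurable [set om | v < weight G i om].
  rewrite (_ : mkset _ = [set om | `]v, +oo[%classic (weight G i om)]).
    by apply: measurable_preimage; [exact: measurable_weight|exact: measurable_itv].
  by apply/seteqP; split => om /=; rewrite in_itv/= andbT.
apply/eqP; rewrite eq_le probability_le1//=.
have <- : P [set om | w0 < weight G i om] = 1%E.
  by rewrite weight_pareto// divff ?powR1// gt_eqF.
by apply: le_measure; rewrite ?inE// => om /=; exact: lt_trans.
Qed.

Lemma leb01E (A : set R) : measurable A ->
  leb01 A = lebesgue_measure (A `&` `[0%R, 1%R[%classic).
Proof.
move=> mA; have mi : measurable_fun setT (fun x : R => (\1_A x)%:E : \bar R).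
  exact: measurable_EFin_indic.
transitivity (\int[leb01]_x (\1_A x)%:E)%E.
  by rewrite integral_indic// setIT.
rewrite integral_leb_on//.
rewrite -integral_itv_bndo_bndc; last exact: (measurable_funTS mi).
by rewrite integral_indic.
Qed.

Lemma position_law (i : 'I_n) (B : set (d.-tuple R)) : measurable B ->
  P [set om | B (position G i om)] = cube d B.
Proof.
move=> mB.
apply: (@eq_measure_box _ _ _ d measurable (distribution P (position G i)) (cube d)) => //.
- apply/seteqP; split; first exact: sub_sigma_algebra.
  apply: smallest_sub => //; exact: sigma_algebra_measurable.
- by move=> A1 A2 mA1 mA2; exact: measurableI.
- by rewrite [ltLHS]probability_setT ltry.
move=> A mA; rewrite [RHS]mprod_box//.
rewrite [LHS](_ : _ = P [set om | forall h, A h (tnth (position G i om) h)])//.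
by rewrite position_uniform//; apply: eq_bigr => h _; rewrite leb01E.
Qed.

Lemma vertex_lawX (A : set R) (B : set (d.-tuple R)) : measurable A -> measurable B ->
  (vertex_law (A `*` B) = pareto A * cube d B)%E.
Proof. by move=> mA mB; rewrite [LHS]product_measure1E. Qed.

Definition vertices m (s : 'I_m -> 'I_n) (om : Omega) : m.-tuple (R * d.-tuple R) :=
  [tuple vertex (s i) om | i < m].

Lemma measurable_vertices m (s : 'I_m -> 'I_n) : measurable_fun setT (vertices s).
Proof. by apply: measurable_mktuple => i; exact: measurable_vertex. Qed.

(** Padding a family indexed by 'I_m with factors equal to 1 outside the image
    of an injection does not change its product; in this way the independence
    of all n vertices gives that of any m of them. *)
Lemma prod_injective m (s : 'I_m -> 'I_n) (f : 'I_n -> \bar R) (h : 'I_m -> \bar R) :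
  injective s -> (forall j, f (s j) = h j) ->
  (forall i, (forall j, s j != i) -> f i = 1%E) ->
  (\prod_(i < n) f i = \prod_(j < m) h j)%E.
Proof.
move=> sI fs f1; rewrite (bigID (mem (codom s)))/= [X in (_ * X)%E]big1 ?mule1.
  rewrite -big_uniq; last by rewrite map_inj_uniq ?enum_uniq.
  rewrite [LHS]big_map big_enum.
  by apply: eq_bigr => j _.
by move=> i si; apply: f1 => j; apply: contraNneq si => <-; exact: codom_f.
Qed.

(** The laws of weights and positions are only known on half-lines and on boxes,
    and independence only for product events. Both extend to all events by
    uniqueness of measures on pi-systems, so distinct vertices have i.i.d.
    weights and positions. *)
Lemma vertices_law m (s : 'I_m -> 'I_n) (E : set (m.-tuple (R * d.-tuple R))) :
  injective s -> measurable E ->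
  P [set om | E (vertices s om)] = mprod vertex_law m E.
Proof.
move=> sI mE.
pose GG : set (set (R * d.-tuple R)) :=
  [set A `*` B | A in (measurable : set (set R)) & B in (measurable : set (set (d.-tuple R)))].
apply: (@eq_measure_box _ _ _ m GG
  (measure_function_pushforward__canonical__measure_function_Measure P (measurable_vertices s))
  (mprod vertex_law m)) => //.
- exact: measurable_prod_measurableType.
- move=> _ _ [A1 mA1 [B1 mB1 <-]] [A2 mA2 [B2 mB2 <-]].
  by rewrite -setXI; exists (A1 `&` A2); [exact: measurableI|exists (B1 `&` B2); [exact: measurableI|]].
- by exists setT => //; exists setT => //; rewrite setXTT.
- by rewrite [ltLHS]probability_setT ltry.
move=> A GA.
have mGG X : GG X -> measurable X.
  by move=> [A1 mA1 [B1 mB1 <-]]; exact: measurableX.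
have HA i : exists AB : set R * set (d.-tuple R),
    [/\ measurable AB.1, measurable AB.2 & A i = AB.1 `*` AB.2].
  by have [A1 mA1 [B1 mB1 <-]] := GA i; exists (A1, B1).
have [AB HAB] := choice HA.
rewrite [RHS]mprod_box; last by move=> i; exact: (mGG _ (GA i)).
(* the constraint on vertex i: X_j when i = s j, and none outside the image of s *)
pose ext T (X : 'I_m -> set T) (i : 'I_n) : set T :=
  [set x | forall j, s j = i -> X j x].
have extE T (X : 'I_m -> set T) j : ext T X (s j) = X j.
  apply/seteqP; split => x; first by apply.
  by move=> Xx j' /sI ->.
have extT T (X : 'I_m -> set T) i : (forall j, s j != i) -> ext T X i = setT.
  by move=> si; apply/seteqP; split => // x _ j sj; have := si j; rewrite sj eqxx.
have mext d' (T : measurableType d') (X : 'I_m -> set T) i :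
    (forall j, measurable (X j)) -> measurable (ext T X i).
  move=> mX; have [[j <-]|si] := pselect (exists j, s j = i); first by rewrite extE.
  by rewrite extT// => j; apply/eqP => sj; apply: si; exists j.
have := weight_position_indep G
  (A := ext _ (fun j => (AB j).1)) (B := ext _ (fun j => (AB j).2))
  (fun i => mext _ _ _ _ (fun j => let: And3 p _ _ := HAB j in p))
  (fun i => mext _ _ _ _ (fun j => let: And3 _ p _ := HAB j in p)).
rewrite (prod_injective (h := fun j => vertex_law (A j)) sI).
- move=> <-; congr (P _); apply/seteqP; split => om /=.
    move=> Aom i; split => j ji; have := Aom j; rewrite tnth_mktuple ji.
      by have [_ _ ->] := HAB j => -[].
    by have [_ _ ->] := HAB j => -[].
  move=> Aom j; rewrite tnth_mktuple; have [_ _ ->] := HAB j.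
  have [A1 A2] := Aom (s j); split; [exact: A1|exact: A2].
- move=> j; rewrite !extE; have [m1 m2 ->] := HAB j.
  by rewrite vertex_lawX// weight_law// position_law.
- by move=> i si; rewrite !extT// probability_setT mule1.
Qed.

Lemma integral_vertices m (s : 'I_m -> 'I_n) (F : m.-tuple (R * d.-tuple R) -> \bar R) :
  injective s -> measurable_fun setT F -> (forall t, 0 <= F t)%E ->
  (\int[P]_om F (vertices s om) = \int[mprod vertex_law m]_t F t)%E.
Proof.
move=> sI mF F0.
transitivity (\int[measure_function_pushforward__canonical__measure_function_Measure P
    (measurable_vertices s)]_t F t)%E.
  by rewrite ge0_integral_pushforward//; exact: measurable_vertices.
apply: eq_measure_integral => E mE _; exact: vertices_law.
Qed.

End Laws.

(** * Cliques as events *)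

Section FiniteProducts.
Context {R : realType}.

(** An unordered pair is represented by its increasing ordering, as in the
    edge independence of [girg]. *)
Definition pairs_in n (K : {set 'I_n}) : {set 'I_n * 'I_n} :=
  [set e | [&& e.1 \in K, e.2 \in K & (e.1 < e.2)%N]].

Lemma enum_val_ltn n (K : {set 'I_n}) (i j : 'I_#|K|) :
  (enum_val i < enum_val j)%N = (i < j)%N.
Proof.
have srt : sorted ltn [seq val x | x <- enum K].
  rewrite {1}/enum_mem -enumT; apply: (@subseq_sorted _ _ ltn_trans _ [seq val x | x <- enum 'I_n]).
    by rewrite map_subseq ?filter_subseq.
  by rewrite val_enum_ord iota_ltn_sorted.
have x0 : 'I_n by case: n K i j srt => [|n] K i j _; [have := enum_val i; case|exact: ord0].
have sz : size [seq val x | x <- enum K] = #|K| by rewrite size_map -cardE.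
have E (k : 'I_#|K|) : val (enum_val k) = nth 0%N [seq val x | x <- enum K] k.
  by rewrite (nth_map x0) -?cardE// (enum_val_nth x0).
rewrite -[LHS]/(val (enum_val i) < val (enum_val j))%N !E.
case: (ltngtP i j) => [ij|ji|/val_inj ->].
- by apply: (sorted_ltn_nth ltn_trans) => //; rewrite inE sz.
- apply/negbTE; rewrite -leqNgt ltnW//.
  by apply: (sorted_ltn_nth ltn_trans) => //; rewrite inE sz.
- by rewrite ltnn.
Qed.

Lemma prod_pairs_in n (K : {set 'I_n}) (f : 'I_n -> 'I_n -> R) :
  \prod_(e in pairs_in K) f e.1 e.2 =
  \prod_(i < #|K|) \prod_(j < #|K| | (i < j)%N) f (enum_val i) (enum_val j).
Proof.
transitivity (\prod_(u in K) \prod_(v in K | (u < v)%N) f u v).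
  rewrite pair_big_dep/=; apply: eq_bigl => e.
  by rewrite inE.
rewrite big_enum_val; apply: eq_bigr => i _.
rewrite big_enum_val_cond; apply: eq_bigl => j.
by rewrite enum_val_ltn.
Qed.

(** If two cliques share the vertex u0, their union contains the star joining
    u0 to all the other vertices. *)
Lemma prod_star_le n (K K' : {set 'I_n}) (u0 : 'I_n) (f : 'I_n -> 'I_n -> R) :
  (forall u v, 0 <= f u v <= 1) -> (forall u v, f u v = f v u) ->
  u0 \in K -> u0 \in K' ->
  \prod_(e in pairs_in K :|: pairs_in K') f e.1 e.2 <=
  \prod_(v in (K :|: K') :\ u0) f u0 v.
Proof.
move=> f01 fC uK uK'.
(* the increasing representation of the edge between u0 and v *)
pose phi (v : 'I_n) := if (v < u0)%N then (v, u0) else (u0, v).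
pose S : {set 'I_n * 'I_n} := imset phi (mem ((K :|: K') :\ u0)).
have fphi v : f (phi v).1 (phi v).2 = f u0 v by rewrite /phi; case: ifP => //= _; rewrite fC.
have phiI u v : u \in (K :|: K') :\ u0 -> v \in (K :|: K') :\ u0 -> phi u = phi v -> u = v.
  rewrite !inE => /andP[uu0 _] /andP[vu0 _]; rewrite /phi.
  case: ifP => _; case: ifP => _ [] //.
  - by move=> E; rewrite E eqxx in uu0.
  - by move=> E; rewrite -E eqxx in vu0.
have SS : S \subset pairs_in K :|: pairs_in K'.
  apply/fintype.subsetP => e /imsetP[v]; rewrite !inE => /andP[vu0 vKK'] ->.
  have H : phi v \in pairs_in K \/ phi v \in pairs_in K'.
    case/orP: vKK' => vK; [left|right]; rewrite inE /phi; case: (ltngtP v u0) => vu /=;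
      rewrite ?vK ?uK ?uK' ?vu //; by rewrite (val_inj vu) eqxx in vu0.
  by case: H; rewrite inE => ->; rewrite ?orbT.
have -> : \prod_(v in (K :|: K') :\ u0) f u0 v = \prod_(e in S) f e.1 e.2.
  by rewrite big_imset//=; apply: eq_bigr => v _; rewrite fphi.
rewrite (bigID (mem S))/= -[leRHS]mulr1 ler_pM//.
- by apply: prodr_ge0 => e _; case/andP: (f01 e.1 e.2).
- by apply: prodr_ge0 => e _; case/andP: (f01 e.1 e.2).
- rewrite le_eqVlt; apply/orP; left; apply/eqP; apply: eq_bigl => e.
  by apply/andP/idP => [[]//|eS]; split => //; exact: (fintype.subsetP SS).
- by apply: prodr_ile1.
Qed.

Lemma prod_setU (I : finType) (A B : {set I}) (f : I -> R) : fintype.disjoint (mem A) (mem B) ->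
  \prod_(i in A :|: B) f i = (\prod_(i in A) f i) * \prod_(i in B) f i.
Proof.
by move=> AB; rewrite -bigU//; apply: eq_bigl => i; rewrite !inE.
Qed.

Lemma prod_indic_set (I : finType) T (U : {set I}) (B : set T) (f : I -> T) :
  \prod_(u in U) \1_B (f u) = (`[< forall u, u \in U -> B (f u) >])%:R :> R.
Proof.
case: asboolP => [UB|nUB].
  by rewrite big1// => u uU; rewrite indicE mem_set//; exact: UB.
have [u uU nB] : exists2 u, u \in U & ~ B (f u).
  by apply: contra_notP nUB => H u uU; apply: contra_notP H => nB; exists u.
by rewrite (bigD1 u)//= indicE memNset// mul0r.
Qed.

End FiniteProducts.

Section EdgeEvents.
Context {R : realType}.
Variables (tau w0 g : R) (d n : nat) (disp : measure_display)
  (Omega : measurableType disp) (P : probability Omega R)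
  (G : girg tau w0 g d n P).
Hypotheses (tau2 : 2 < tau) (w00 : 0 < w0).

Local Notation T0 := (R * d.-tuple R)%type.
Local Notation law := (vertex_law d tau2 w00).

Definition kernel (z z' : T0) : R := edge_prob tau w0 g n z.1 z'.1 z.2 z'.2.

Lemma kernelC z z' : kernel z z' = kernel z' z.
Proof. by rewrite /kernel /edge_prob mulrC torus_distC. Qed.

Lemma kernel01 z z' : 0 <= kernel z z' <= 1.
Proof. by rewrite /kernel /edge_prob conn_ge0 conn_le1. Qed.

Lemma measurable_kernel : measurable_fun setT (fun z : T0 * T0 => kernel z.1 z.2).
Proof.
apply: (measurable_fun_comp2 (measurable_conn g)).
  apply: measurable_funM.
    exact: (measurableT_comp measurable_fst measurable_fst).
  exact: (measurableT_comp measurable_fst measurable_snd).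
apply: (measurable_fun_comp2 (F := @torus_scaled R (n%:R * pareto_mean tau w0) d)
  (f := fun z : T0 * T0 => z.1.2) (g := fun z : T0 * T0 => z.2.2)).
- exact: measurable_torus_scaled.
- exact: (measurableT_comp measurable_snd measurable_fst).
- exact: (measurableT_comp measurable_snd measurable_snd).
Qed.

Definition edges_event (U : {set 'I_n}) (S : {set 'I_n * 'I_n}) (B : set R) : set Omega :=
  [set om | (forall u, u \in U -> B (weight G u om)) /\
            (forall e, e \in S -> adj G om e.1 e.2)].

Lemma measurable_edges_event U S B : measurable B -> measurable (edges_event U S B).
Proof.
move=> mB; apply: measurableI.
  rewrite [X in measurable X](_ : _ = \bigcap_(u in [set u | u \in U]) [set om | B (weight G u om)]).
    apply: fin_bigcap_measurable => // u _.
    by apply: measurable_preimage => //; exact: measurable_weight.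
  by apply/seteqP; split => om H u; exact: H.
rewrite [X in measurable X](_ : _ = \bigcap_(e in [set e | e \in S]) [set om | adj G om e.1 e.2]).
  by apply: fin_bigcap_measurable => // e _; exact: adj_measurable.
by apply/seteqP; split => om H u; exact: H.
Qed.

Definition edges_weight (U : {set 'I_n}) (S : {set 'I_n * 'I_n}) (B : set R) (om : Omega) : R :=
  \prod_(u in U) \1_B (weight G u om) *
  \prod_(e in S) kernel (vertex G e.1 om) (vertex G e.2 om).

(** Integrate the conditional probability of the edges over the event that the
    weights are admissible. *)
Lemma prob_edges_event (U : {set 'I_n}) (S : {set 'I_n * 'I_n}) (B : set R) : (forall e, e \in S -> (e.1 < e.2)%N) -> measurable B ->
  P (edges_event U S B) = (\int[P]_om (edges_weight U S B om)%:E)%E.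
Proof.
move=> Sord mB.
pose BB : set (n.-tuple R * n.-tuple (d.-tuple R)) :=
  [set p | forall u, u \in U -> B (tnth p.1 u)].
have mBB : measurable BB.
  rewrite (_ : BB = \bigcap_(u in [set u | u \in U]) ((fun p => tnth p.1 u) @^-1` B)).
    apply: fin_bigcap_measurable => // u _; rewrite -[X in measurable X]setTI.
    exact: (measurableT_comp (measurable_tnth u) measurable_fst).
  by apply/seteqP; split => om H u; exact: H.
have := adj_cond G Sord mBB; set D := [set om | _] => /= H.
have DE : D = [set om | forall u, u \in U -> B (weight G u om)].
  by apply/seteqP; split => om Dom u uU; have := Dom u uU; rewrite /= tnth_mktuple.
have -> : edges_event U S B = D `&` [set om | forall e, e \in S -> adj G om e.1 e.2].
  by rewrite DE; apply/seteqP; split.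
rewrite H integral_mkcond; apply: eq_integral => om _.
rewrite /patch /edges_weight prod_indic_set DE.
case: asboolP => Uom; first by rewrite mem_set// mul1r.
by rewrite memNset// mul0r.
Qed.

Definition clique_weight (B : set R) m (t : m.-tuple T0) : R :=
  (\prod_(i < m) \1_B (tnth t i).1) *
  \prod_(i < m) \prod_(j < m | (i < j)%N) kernel (tnth t i) (tnth t j).

Lemma clique_weight_ge0 B m (t : m.-tuple T0) : 0 <= clique_weight B t.
Proof.
rewrite mulr_ge0//; first by apply: prodr_ge0 => i _.
by apply: prodr_ge0 => i _; apply: prodr_ge0 => j _; case/andP: (kernel01 (tnth t i) (tnth t j)).
Qed.

Lemma measurable_indic_fst (B : set R) : measurable B ->
  measurable_fun setT (fun z : T0 => \1_B z.1 : R).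
Proof. by move=> mB; exact: (measurableT_comp (measurable_indic mB) measurable_fst). Qed.

Lemma measurable_clique_weight B m : measurable B ->
  measurable_fun setT (fun t : m.-tuple T0 => (clique_weight B t)%:E).
Proof.
move=> mB; apply/measurable_EFinP; apply: measurable_funM.
  apply: measurable_rprod => i.
  exact: (measurable_tnth_comp i (measurable_indic_fst mB)).
apply: measurable_rprod => i; apply: measurable_rprod => j.
by apply: (measurable_fun_comp2 measurable_kernel); exact: measurable_tnth.
Qed.

Definition clique_event (K : {set 'I_n}) (B : set R) := edges_event K (pairs_in K) B.

Definition clique_prob (B : set R) m : \bar R :=
  (\int[mprod law m]_t (clique_weight B t)%:E)%E.

Lemma edges_weight_clique (K : {set 'I_n}) B om :
  edges_weight K (pairs_in K) B om =
  clique_weight B (vertices G (@enum_val _ (mem K)) om).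
Proof.
rewrite /edges_weight /clique_weight; congr (_ * _).
  by rewrite big_enum_val; apply: eq_bigr => i _; rewrite tnth_mktuple.
rewrite (prod_pairs_in K (fun u v => kernel (vertex G u om) (vertex G v om))).
by apply: eq_bigr => i _; apply: eq_bigr => j _; rewrite !tnth_mktuple.
Qed.

Lemma pairs_in_ltn (K : {set 'I_n}) e : e \in pairs_in K -> (e.1 < e.2)%N.
Proof. by rewrite inE => /and3P[]. Qed.

Lemma prob_clique (K : {set 'I_n}) B : measurable B ->
  P (clique_event K B) = clique_prob B #|K|.
Proof.
move=> mB; rewrite prob_edges_event//; last exact: pairs_in_ltn.
rewrite /clique_prob -(integral_vertices G tau2 w00 (s := @enum_val _ (mem K))).
- by apply: eq_integral => om _; rewrite edges_weight_clique.
- exact: enum_val_inj.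
- exact: measurable_clique_weight.
- by move=> t; rewrite lee_fin clique_weight_ge0.
Qed.

Lemma clique_eventI (K K' : {set 'I_n}) B :
  clique_event K B `&` clique_event K' B =
  edges_event (K :|: K') (pairs_in K :|: pairs_in K') B.
Proof.
apply/seteqP; split => om.
  by move=> [[A1 A2] [B1 B2]]; split => x; rewrite finset.in_setU => /orP[]; auto.
by move=> [A1 A2]; split; split => x xK; (apply: A1 || apply: A2);
  rewrite finset.in_setU xK ?orbT.
Qed.

Lemma pairs_inU_ltn (K K' : {set 'I_n}) e :
  e \in pairs_in K :|: pairs_in K' -> (e.1 < e.2)%N.
Proof. by rewrite finset.in_setU => /orP[]; exact: pairs_in_ltn. Qed.

(** The two cliques have no edge in common and involve disjoint sets of vertices,
    which are independent. *)
Lemma prob_clique_disjoint (K K' : {set 'I_n}) B : measurable B -> fintype.disjoint (mem K) (mem K') ->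
  P (clique_event K B `&` clique_event K' B) =
  (clique_prob B #|K| * clique_prob B #|K'|)%E.
Proof.
move=> mB KK'.
rewrite clique_eventI prob_edges_event//; last exact: pairs_inU_ltn.
have mc m := measurable_clique_weight (m := m) mB.
have c0 m (t : m.-tuple T0) : (0 <= (clique_weight B t)%:E)%E.
  by rewrite lee_fin clique_weight_ge0.
rewrite -integral_mprod_cat//.
pose s (i : 'I_(#|K| + #|K'|)) : 'I_n :=
  match fintype.split i with inl a => enum_val a | inr b => enum_val b end.
have sl a : s (lshift _ a) = enum_val a.
  by rewrite /s (unsplitK (inl a : 'I_#|K| + 'I_#|K'|)).
have sr b : s (rshift _ b) = enum_val b.
  by rewrite /s (unsplitK (inr b : 'I_#|K| + 'I_#|K'|)).
have sI : injective s.
  have D (a : 'I_#|K|) (b : 'I_#|K'|) : enum_val a <> enum_val b :> 'I_n.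
    move=> ab; have := enum_valP a; have := enum_valP b; rewrite -ab => h1 h2.
    by rewrite (disjointFr KK' h2) in h1.
  move=> i j; rewrite -[i]splitK -[j]splitK.
  case: (fintype.split i) => a; case: (fintype.split j) => b /=; rewrite ?sl ?sr.
  - by move/enum_val_inj ->.
  - by move/D.
  - by move/esym/D.
  - by move/enum_val_inj ->.
rewrite -(integral_vertices G tau2 w00 (s := s))//; last 2 first.
- apply: emeasurable_funM; apply: (measurableT_comp (mc _)); apply: measurable_mktuple => i;
    exact: measurable_tnth.
- by move=> t; rewrite mule_ge0.
apply: eq_integral => om _; rewrite -EFinM; congr EFin.
have -> : [tuple tnth (vertices G s om) (lshift #|K'| i) | i < #|K|] =
    vertices G (@enum_val _ (mem K)) om.
  by apply: eq_from_tnth => i; rewrite !tnth_mktuple sl.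
have -> : [tuple tnth (vertices G s om) (rshift #|K| i) | i < #|K'|] =
    vertices G (@enum_val _ (mem K')) om.
  by apply: eq_from_tnth => i; rewrite !tnth_mktuple sr.
have PP : fintype.disjoint (mem (pairs_in K)) (mem (pairs_in K')).
  rewrite disjoint_subset; apply/fintype.subsetP => e; rewrite !inE => /and3P[eK _ _].
  by rewrite (disjointFr KK' eK).
rewrite -(edges_weight_clique K) -(edges_weight_clique K') /edges_weight.
rewrite (prod_setU _ KK') (prod_setU _ PP).
exact: mulrACA.
Qed.

End EdgeEvents.

(** * Clique probabilities in terms of the weights *)

Lemma measurable_integral_pair (R : realType) d1 d2 (S : measurableType d1)
    (T : measurableType d2) (m : {sigma_finite_measure set T -> \bar R})
    (f : S * T -> \bar R) :
  measurable_fun setT f -> (forall z, (0 <= f z)%E) ->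
  measurable_fun setT (fun s => \int[m]_t f (s, t))%E.
Proof.
move=> mf f0; apply: measurable_integral_param => //.
by rewrite (_ : (fun _ => _) = f)//; apply/funext => -[].
Qed.

Section CliqueProbability.
Context {R : realType}.
Variables (tau w0 g : R) (d n : nat).
Hypotheses (tau2 : 2 < tau) (w00 : 0 < w0).

Local Notation T0 := (R * d.-tuple R)%type.
Local Notation law := (vertex_law d tau2 w00).
Local Notation a := (n%:R * pareto_mean tau w0).

Lemma integral_vertex_law_indic (B : set R) : measurable B ->
  (\int[law]_z (\1_B z.1)%:E = pareto_law tau2 w00 B)%E.
Proof.
move=> mB; rewrite integral_prod_measure//; last first.
  by apply/measurable_EFinP; exact: measurable_indic_fst.
transitivity (\int[pareto_law tau2 w00]_x (\1_B x)%:E)%E.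
  apply: eq_integral => x _ /=.
  rewrite -[RHS]mule1 -(@cube_mass R d) -ge0_integralZl_EFin//.
  by under [RHS]eq_integral do rewrite mule1.
by rewrite integral_indic// setIT.
Qed.

Lemma clique_weight_zip (B : set R) m (w : m.-tuple R) (x : m.-tuple (d.-tuple R)) :
  clique_weight tau w0 g n B [tuple (tnth w i, tnth x i) | i < m] =
  (\prod_(i < m) \1_B (tnth w i)) * clique_prod g (@torus_scaled R a d) w x.
Proof.
congr (_ * _); first by apply: eq_bigr => i _; rewrite tnth_mktuple.
by apply: eq_bigr => i _; apply: eq_bigr => j _; rewrite !tnth_mktuple.
Qed.

(** Integrate over the positions first, then insert the Pareto density: the
    constant of the density comes out once per vertex. *)
Lemma clique_probE (B : set R) m : measurable B ->
  clique_prob g d n tau2 w00 B m =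
  ((pareto_const tau w0 ^+ m)%:E * weight_integral tau w0 g d m a B)%E.
Proof.
move=> mB; rewrite /clique_prob.
rewrite (integral_mprod_zip (@integral_prod_measure R _ _ _ _ _ _)); last 2 first.
- exact: measurable_clique_weight.
- by move=> t; rewrite lee_fin clique_weight_ge0.
have B0 (w : m.-tuple R) : 0 <= \prod_(i < m) \1_B (tnth w i) :> R.
  by apply: prodr_ge0 => i _.
transitivity (\int[mprod (pareto_law tau2 w00) m]_w
    ((\prod_(i < m) \1_B (tnth w i))%:E * torus_clique g d a w))%E.
  apply: eq_integral => w _; rewrite /torus_clique.
  rewrite -(ge0_integralZl_EFin (mprod (cube d) m) measurableT); last 3 first.
  - by move=> x _; rewrite lee_fin clique_prod_ge0.
  - by apply: measurable_clique_prod_pos; exact: measurable_torus_scaled.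
  - exact: B0.
  by apply: eq_integral => x _; rewrite clique_weight_zip.
have mBw : measurable_fun setT (fun w : m.-tuple R => (\prod_(i < m) \1_B (tnth w i))%:E : \bar R).
  apply/measurable_EFinP; apply: measurable_rprod => i.
  exact: (measurable_tnth_comp i (measurable_indic mB)).
rewrite (integral_mprod_subst (m' := leb_ge w0)
  (h := fun _ x => (pareto_density tau w0 x)%:E) (phi := fun _ x => x))//; last 5 first.
- by move=> i; apply/measurable_EFinP; exact: measurable_pareto_density.
- by move=> i x; rewrite lee_fin pareto_density_ge0.
- by move=> i f mf f0; rewrite integral_pareto.
- by apply: (emeasurable_funM mBw); exact: measurable_torus_clique.
- by move=> t; rewrite mule_ge0 ?torus_clique_ge0 ?lee_fin.
rewrite /weight_integral -(ge0_integralZl_EFin (mprod (leb_ge w0) m) measurableT); last 3 first.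
- move=> w _; rewrite mule_ge0 ?torus_clique_ge0// lee_fin.
  by apply: prodr_ge0 => i _; rewrite mulr_ge0 ?powR_ge0.
- apply: emeasurable_funM; last exact: measurable_torus_clique.
  have := measurable_weight_factor (k := m) tau 1 mB.
  by under eq_fun do under eq_bigr do rewrite mul1r.
- by rewrite exprn_ge0// ltW// pareto_const_gt0.
apply: eq_integral => w _.
have -> : [tuple tnth w i | i < m] = w by exact: tnth_tuple_eta.
rewrite muleA [in RHS]muleA; congr (_ * _)%E.
rewrite prodEFin -EFinM -[RHS]EFinM; congr EFin.
have -> : pareto_const tau w0 ^+ m = \prod_(i < m) pareto_const tau w0.
  by rewrite prodr_const card_ord.
rewrite -!big_split/=.
by apply: eq_bigr => i _; rewrite /pareto_density mulrA.
Qed.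

(** The edge probability, averaged over the position of the second endpoint, is
    at most linear in the product of the two weights, which is at most L^2. *)
Lemma kernel_mass_le (L : R) (z : T0) : 1 < g -> (0 < d)%N -> (0 < n)%N -> 
  0 < z.1 <= L -> in_cube z.2 ->
  (\int[law]_z' (\1_`]0, L] z'.1 * kernel tau w0 g n z z')%:E <=
   (conn_const g d * (L ^+ 2 / a))%:E)%E.
Proof.
move=> g1 d0 n0 /andP[z0 zL] zc.
have a0 : 0 < a by rewrite mulr_gt0 ?ltr0n ?pareto_mean_gt0.
have L0 : 0 < L := lt_le_trans z0 zL.
have K0 z' : 0 <= kernel tau w0 g n z z' by case/andP: (kernel01 tau w0 g n z z').
have mk : measurable_fun setT (kernel tau w0 g n z).
  exact: (measurableT_comp (measurable_kernel tau w0 g n) (pair1_measurable z)).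
have mF : measurable_fun setT
    (fun z' : T0 => (\1_`]0, L] z'.1 * kernel tau w0 g n z z')%:E).
  apply/measurable_EFinP; apply: (measurable_funM _ mk).
  by apply: measurable_indic_fst.
have F0 z' : (0 <= (\1_`]0, L] z'.1 * kernel tau w0 g n z z')%:E :> \bar R)%E.
  by rewrite lee_fin mulr_ge0.
rewrite integral_prod_measure//.
have q0 : 0 <= conn_const g d * (L ^+ 2 / a).
  by rewrite mulr_ge0 ?conn_const_ge0// divr_ge0 ?exprn_ge0 ?ltW.
apply: (@le_trans _ _ (\int[pareto_law tau2 w00]_w (conn_const g d * (L ^+ 2 / a))%:E)%E); last first.
  by rewrite integral_cst// [X in (_ * X)%E](pareto_mass tau2 w00) mule1.
apply: ge0_le_integral => //.
- by move=> w _; apply: integral_ge0 => x _; rewrite lee_fin mulr_ge0.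
- exact: (measurable_integral_pair _ mF F0).
move=> w _ /=.
have [wB|nwB] := pselect (`]0, L]%classic w); last first.
  by under eq_integral do rewrite indicE memNset// mul0r; rewrite integral0 lee_fin.
have /andP[w1 wL] : 0 < w <= L by move: wB; rewrite /= in_itv.
under eq_integral do rewrite indicE mem_set// mul1r /kernel /edge_prob /= conn_scale//.
apply: (le_trans (integral_cube_conn _ _ _ _)) => //.
  by rewrite divr_gt0// mulr_gt0.
rewrite lee_fin -/(conn_const g d) ler_wpM2l ?conn_const_ge0//.
by rewrite ler_pM2r ?invr_gt0// expr2 ler_pM// ltW.
Qed.

Lemma star_mass_le (L : R) m (p : 'I_m) : 1 < g -> (0 < d)%N -> (0 < n)%N -> 
  (\int[mprod law m]_t ((\1_`]0, L] (tnth t p).1)%:E * \prod_(j < m | j != p)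
     (\1_`]0, L] (tnth t j).1 * kernel tau w0 g n (tnth t p) (tnth t j))%:E) <=
   ((conn_const g d * (L ^+ 2 / a)) ^+ m.-1)%:E)%E.
Proof.
move=> g1 d0 n0.
have K0 z z' : 0 <= kernel tau w0 g n z z' by case/andP: (kernel01 tau w0 g n z z').
have mB : measurable_fun setT (fun z : T0 => \1_`]0, L] z.1 : R) by apply: measurable_indic_fst.
have mBk : measurable_fun setT (fun z : T0 * T0 => \1_`]0, L] z.2.1 * kernel tau w0 g n z.1 z.2).
  apply: measurable_funM; first exact: (measurableT_comp mB measurable_snd).
  exact: measurable_kernel.
rewrite (@integral_mprod_pivot _ _ _ _ _ p (fun z => (\1_`]0, L] z.1)%:E)
  (fun _ z z' => (\1_`]0, L] z'.1 * kernel tau w0 g n z z')%:E))//; last 3 first.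
- exact/measurable_EFinP.
- by move=> j; exact/measurable_EFinP.
- by move=> j z z'; rewrite lee_fin mulr_ge0.
set q := conn_const g d * _.
have a0 : 0 <= a by rewrite mulr_ge0// ltW// pareto_mean_gt0.
have q0 : 0 <= q.
  by rewrite mulr_ge0 ?conn_const_ge0// divr_ge0 ?exprn_even_ge0.
have Fge z : (0 <= (\1_`]0%R, L] z.1)%:E * \prod_(j < m | j != p)
    \int[law]_y (\1_`]0%R, L] y.1 * kernel tau w0 g n z y)%:E)%E.
  rewrite mule_ge0 ?lee_fin//; apply: prode_ge0 => j _.
  by apply: integral_ge0 => y _; rewrite lee_fin mulr_ge0.
have mF : measurable_fun setT (fun z : T0 => (\1_`]0%R, L] z.1)%:E * \prod_(j < m | j != p)
    \int[law]_y (\1_`]0%R, L] y.1 * kernel tau w0 g n z y)%:E)%E.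
  apply: emeasurable_funM; first exact/measurable_EFinP.
  apply: measurable_eprod => j.
  apply: measurable_integral_param => [|z z']; last by rewrite lee_fin mulr_ge0.
  exact/measurable_EFinP.
rewrite integral_prod_measure//.
apply: (@le_trans _ _ (\int[pareto_law tau2 w00]_w \int[cube d]_x (q ^+ m.-1)%:E)%E); last first.
  under eq_integral => w _.
    rewrite (_ : \int[cube d]_x (q ^+ m.-1)%:E = (q ^+ m.-1)%:E)%E; last first.
      rewrite -[RHS]mule1 -(@cube_mass R d) -ge0_integralZl_EFin ?exprn_ge0//.
      by under [RHS]eq_integral do rewrite mule1.
    over.
  by rewrite integral_cst// [X in (_ * X)%E](pareto_mass tau2 w00) mule1.
apply: ge0_le_integral => //.
- by move=> w _; apply: integral_ge0 => x _.
- exact: (measurable_integral_pair _ mF Fge).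
move=> w _.
apply: (le_integral_supported (@supported_cube R d)) => //.
- exact: (measurableT_comp mF).
- by move=> x; rewrite lee_fin exprn_ge0.
move=> x xc.
have [wL|nwL] := pselect (`]0, L]%classic w); last first.
  by rewrite indicE memNset// mul0e lee_fin exprn_ge0.
rewrite indicE mem_set// mul1e -(prod_neq_const p).
apply: prod_EFin_le_cond => j _; apply/andP; split.
  by apply: integral_ge0 => y _; rewrite lee_fin mulr_ge0.
by apply: kernel_mass_le => //; move: wL; rewrite /= in_itv.
Qed.

End CliqueProbability.

(** * Overlapping pairs of cliques *)

Section OverlapBounds.
Context {R : realType}.
Variables (tau w0 g : R) (d n : nat) (disp : measure_display)
  (Omega : measurableType disp) (P : probability Omega R)
  (G : girg tau w0 g d n P).
Hypotheses (tau2 : 2 < tau) (w00 : 0 < w0).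

Local Notation T0 := (R * d.-tuple R)%type.
Local Notation law := (vertex_law d tau2 w00).
Local Notation a := (n%:R * pareto_mean tau w0).

Lemma edges_weight_le (U : {set 'I_n}) S (B : set R) om :
  edges_weight G U S B om <= \prod_(u in U) \1_B (weight G u om).
Proof.
rewrite -[leRHS]mulr1 ler_wpM2l//; first by apply: prodr_ge0 => u _.
by apply: prodr_ile1 => e _; exact: kernel01.
Qed.

Lemma edges_weight_ge0 (U : {set 'I_n}) S (B : set R) om :
  0 <= edges_weight G U S B om.
Proof.
rewrite mulr_ge0//; first by apply: prodr_ge0 => u _.
by apply: prodr_ge0 => e _; case/andP: (kernel01 tau w0 g n (vertex G e.1 om) (vertex G e.2 om)).
Qed.

Lemma measurable_edges_weight (U : {set 'I_n}) S (B : set R) : measurable B ->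
  measurable_fun setT (edges_weight G U S B).
Proof.
move=> mB; apply: measurable_funM.
  apply: measurable_rprod => u.
  exact: (measurableT_comp (measurable_indic mB) (measurable_weight G u)).
apply: measurable_rprod => e.
by apply: (measurable_fun_comp2 (measurable_kernel tau w0 g n));
  exact: measurable_vertex.
Qed.

(** Forget the edges and keep only the constraint on the weights. *)
Lemma prob_edges_le_law (U : {set 'I_n}) (S : {set 'I_n * 'I_n}) (B : set R) (q : R) :
  (forall e, e \in S -> (e.1 < e.2)%N) -> measurable B ->
  pareto_law tau2 w00 B = q%:E -> (P (edges_event G U S B) <= (q ^+ #|U|)%:E)%E.
Proof.
move=> Sord mB Bq; rewrite prob_edges_event//.
have mfB : measurable_fun setT (fun z : T0 => (\1_B z.1)%:E : \bar R).
  by apply/measurable_EFinP; exact: measurable_indic_fst.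
pose F (t : #|U|.-tuple T0) : \bar R := (\prod_(i < #|U|) (\1_B (tnth t i).1)%:E)%E.
have mF : measurable_fun setT F.
  by apply: measurable_eprod => i; exact: (measurable_tnth_comp i mfB).
have F0 t : (0 <= F t)%E by apply: prode_ge0 => i _; rewrite lee_fin.
have FE om : (\prod_(u in U) \1_B (weight G u om))%:E = F (vertices G (@enum_val _ (mem U)) om).
  by rewrite /F prodEFin big_enum_val; congr EFin; apply: eq_bigr => i _; rewrite tnth_mktuple.
apply: (@le_trans _ _ (\int[P]_om F (vertices G (@enum_val _ (mem U)) om))%E).
  apply: ge0_le_integral => //.
  - by move=> om _; rewrite lee_fin edges_weight_ge0.
  - by apply/measurable_EFinP; exact: measurable_edges_weight.
  - by apply: (measurableT_comp mF); exact: measurable_vertices.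
  - by move=> om _; rewrite -FE lee_fin edges_weight_le.
rewrite (integral_vertices G tau2 w00)//; last exact: enum_val_inj.
rewrite (integral_mprod_prod _ (f := fun _ z => (\1_B z.1)%:E))//.
under eq_bigr do rewrite integral_vertex_law_indic// Bq.
by rewrite prodEFin prodr_const card_ord.
Qed.

(** Keep only the star at a common vertex u0 in the union of the two
    cliques. *)
Lemma prob_overlap_star (K K' : {set 'I_n}) (u0 : 'I_n) (L : R) :
  1 < g -> (0 < d)%N -> (0 < n)%N -> u0 \in K -> u0 \in K' ->
  (P (clique_event G K `]0%R, L] `&` clique_event G K' `]0%R, L]) <=
   ((conn_const g d * (L ^+ 2 / a)) ^+ #|K :|: K'|.-1)%:E)%E.
Proof.
move=> g1 d0 n0 uK uK'.
set B := `]0%R, L]%classic; have mB : measurable B by exact: measurable_itv.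
rewrite clique_eventI prob_edges_event//; last exact: pairs_inU_ltn.
set U := K :|: K'.
have uU : u0 \in U by rewrite finset.in_setU uK.
(* p is the index of u0 in the enumeration of U *)
pose p : 'I_#|U| := enum_rank_in uU u0.
have pE : enum_val p = u0 by rewrite enum_rankK_in.
pose F (t : #|U|.-tuple T0) : \bar R := ((\1_B (tnth t p).1)%:E * \prod_(j < #|U| | j != p)
     (\1_B (tnth t j).1 * kernel tau w0 g n (tnth t p) (tnth t j))%:E)%E.
have K0 z z' : 0 <= kernel tau w0 g n z z' by case/andP: (kernel01 tau w0 g n z z').
have F0 t : (0 <= F t)%E.
  rewrite mule_ge0 ?lee_fin//; apply: prode_ge0 => j _.
  by rewrite lee_fin mulr_ge0.
have mt (i : 'I_#|U|) : measurable_fun setT (fun t : #|U|.-tuple T0 => \1_B (tnth t i).1 : R).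
  have H := measurable_indic_fst (d := d) mB.
  have H2 := measurable_tnth_comp i H.
  exact H2.
have mF : measurable_fun setT F.
  apply: emeasurable_funM; first exact/measurable_EFinP.
  apply: measurable_eprod => j; apply/measurable_EFinP; apply: measurable_funM => //.
  by apply: (measurable_fun_comp2 (measurable_kernel tau w0 g n)); exact: measurable_tnth.
have FE om : F (vertices G (@enum_val _ (mem U)) om) =
    ((\prod_(u in U) \1_B (weight G u om)) *
     \prod_(v in U :\ u0) kernel tau w0 g n (vertex G u0 om) (vertex G v om))%:E.
  rewrite /F prodEFin -EFinM; congr EFin.
  have E1 : \prod_(u in U) \1_B (weight G u om) =
      \1_B (weight G u0 om) * \prod_(j < #|U| | j != p) \1_B (weight G (enum_val j) om) :> R.
    by rewrite big_enum_val (bigD1 p)//= pE.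
  have E2 : \prod_(v in U :\ u0) kernel tau w0 g n (vertex G u0 om) (vertex G v om) =
      \prod_(j < #|U| | j != p) kernel tau w0 g n (vertex G u0 om) (vertex G (enum_val j) om).
    transitivity (\prod_(v in U | v != u0) kernel tau w0 g n (vertex G u0 om) (vertex G v om)).
      by apply: eq_bigl => v; rewrite finset.in_setD1 andbC.
    rewrite big_enum_val_cond; apply: eq_bigl => j.
    by rewrite -pE (inj_eq enum_val_inj).
  rewrite E1 E2 -mulrA -big_split/= tnth_mktuple pE; congr (_ * _).
  by apply: eq_bigr => j _; rewrite !tnth_mktuple.
apply: (@le_trans _ _ (\int[P]_om F (vertices G (@enum_val _ (mem U)) om))%E).
  apply: ge0_le_integral => //.
  - by move=> om _; rewrite lee_fin edges_weight_ge0.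
  - by apply/measurable_EFinP; exact: measurable_edges_weight.
  - by apply: (measurableT_comp mF); exact: measurable_vertices.
  - move=> om _; rewrite FE lee_fin /edges_weight ler_wpM2l//.
      by apply: prodr_ge0 => u _.
    apply: (prod_star_le (f := fun u v => kernel tau w0 g n (vertex G u om) (vertex G v om))) => //.
    + by move=> u v; exact: kernel01.
    + by move=> u v; exact: kernelC.
rewrite (integral_vertices G tau2 w00)//; last exact: enum_val_inj.
exact: star_mass_le.
Qed.

End OverlapBounds.

Section PairCount.
Context {R : realType}.

Lemma bin_le_exp n s : ('C(n, s) <= n ^ s)%N.
Proof.
rewrite -(leq_pmul2r (fact_gt0 s)) bin_ffact (@leq_trans (n ^ s))//.
  rewrite ffact_prod -[X in (_ <= n ^ X)%N]card_ord -prod_nat_const.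
  by apply: leq_prod => i _; exact: leq_subr.
by rewrite leq_pmulr// fact_gt0.
Qed.

Lemma sum1_natr (I : finType) (Q : pred I) :
  \sum_(i | Q i) 1 = (\sum_(i | Q i) 1)%N%:R :> R.
Proof. by rewrite natr_sum. Qed.

(** Sort the pairs by their union U, which has fewer than 2k elements. A set of
    s vertices contains at most 4^s pairs of subsets, and there are at most n^s
    such sets. *)
Lemma sum_overlap_le n k (r : R) : 0 <= r ->
  \sum_(K : {set 'I_n} | #|K| == k)
    \sum_(K' : {set 'I_n} | (#|K'| == k) && ~~ fintype.disjoint (mem K) (mem K'))
      r ^+ #|K :|: K'| <=
  \sum_(s < k.*2) (4 * n%:R * r) ^+ s.
Proof.
move=> r0; rewrite pair_big_dep/=.
pose U (p : {set 'I_n} * {set 'I_n}) := p.1 :|: p.2.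
have Ult (p : {set 'I_n} * {set 'I_n}) : (#|p.1| == k) && ((#|p.2| == k) && ~~ fintype.disjoint (mem p.1) (mem p.2)) ->
    (#|U p| < k.*2)%N.
  case: p => K K' /= /and3P[/eqP Kk /eqP K'k KK'].
  rewrite -setI_eq0 -cards_eq0 -lt0n in KK'.
  rewrite /U/= cardsU Kk K'k -addnn.
  have : (0 < k)%N by rewrite -Kk (leq_trans KK')// subset_leq_card// finset.subsetIl.
  move: KK'; lia.
have cU (V : {set 'I_n}) : (\sum_(p : {set 'I_n} * {set 'I_n} | U p == V) 1 <= 4 ^ #|V|)%N.
  rewrite sum1_card (_ : 4 = 2 * 2)%N// expnMn -card_powerset -cardsX subset_leq_card//.
  apply/fintype.subsetP => -[K K'] UV; have <- : U (K, K') = V by apply/eqP.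
  by rewrite finset.in_setX !powersetE/= finset.subsetUl finset.subsetUr.
rewrite (partition_big U (fun V => #|V| < k.*2)%N)//=.
apply: (@le_trans _ _ (\sum_(V : {set 'I_n} | (#|V| < k.*2)%N) (4 * r) ^+ #|V|)).
  apply: ler_sum => V _.
  rewrite big_mkcondl/= (le_trans (y := \sum_(p | U p == V) 1 * r ^+ #|V|))//.
    apply: ler_sum => p /eqP UV; rewrite mul1r; case: ifP => _; rewrite ?exprn_ge0//.
    by rewrite -/(U p) UV.
  rewrite -mulr_suml exprMn ler_wpM2r ?exprn_ge0// -natrX sum1_natr ler_nat.
  exact: cU.
apply: (@le_trans _ _ (\sum_(s < k.*2) \sum_(V : {set 'I_n} | #|V| == s) (4 * r) ^+ s)).
  rewrite (exchange_big_dep xpredT)//= big_mkcond/=.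
  apply: ler_sum => V _; case: ifP => [Vk|_]; last first.
    by apply: sumr_ge0 => s _; rewrite exprn_ge0// mulr_ge0.
  rewrite (bigD1 (Ordinal Vk))//= lerDl.
  by apply: sumr_ge0 => s _; rewrite exprn_ge0// mulr_ge0.
apply: ler_sum => s _.
rewrite (eq_bigr (fun=> 1 * (4 * r) ^+ s)); last by move=> V _; rewrite mul1r.
rewrite -mulr_suml mulrAC [leRHS]exprMn [leLHS]mulrC ler_wpM2l ?exprn_ge0 ?mulr_ge0//.
rewrite -natrX sum1_natr ler_nat (leq_trans _ (bin_le_exp n s))//.
rewrite sum1_card -[X in 'C(X, _)]card_ord -cardsT -cards_draws subset_leq_card//.
by apply/fintype.subsetP => V Vs; rewrite inE finset.subsetT; exact: Vs.
Qed.

End PairCount.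

(** * The second moment method *)

Lemma measurable_le_set (R : realType) d (T : measurableType d) (f h : T -> R) :
  measurable_fun setT f -> measurable_fun setT h ->
  measurable [set x | f x <= h x].
Proof.
move=> mf mh; rewrite -[X in measurable X]setTI.
by have := measurable_fun_ler mf mh; move=> /(_ measurableT [set true]) H; exact: H.
Qed.

Lemma measurable_rsum_cond (R : realType) d (T : measurableType d) (I : Type)
    (s : seq I) (Q : pred I) (f : I -> T -> R) :
  (forall i, measurable_fun setT (f i)) ->
  measurable_fun setT (fun x => \sum_(i <- s | Q i) f i x).
Proof.
move=> mf; under eq_fun do rewrite -big_filter.
exact: measurable_sum.
Qed.

Lemma integral_sum_cond (R : realType) d (T : measurableType d)
    (m : {measure set T -> \bar R}) (I : Type) (s : seq I) (Q : pred I)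
    (f : I -> T -> \bar R) :
  (forall i, measurable_fun setT (f i)) -> (forall i x, 0 <= f i x)%E ->
  (\int[m]_x \sum_(i <- s | Q i) f i x = \sum_(i <- s | Q i) \int[m]_x f i x)%E.
Proof.
move=> mf f0; under eq_integral do rewrite -big_filter.
by rewrite -big_filter ge0_integral_sum.
Qed.

Section SecondMoment.
Context {R : realType} {disp : measure_display} {Omega : measurableType disp}
  {P : probability Omega R}.

Lemma markov_ge0 (f : Omega -> R) (A : set Omega) (t : R) :
  measurable A -> measurable_fun setT f -> (forall om, 0 <= f om) -> 0 < t ->
  (forall om, A om -> t <= f om) ->
  (P A <= (t^-1)%:E * \int[P]_om (f om)%:E)%E.
Proof.
move=> mA mf f0 t0 tf; have ti0 : 0 <= t^-1 by rewrite invr_ge0 ltW.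
have f0' om : (0 <= (f om)%:E)%E by rewrite lee_fin.
rewrite -ge0_integralZl_EFin//; last exact/measurable_EFinP.
rewrite -[A in leLHS]setIT -integral_indic//.
apply: ge0_le_integral => //.
- by apply/measurable_EFinP; exact: measurable_indic.
- by apply/measurable_EFinP; exact: measurable_funM.
move=> om _; rewrite -EFinM lee_fin indicE.
have [/set_mem Aom|_] := boolP (om \in A); last by rewrite mulr_ge0.
by rewrite -(@mulVf _ t) ?gt_eqF// ler_wpM2l// tf.
Qed.

Lemma chebyshev_ge0 (X : Omega -> R) (m v t : R) :
  measurable_fun setT X -> 0 < t ->
  (\int[P]_om ((X om - m) ^+ 2)%:E <= v%:E)%E ->
  (P [set om | (t <= `|X om - m|)%R] <= (v / t ^+ 2)%:E)%E.
Proof.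
move=> mX t0 Xv.
have mXm : measurable_fun setT (fun om => X om - m) by exact: measurable_funB.
have mA : measurable [set om | t <= `|X om - m|].
  by apply: measurable_le_set => //; exact: measurableT_comp.
apply: (le_trans (markov_ge0 (f := fun om => (X om - m) ^+ 2) (t := t ^+ 2) mA _ _ _ _)).
- exact: measurable_funX.
- by move=> om; rewrite sqr_ge0.
- by rewrite exprn_gt0.
- by move=> om /= tX; rewrite -[leRHS]real_normK ?num_real// lerXn2r ?nnegrE ?(ltW t0).
by rewrite mulrC EFinM lee_wpmul2l// lee_fin invr_ge0 exprn_ge0// ltW.
Qed.

Variables (I : finType) (Q : pred I) (D : rel I) (E : I -> set Omega) (p : I -> R).
Hypotheses (mE : forall i, measurable (E i)) (pE : forall i, P (E i) = (p i)%:E).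

Definition event_count (om : Omega) : R := \sum_(i | Q i) \1_(E i) om.

Definition event_mean : R := \sum_(i | Q i) p i.

Lemma measurable_event_count : measurable_fun setT event_count.
Proof. by apply: measurable_rsum_cond => i; exact: measurable_indic. Qed.

Lemma event_count_ge0 om : 0 <= event_count om.
Proof. by apply: sumr_ge0 => i _. Qed.

Lemma event_mean_ge0 : 0 <= event_mean.
Proof. by apply: sumr_ge0 => i _; rewrite -lee_fin -pE. Qed.

Lemma integral_event_count : (\int[P]_om (event_count om)%:E = event_mean%:E)%E.
Proof.
under eq_integral do rewrite /event_count -sumEFin.
rewrite integral_sum_cond//; last first.
  by move=> i; apply/measurable_EFinP; exact: measurable_indic.
rewrite /event_mean -sumEFin; apply: eq_bigr => i _.
by rewrite integral_indic// setIT; exact: pE.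
Qed.

Lemma integral_event_count_sqr :
  (\int[P]_om ((event_count om) ^+ 2)%:E =
   \sum_(i | Q i) \sum_(j | Q j) P (E i `&` E j))%E.
Proof.
transitivity (\int[P]_om (\sum_(i | Q i) \sum_(j | Q j) (\1_(E i `&` E j) om)%:E))%E.
  apply: eq_integral => om _.
  under eq_bigr do rewrite sumEFin.
  rewrite sumEFin expr2 /event_count mulr_suml; congr EFin.
  apply: eq_bigr => i _; rewrite mulr_sumr; apply: eq_bigr => j _.
  by rewrite indicI.
rewrite integral_sum_cond//; last 2 first.
- move=> i; under eq_fun do rewrite sumEFin; apply/measurable_EFinP.
  apply: measurable_rsum_cond => j.
  by apply: measurable_indic; exact: measurableI.
- by move=> i om; apply: sume_ge0 => j _; rewrite lee_fin.
apply: eq_bigr => i _; rewrite integral_sum_cond//; last first.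
  move=> j; apply/measurable_EFinP.
  by apply: measurable_indic; exact: measurableI.
apply: eq_bigr => j _; rewrite integral_indic ?setIT//; exact: measurableI.
Qed.

(** The variance of a number of events is at most the sum of P(E_i and E_j)
    over the dependent pairs (those related by D), because the other pairs
    have zero covariance. *)
Lemma event_variance_le (v : R) :
  (forall i j, Q i -> Q j -> ~~ D i j -> P (E i `&` E j) = (p i * p j)%:E) ->
  (\sum_(i | Q i) \sum_(j | Q j && D i j) P (E i `&` E j) <= v%:E)%E ->
  (\int[P]_om ((event_count om - event_mean) ^+ 2)%:E <= v%:E)%E.
Proof.
move=> indep Vv.
have m0 := event_mean_ge0; have mc := measurable_event_count.
have mm : measurable_fun setT (fun om => (event_count om - event_mean) ^+ 2).
  by apply: measurable_funX; exact: measurable_funB.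
(* expand the square with the negative term moved to the left, so that all integrands are
   nonnegative *)
have H : (\int[P]_om ((event_count om - event_mean) ^+ 2)%:E +
    \int[P]_om ((2 * event_mean) * event_count om)%:E =
  \int[P]_om (event_count om ^+ 2)%:E + \int[P]_om (event_mean ^+ 2)%:E)%E.
  rewrite -ge0_integralD//; last 4 first.
  - by move=> om _; rewrite lee_fin sqr_ge0.
  - exact/measurable_EFinP.
  - by move=> om _; rewrite lee_fin !mulr_ge0// event_count_ge0.
  - by apply/measurable_EFinP; exact: measurable_funM.
  rewrite -ge0_integralD//; last 3 first.
  - by move=> om _; rewrite lee_fin sqr_ge0.
  - by apply/measurable_EFinP; exact: measurable_funX.
  - by move=> om _; rewrite lee_fin sqr_ge0.
  by apply: eq_integral => om _; rewrite -!EFinD; congr EFin; ring.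
have E2 : (\int[P]_om ((2 * event_mean) * event_count om)%:E = (2 * event_mean ^+ 2)%:E)%E.
  under eq_integral do rewrite EFinM.
  rewrite ge0_integralZl_EFin ?mulr_ge0//.
  - by rewrite integral_event_count -EFinM expr2 mulrA.
  - by move=> om _; rewrite lee_fin event_count_ge0.
  - exact/measurable_EFinP.
have E3 : (\int[P]_om (event_mean ^+ 2)%:E = (event_mean ^+ 2)%:E)%E.
  by rewrite integral_cst// [X in (_ * X)%E]probability_setT mule1.
have E4 : (\int[P]_om (event_count om ^+ 2)%:E <= (v + event_mean ^+ 2)%:E)%E.
  rewrite integral_event_count_sqr.
  apply: (@le_trans _ _ (\sum_(i | Q i) (\sum_(j | Q j && D i j) P (E i `&` E j) +
      \sum_(j | Q j) (p i * p j)%:E))%E).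
    apply: lee_sum => i Qi; rewrite (bigID (D i))/= leeD2l//.
    rewrite (eq_bigr (fun j => (p i * p j)%:E)); last first.
      by move=> j /andP[Qj nD]; exact: indep.
    rewrite [leRHS](bigID (D i))/= -[leLHS]add0e leeD2r// sume_ge0// => j _.
    by rewrite lee_fin mulr_ge0// -lee_fin -pE.
  rewrite big_split/= EFinD leeD//.
  under eq_bigr do rewrite sumEFin -mulr_sumr.
  by rewrite sumEFin -mulr_suml expr2.
move: H; rewrite E2 E3 => H.
rewrite -(@leeD2rE _ (2 * event_mean ^+ 2)%:E)// H -EFinD.
have -> : v + 2 * event_mean ^+ 2 = (v + event_mean ^+ 2) + event_mean ^+ 2 by ring.
by rewrite [leRHS]EFinD leeD2r.
Qed.

End SecondMoment.

Section Truncation.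
Context {R : realType} (disp : nat -> measure_display)
  (Omega : forall n, measurableType (disp n))
  (P : forall n, probability (Omega n) R).

(** The truncated count NB concentrates by Chebyshev's inequality. The removed
    part N - NB is nonnegative and its mean is negligible, so that it is small
    by Markov's inequality. *)
Lemma cvg_in_prob_truncation (N NB : forall n, Omega n -> R) (s e eB v : nat -> R) (c : R) :
  (forall n, measurable_fun setT (N n)) -> (forall n, measurable_fun setT (NB n)) ->
  (forall n om, 0 <= NB n om <= N n om) ->
  (forall n, \int[P n]_om (N n om)%:E = (e n)%:E)%E ->
  (forall n, \int[P n]_om (NB n om)%:E = (eB n)%:E)%E ->
  (\forall n \near \oo, \int[P n]_om ((NB n om - eB n) ^+ 2)%:E <= (v n)%:E)%E ->
  (\forall n \near \oo, 0 < s n) ->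
  e n / s n @[n --> \oo] --> c -> eB n / s n @[n --> \oo] --> c ->
  v n / s n ^+ 2 @[n --> \oo] --> (0 : R) ->
  cvg_in_prob P (fun n om => N n om / s n) c.
Proof.
move=> mN mNB NBN eE eBE vE s0 ec eBc vs eps eps0.
(* N/s - c is cut into (N - NB)/s, (NB - eB)/s and eB/s - c, each allowed eps/3: Markov
   for the first, Chebyshev for the second, and the third is deterministic *)
pose u n := (3 / eps) * (e n / s n - eB n / s n) + (9 / eps ^+ 2) * (v n / s n ^+ 2).
have u0 : u n @[n --> \oo] --> (0 : R).
  have -> : (0 : R) = (3 / eps) * (c - c) + (9 / eps ^+ 2) * 0 by rewrite subrr !mulr0 addr0.
  by apply: cvgD; apply: cvgMr; [exact: cvgB|].
apply: (squeeze_cvge (f := fun=> 0%E) (h := fun n => (u n)%:E)); [|exact: cvg_cst|]; last first.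
  by apply: cvg_EFin => //; exact: nearW.
have e3 : 0 < eps / 3 by rewrite divr_gt0.
near=> n.
rewrite measure_ge0/=.
have sn : 0 < s n by near: n.
have tn : 0 < s n * (eps / 3) by rewrite mulr_gt0.
have vn : (\int[P n]_om ((NB n om - eB n) ^+ 2)%:E <= (v n)%:E)%E by near: n.
have cn : `|c - eB n / s n| < eps / 3.
  by near: n; move/cvgrPdist_lt : eBc; apply.
pose A1 : set (Omega n) := [set om | s n * (eps / 3) <= N n om - NB n om].
pose A2 : set (Omega n) := [set om | s n * (eps / 3) <= `|NB n om - eB n|].
have mD : measurable_fun setT (fun om => N n om - NB n om) by exact: measurable_funB.
have mA1 : measurable A1.
  exact: measurable_le_set.
have mA2 : measurable A2.
  by apply: measurable_le_set => //; apply: measurableT_comp => //; exact: measurable_funB.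
have D0 om : 0 <= N n om - NB n om by rewrite subr_ge0; case/andP: (NBN n om).
have iD : (\int[P n]_om (N n om - NB n om)%:E = (e n - eB n)%:E)%E.
  have H : (\int[P n]_om (N n om - NB n om)%:E + (eB n)%:E = (e n)%:E)%E.
    rewrite -eE -eBE -ge0_integralD//; last 4 first.
    - by move=> om _; rewrite lee_fin.
    - exact/measurable_EFinP.
    - by move=> om _; rewrite lee_fin; case/andP: (NBN n om).
    - exact/measurable_EFinP.
    by apply: eq_integral => om _; rewrite -EFinD subrK.
  by rewrite EFinB -H addeK.
apply: (@le_trans _ _ (P n (A1 `|` A2))).
  apply: le_measure; rewrite ?inE.
  - have mZ : measurable_fun setT (fun om => `|N n om / s n - c|).
      apply: (measurableT_comp (@normr_measurable R setT)).
      by apply: measurable_funB => //; exact: measurable_funM.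
    have := measurable_fun_ltr (measurable_cst eps) mZ.
    by move=> /(_ measurableT [set true]); rewrite setTI => H; exact: H.
  - exact: measurableU.
  move=> om /= Hom; apply: contrapT => /not_orP[/negP nA1 /negP nA2].
  move: Hom; apply/negP; rewrite -leNgt.
  move: nA1 nA2; rewrite -!ltNge => nA1 nA2.
  have ->: N n om / s n - c = (N n om - NB n om) / s n +
      ((NB n om - eB n) / s n + (eB n / s n - c)) by ring.
  have D1 : `|(N n om - NB n om) / s n| <= eps / 3.
    by rewrite ger0_norm ?divr_ge0 ?(ltW sn)// ler_pdivrMr// mulrC ltW.
  have D2 : `|(NB n om - eB n) / s n| <= eps / 3.
    by rewrite normrM [X in _ * X]gtr0_norm ?invr_gt0// ler_pdivrMr// mulrC ltW.
  have D3 : `|eB n / s n - c| <= eps / 3 by rewrite distrC ltW.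
  rewrite (le_trans (ler_normD _ _))//.
  have D4 := ler_normD ((NB n om - eB n) / s n) (eB n / s n - c).
  lra.
apply: (le_trans (measureU2 _ mA1 mA2)).
rewrite /u EFinD leeD//.
  apply: (le_trans (markov_ge0 (P := P n) mA1 mD D0 tn _)) => //.
  rewrite iD -EFinM lee_fin le_eqVlt; apply/orP; left; apply/eqP.
  by field; rewrite !gt_eqF.
apply: (le_trans (chebyshev_ge0 (P := P n) (mNB n) tn vn)).
rewrite lee_fin le_eqVlt; apply/orP; left; apply/eqP.
by field; rewrite !gt_eqF.
Unshelve. all: by end_near. Qed.

End Truncation.

(** * The truncated clique count *)

Lemma fine_mulEFin (R : realType) (c : R) (y : \bar R) : 0 < c -> fine (c%:E * y)%E = c * fine y.
Proof.
move=> c0; case: y => [x|/=|/=] //.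
  by rewrite gt0_muley// mulr0.
by rewrite gt0_muleNy// mulr0.
Qed.

Section CliqueCount.
Context {R : realType}.
Variables (tau w0 g : R) (d n : nat) (disp : measure_display)
  (Omega : measurableType disp) (P : probability Omega R)
  (G : girg tau w0 g d n P).
Hypotheses (tau2 : 2 < tau) (w00 : 0 < w0).
Variable k : nat.

Definition clique_count (B : set R) : Omega -> R :=
  event_count (fun K : {set 'I_n} => #|K| == k) (fun K => clique_event G K B).

(** The mean of [clique_count B]: the number of k-subsets times the clique
    probability of each. *)
Definition clique_mean (B : set R) : R :=
  'C(n, k)%:R * (pareto_const tau w0 ^+ k *
    fine (weight_integral tau w0 g d k (n%:R * pareto_mean tau w0) B)).

Lemma nb_cliquesE om : (nb_cliques k (adj G om))%:R = clique_count setT om :> R.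
Proof.
rewrite /nb_cliques -sum1_card natr_sum /clique_count /event_count big_mkcond [RHS]big_mkcond/=.
have E (Q : pred {set 'I_n}) K : (K \in in_set [set K0 | Q K0]) = Q K.
  exact: asboolb.
apply: eq_bigr => K _; rewrite E; case: ifP => [/andP[-> cK]|/negbT ncK].
  rewrite indicE mem_set//; split => // e; rewrite inE => /and3P[e1 e2 e12].
  move/forall_inP : cK => /(_ _ e1)/forall_inP/(_ _ e2)/implyP; apply.
  by apply: contraTneq e12 => ->; rewrite ltnn.
case: ifP => // cK; rewrite indicE memNset// => -[_ adjK].
apply: (negP ncK); rewrite cK/=; apply/forall_inP => u uK; apply/forall_inP => v vK.
apply/implyP => uv; case: (ltngtP u v) => [lt|lt|/val_inj uvE].
- by apply: (adjK (u, v)); rewrite inE uK vK.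
- by rewrite adj_sym; apply: (adjK (v, u)); rewrite inE uK vK.
- by rewrite uvE eqxx in uv.
Qed.

Lemma measurable_clique_event K B : measurable B -> measurable (clique_event G K B).
Proof. exact: measurable_edges_event. Qed.

Lemma measurable_clique_count B : measurable B ->
  measurable_fun setT (clique_count B).
Proof. by move=> mB; apply: measurable_event_count => K; exact: measurable_clique_event. Qed.

Lemma clique_count_le B om : 0 <= clique_count B om <= clique_count setT om.
Proof.
rewrite event_count_ge0/=; apply: ler_sum => K _; rewrite !indicE ler_nat.
have [/set_mem[_ H]|//] := boolP (om \in clique_event G K B).
by rewrite mem_set.
Qed.

Lemma prob_clique_fine K B : measurable B -> P (clique_event G K B) = (fine (P (clique_event G K B)))%:E.
Proof. by move=> mB; rewrite fineK// fin_num_measure//; exact: measurable_clique_event. Qed.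

Lemma clique_meanE B : measurable B ->
  event_mean (fun K : {set 'I_n} => #|K| == k) (fun K => fine (P (clique_event G K B))) =
  clique_mean B.
Proof.
move=> mB; rewrite /event_mean.
rewrite (eq_bigr (fun=> fine (clique_prob g d n tau2 w00 B k))); last first.
  by move=> K /eqP Kk; rewrite (prob_clique G tau2 w00)// Kk.
rewrite sumr_const /clique_mean.
rewrite -[n in 'C(n, k)]card_ord -card_draws -[LHS]mulr_natl; congr (_ * _).
  by congr _%:R; apply: eq_card => K; rewrite inE.
by rewrite clique_probE// fine_mulEFin// exprn_gt0// pareto_const_gt0.
Qed.

Lemma integral_clique_count B : measurable B ->
  (\int[P]_om (clique_count B om)%:E = (clique_mean B)%:E)%E.
Proof.
move=> mB; rewrite -clique_meanE//; apply: integral_event_count => K.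
  exact: measurable_clique_event.
exact: prob_clique_fine.
Qed.

Definition overlapping (K K' : {set 'I_n}) : bool := ~~ fintype.disjoint (mem K) (mem K').

(** Only pairs with a common vertex contribute, and n r >= 1/4 makes the last
    term of the geometric sum over the size of the union dominate. *)
Lemma clique_variance_le (B : set R) (A r : R) :
  measurable B -> 0 <= A -> 1 <= 4 * n%:R * r ->
  (forall K K' : {set 'I_n}, overlapping K K' ->
     (P (clique_event G K B `&` clique_event G K' B) <= (A * r ^+ #|K :|: K'|)%:E)%E) ->
  (\int[P]_om ((clique_count B om - clique_mean B) ^+ 2)%:E <=
   (A * (k.*2%:R * (4 * n%:R * r) ^+ k.*2.-1))%:E)%E.
Proof.
move=> mB A0 r1 ovl; rewrite -clique_meanE//.
have n0 : (0 < n)%N.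
  by case: posnP r1 => // ->; rewrite mulr0 mul0r ler10.
have r0 : 0 <= r by rewrite -(pmulr_rge0 (x := 4 * n%:R)) ?(le_trans ler01 r1)// mulr_gt0// ltr0n.
apply: (event_variance_le (D := overlapping)).
- by move=> K; exact: measurable_clique_event.
- by move=> K; exact: prob_clique_fine.
- move=> K K' /eqP Kk /eqP K'k; rewrite negbK => KK'.
  rewrite (prob_clique_disjoint G tau2 w00)// -!(prob_clique G tau2 w00)//.
  by rewrite EFinM -!prob_clique_fine.
apply: (@le_trans _ _ (A * \sum_(K : {set 'I_n} | #|K| == k)
    \sum_(K' : {set 'I_n} | (#|K'| == k) && overlapping K K') r ^+ #|K :|: K'|)%:E).
  rewrite mulr_sumr -sumEFin; apply: lee_sum => K _.
  rewrite mulr_sumr -sumEFin; apply: lee_sum => K' /andP[_ KK'].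
  exact: ovl.
rewrite lee_fin ler_wpM2l// (le_trans (sum_overlap_le _ _ r0))//.
apply: (@le_trans _ _ (\sum_(s < k.*2) (4 * n%:R * r) ^+ k.*2.-1)); last first.
  by rewrite sumr_const card_ord -[leLHS]mulr_natl.
apply: ler_sum => s _.
by rewrite ler_weXn2l// -ltnS (leq_trans (ltn_ord s))// leqSpred.
Qed.

End CliqueCount.

Section CliqueCountLimit.
Context {R : realType} (tau w0 g : R) (d k : nat) (disp : nat -> measure_display)
  (Omega : forall n, measurableType (disp n))
  (P : forall n, probability (Omega n) R)
  (G : forall n, girg tau w0 g d n (P n)).
Hypotheses (tau2 : 2 < tau) (w00 : 0 < w0).

(** A criterion for the convergence of the clique count: the truncation B must
    be mild enough to preserve the mean asymptotically, and severe enough for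
    the bound A r^|U| on overlapping pairs to be negligible with respect to the
    square of the norming s. *)
Lemma cvg_in_prob_cliques (B : nat -> set R) (s A r : nat -> R) (c : R) :
  (forall n, measurable (B n)) ->
  (\forall n \near \oo, 0 < s n) -> (\forall n \near \oo, 0 <= A n) ->
  (\forall n \near \oo, 1 <= 4 * n%:R * r n) ->
  (\forall n \near \oo, forall K K' : {set 'I_n}, overlapping K K' ->
     (P n (clique_event (G n) K (B n) `&` clique_event (G n) K' (B n)) <=
      (A n * r n ^+ #|K :|: K'|)%:E)%E) ->
  clique_mean tau w0 g d n k setT / s n @[n --> \oo] --> c ->
  clique_mean tau w0 g d n k (B n) / s n @[n --> \oo] --> c ->
  A n * (4 * n%:R * r n) ^+ k.*2.-1 / s n ^+ 2 @[n --> \oo] --> (0 : R) ->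
  cvg_in_prob P (fun n om => (nb_cliques k (adj (G n) om))%:R / s n) c.
Proof.
move=> mB s0 A0 r1 ovl cT cB v0.
rewrite (_ : (fun n om => _) = fun n om => clique_count (G n) k setT om / s n); last first.
  by apply: functional_extensionality_dep => n; apply/funext => om; rewrite nb_cliquesE.
apply: (cvg_in_prob_truncation (NB := fun n => clique_count (G n) k (B n))
  (v := fun n => A n * (k.*2%:R * (4 * n%:R * r n) ^+ k.*2.-1))
  _ _ _ _ _ _ s0 cT cB) => [n|n|n om|n|n||].
- exact: measurable_clique_count.
- exact: measurable_clique_count.
- exact: clique_count_le.
- exact: integral_clique_count.
- exact: integral_clique_count.
- near=> n; apply: clique_variance_le => //; by near: n.
have -> : (0 : R) = k.*2%:R * 0 by rewrite mulr0.
rewrite (_ : (fun n => _) = fun n => k.*2%:R *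
    (A n * (4 * n%:R * r n) ^+ k.*2.-1 / s n ^+ 2)); last first.
  by apply/funext => n; rewrite (mulrCA (A n)) -[LHS]mulrA.
exact: cvgMr v0.
Unshelve. all: by end_near. Qed.

End CliqueCountLimit.

(** * Asymptotics of the means *)

Section Asymptotics.
Context {R : realType}.
Implicit Types (b : R^nat).

Lemma cvg_powR_infty b (e : R) : b @ \oo --> +oo -> 0 < e -> b n `^ e @[n --> \oo] --> +oo.
Proof.
move=> boo e0; apply/cvgryPge => A; near=> n.
have bA : `|A| `^ e^-1 <= b n.
  by near: n; move/cvgryPge : boo; exact.
rewrite (le_trans (ler_norm A))// -[leLHS](powRr1 (normr_ge0 A)) -(mulVf (lt0r_neq0 e0)).
by rewrite powRrM ge0_ler_powR ?nnegrE ?powR_ge0 ?(le_trans _ bA) ?(ltW e0).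
Unshelve. all: by end_near. Qed.

Lemma cvg_powR_infty0 b (e : R) : b @ \oo --> +oo -> e < 0 ->
  b n `^ e @[n --> \oo] --> (0 : R).
Proof.
by move=> boo e0; exact: (cvg_comp b (fun x => x `^ e) boo (cvg_powR_pinfty0 e0)).
Qed.

Lemma cvg_bin_exp k : 'C(n, k)%:R / n%:R ^+ k @[n --> \oo] --> (k`!%:R^-1 : R).
Proof.
suff H : (n ^_ k)%:R / n%:R ^+ k @[n --> \oo] --> (1 : R).
  rewrite (_ : (fun n => _) = fun n => k`!%:R^-1 * ((n ^_ k)%:R / n%:R ^+ k : R)); last first.
    have kf : k`!%:R != 0 :> R by rewrite pnatr_eq0 -lt0n fact_gt0.
    by apply/funext => n; rewrite -bin_ffact natrM mulrAC mulrCA mulVf// mulr1.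
  rewrite -[X in _ --> X]mulr1; exact: cvgMr H.
elim: k => [|k IH].
  under eq_fun do rewrite ffactn0 expr0 divr1.
  exact: cvg_cst.
have H : 1 - k%:R * n%:R^-1 @[n --> \oo] --> (1 : R).
  rewrite -[X in _ --> X]subr0 -(mulr0 k%:R).
  apply: cvgB; first exact: cvg_cst.
  apply: cvgMr.
  have n0 : \forall n \near \oo, 0 < (n%:R : R).
    by apply: filterS (nbhs_infty_gt 0) => n; rewrite /= ltr0n.
  exact: ((gtr0_cvgV0 n0).2 cvgr_idn).
have := cvgM IH H; rewrite mulr1 => HH; apply: (cvg_trans _ (HH _)); apply: near_eq_cvg; near=> n.
have kn : (k < n)%N by near: n; exact: nbhs_infty_gt.
have n0 : n%:R != 0 :> R by rewrite pnatr_eq0 -lt0n (leq_ltn_trans _ kn).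
rewrite /= ffactnSr natrM natrB ?(ltnW kn)// exprSr.
have nk : n%:R ^+ k != 0 :> R by rewrite expf_neq0.
by move: (n%:R ^+ k) nk (n ^_ k)%:R => x x0 y; field; rewrite n0 x0.
Unshelve. all: by end_near. Qed.

Lemma J_NG_ge0 (tau g : R) d k : (0 <= J_NG tau g d k)%E.
Proof.
rewrite J_NGE; apply: integral_ge0 => y _.
by rewrite mule_ge0 ?pow_weight_ge0 ?torus_clique_ge0.
Qed.

Lemma J_G_ge0 (tau w0 g : R) d k : (0 <= J_G tau w0 g d k.+1)%E.
Proof.
rewrite J_GE; apply: integral_ge0 => y _.
by rewrite mule_ge0 ?pow_weight_ge0 ?space_clique_ge0.
Qed.

End Asymptotics.

Section Scaling.
Context {R : realType} (tau w0 g : R) (d : nat).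
Hypotheses (tau23 : 2 < tau < 3) (w00 : 0 < w0) (g1 : 1 < g) (d0 : (0 < d)%N).

Local Notation mu := (pareto_mean tau w0).

(** This is n mu, kept positive at n = 0. *)
Definition scale (n : nat) : R := (maxn n 1)%:R * mu.

Let tau2 : 2 < tau. Proof. by case/andP: tau23. Qed.

Lemma scale_gt0 n : 0 < scale n.
Proof. by rewrite mulr_gt0 ?pareto_mean_gt0// ltr0n leq_max orbT. Qed.

Lemma scaleE n : (0 < n)%N -> scale n = n%:R * mu.
Proof. by move=> n0; rewrite /scale (maxn_idPl n0). Qed.

Lemma cvg_scale : scale @ \oo --> +oo.
Proof.
have m0 := pareto_mean_gt0 tau2 w00.
apply/cvgryPge => A; near=> n.
rewrite -ler_pdivrMr// (@le_trans _ _ n%:R)//; last by rewrite ler_nat leq_maxl.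
by near: n; exact: nbhs_infty_ger.
Unshelve. all: by end_near. Qed.

Lemma cvg_sqrt_scale : (Num.sqrt (scale n)) @[n --> \oo] --> +oo.
Proof.
rewrite (_ : (fun n => _) = fun n => scale n `^ 2^-1).
  by apply: (cvg_powR_infty cvg_scale); rewrite invr_gt0.
by apply/funext => n; rewrite powR12_sqrt// ltW// scale_gt0.
Qed.

Lemma cvg_clique_mean_geometric k (B : nat -> set R) :
  (3 - tau) * k.+1%:R < 2 -> (forall n, measurable (B n)) ->
  (forall w, w0 <= w -> \forall n \near \oo, B n w) ->
  (J_G tau w0 g d k.+1 < +oo)%E /\
  clique_mean tau w0 g d n k.+1 (B n) / n%:R @[n --> \oo] -->
    pareto_const tau w0 ^+ k.+1 *
      (fine (J_G tau w0 g d k.+1) / (mu ^+ k * k.+1`!%:R)).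
Proof.
move=> kt mB cB.
have [Jfin cJ] := geometric_limit g1 d0 tau23 w00 kt scale_gt0 cvg_scale mB cB.
split => //.
have Jf : (fine (J_G tau w0 g d k.+1))%:E = J_G tau w0 g d k.+1.
  by rewrite fineK// ge0_fin_numE// J_G_ge0.
move: cJ; rewrite -Jf => /fine_cvg cJ.
have c0 := pareto_const_gt0 tau2 w00.
have m0 := pareto_mean_gt0 tau2 w00.
have -> : pareto_const tau w0 ^+ k.+1 * (fine (J_G tau w0 g d k.+1) / (mu ^+ k * k.+1`!%:R)) =
    (k.+1)`!%:R^-1 * ((pareto_const tau w0 ^+ k.+1 / mu ^+ k) * fine (J_G tau w0 g d k.+1)).
  by rewrite invfM; ring.
have := cvgM (@cvg_bin_exp R k.+1) (cvgM (cvg_cst (pareto_const tau w0 ^+ k.+1 / mu ^+ k)) cJ) => HH.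
apply: (cvg_trans _ (HH _ _ _)); apply: near_eq_cvg; near=> n.
have n0 : (0 < n)%N by near: n; exact: nbhs_infty_gt.
rewrite /= /clique_mean fine_mulEFin ?exprn_gt0 ?scale_gt0// scaleE//.
move: (fine _) => x; rewrite exprSr.
have -> : (n%:R * mu) ^+ k = n%:R ^+ k * mu ^+ k by rewrite exprMn.
have nR : n%:R != 0 :> R by rewrite pnatr_eq0 -lt0n.
have nk : n%:R ^+ k != 0 :> R by rewrite expf_neq0.
have mk : mu ^+ k != 0 by rewrite expf_neq0// gt_eqF.
move: (n%:R ^+ k) nk (mu ^+ k) mk =>  u u0 v v0.
by field; rewrite nR u0 v0.
Unshelve. all: by end_near. Qed.

Lemma cvg_clique_mean_nongeometric k (B : nat -> set R) :
  (0 < k)%N -> 2 < (3 - tau) * k%:R -> (forall n, measurable (B n)) ->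
  (forall y, 0 < y -> \forall n \near \oo, B n (Num.sqrt (scale n) * y)) ->
  (J_NG tau g d k < +oo)%E /\
  clique_mean tau w0 g d n k (B n) / n%:R `^ ((3 - tau) * k%:R / 2) @[n --> \oo] -->
    pareto_const tau w0 ^+ k *
      (fine (J_NG tau g d k) / (mu `^ ((tau - 1) * k%:R / 2) * k`!%:R)).
Proof.
move=> k0 kt mB cB.
have b0 n : 0 < Num.sqrt (scale n) by rewrite sqrtr_gt0 scale_gt0.
have [Jfin cJ] := nongeometric_limit g1 d0 tau23 w00 k0 kt b0 cvg_sqrt_scale mB cB.
split => //.
have Jf : (fine (J_NG tau g d k))%:E = J_NG tau g d k.
  by rewrite fineK// ge0_fin_numE// J_NG_ge0.
move: cJ; rewrite -Jf => /fine_cvg cJ.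
have c0 := pareto_const_gt0 tau2 w00.
have m0 := pareto_mean_gt0 tau2 w00.
set M := mu `^ _.
have M0 : M != 0 by rewrite gt_eqF// powR_gt0.
have -> : pareto_const tau w0 ^+ k * (fine (J_NG tau g d k) / (M * k`!%:R)) =
    k`!%:R^-1 * ((pareto_const tau w0 ^+ k / M) * fine (J_NG tau g d k)).
  by rewrite invfM; ring.
have := cvgM (@cvg_bin_exp R k) (cvgM (cvg_cst (pareto_const tau w0 ^+ k / M)) cJ) => HH.
apply: (cvg_trans _ (HH _ _ _)); apply: near_eq_cvg; near=> n.
have n0 : (0 < n)%N by near: n; exact: nbhs_infty_gt.
have nR : 0 < n%:R :> R by rewrite ltr0n.
rewrite /= /clique_mean sqr_sqrtr ?(ltW (scale_gt0 _))// scaleE//.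
rewrite fine_mulEFin; last by rewrite exprn_gt0// powR_gt0// sqrtr_gt0 (mulr_gt0 nR m0).
move: (fine _) => x.
have nm0 : 0 <= n%:R * mu := mulr_ge0 (ltW nR) (ltW m0).
have -> : (Num.sqrt (n%:R * mu) `^ (tau - 1)) ^+ k =
    n%:R `^ ((tau - 1) * k%:R / 2) * M.
  rewrite -(powR12_sqrt nm0) -powRrM -powR_mulrn ?powR_ge0// -powRrM.
  by rewrite powRM ?(ltW nR) ?(ltW m0)//; congr (_ `^ _ * _ `^ _); ring.
have -> : n%:R ^+ k = n%:R `^ ((3 - tau) * k%:R / 2) * n%:R `^ ((tau - 1) * k%:R / 2) :> R.
  rewrite -powRD ?(gt_eqF nR) ?implybT// -powR_mulrn ?ltW//; congr (_ `^ _).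
  by field.
have u0 : n%:R `^ ((3 - tau) * k%:R / 2) != 0 :> R by rewrite gt_eqF// powR_gt0.
have v0 : n%:R `^ ((tau - 1) * k%:R / 2) != 0 :> R by rewrite gt_eqF// powR_gt0.
move: (n%:R `^ ((3 - tau) * k%:R / 2)) u0 => u u0.
move: (n%:R `^ ((tau - 1) * k%:R / 2)) v0 => v v0.
by field; rewrite u0 M0 v0.
Unshelve. all: by end_near. Qed.

End Scaling.

(** * Choice of the truncations *)

Section Convergence.
Context {R : realType} (tau w0 g : R) (d : nat) (disp : nat -> measure_display)
  (Omega : forall n, measurableType (disp n))
  (P : forall n, probability (Omega n) R)
  (G : forall n, girg tau w0 g d n (P n)).
Hypotheses (tau23 : 2 < tau < 3) (w00 : 0 < w0) (g1 : 1 < g) (d0 : (0 < d)%N).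

Local Notation mu := (pareto_mean tau w0).
Local Notation sc := (scale tau w0).

Let tau2 : 2 < tau. Proof. by case/andP: tau23. Qed.
Let tau3 : tau < 3. Proof. by case/andP: tau23. Qed.

Lemma near_gt0 : \forall n \near \oo, (0 < n)%N.
Proof. exact: nbhs_infty_gt. Qed.

Lemma near_le_scale_powR (c e : R) : 0 < e ->
  \forall n \near \oo, c <= sc n `^ e.
Proof.
move=> e0; have /cvgryPge := cvg_powR_infty (cvg_scale tau23 w00) e0.
by move/(_ c).
Qed.

Lemma cvg_scale_powR0 (c e : R) : e < 0 -> c * sc n `^ e @[n --> \oo] --> (0 : R).
Proof.
move=> e0; rewrite -(mulr0 c).
by apply: cvgMr; exact: (cvg_powR_infty0 (cvg_scale tau23 w00)).
Qed.

Lemma near_natE : \forall n \near \oo, n%:R = sc n / mu.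
Proof.
apply: filterS near_gt0 => n n0.
by rewrite scaleE// mulfK// gt_eqF// pareto_mean_gt0.
Qed.

(** Truncate at weight at most L = (n mu)^(1/(4k)). The star bound then gives
    pairs of overlapping cliques a total weight of order n L^(4k-4), which is
    n^(2-1/k) and hence negligible with respect to n^2. *)
Lemma cliques_geometric j : (3 - tau) * j.+1%:R < 2 ->
  (J_G tau w0 g d j.+1 < +oo)%E /\
  cvg_in_prob P (fun n om => (nb_cliques j.+1 (adj (G n) om))%:R / n%:R)
    (pareto_const tau w0 ^+ j.+1 *
      (fine (J_G tau w0 g d j.+1) / (mu ^+ j * j.+1`!%:R))).
Proof.
move=> jt.
have m0 := pareto_mean_gt0 tau2 w00.
have [Jfin cT] := cvg_clique_mean_geometric tau23 w00 g1 d0 (B := fun=> setT) jt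
  (fun _ => measurableT) (fun w _ => nearW _ (fun _ => I)).
split => //.
have sc0 n : 0 < sc n := scale_gt0 tau23 w00 n.
(* adding 1 keeps D positive, so that the ratio r of the star bound can be inverted *)
pose D := conn_const g d + 1.
have D0 : 0 < D by rewrite ltr_wpDl// conn_const_ge0.
pose l : R := (4 * j.+1%:R)^-1.
have l0 : 0 < l by rewrite invr_gt0 mulr_gt0.
pose L n := sc n `^ l.
have LE n : L n ^+ 2 = sc n `^ (l * 2).
  by rewrite -powR_mulrn ?powR_ge0// -powRrM.
pose r n := D * (L n ^+ 2 / sc n).
have L0 n : 0 < L n by rewrite powR_gt0.
have r0 n : 0 < r n by rewrite mulr_gt0// divr_gt0// exprn_gt0.
have rE : \forall n \near \oo, 4 * n%:R * r n = 4 * D / mu * sc n `^ (l * 2).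
  apply: filterS near_natE => n ->; rewrite /r LE.
  by field; rewrite (gt_eqF (sc0 n)) (gt_eqF m0).
have mB n : measurable (`]0, L n]%classic : set R) by exact: measurable_itv.
have nB w : w0 <= w -> \forall n \near \oo, `]0, L n]%classic w.
  move=> w0w; apply: filterS (near_le_scale_powR w l0) => n wL.
  by rewrite /= in_itv/= (lt_le_trans w00 w0w).
have [_ cB] := cvg_clique_mean_geometric tau23 w00 g1 d0 jt mB nB.
(* the star has one edge less than it has vertices, hence the factor A = 1/r *)
apply: (cvg_in_prob_cliques tau2 w00 (A := fun n => (r n)^-1) (r := r) mB) => //.
- by apply: filterS near_gt0 => n n0; rewrite ltr0n.
- by apply: nearW => n; rewrite invr_ge0 ltW.
- have l20 : 0 < l * 2 by rewrite mulr_gt0.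
  have c0 : 0 < 4 * D / mu by rewrite divr_gt0// mulr_gt0.
  apply: filterS2 rE (near_le_scale_powR (4 * D / mu)^-1 l20) => n -> H.
  by rewrite mulrC -ler_pdivrMr// div1r.
- apply: filterS near_gt0 => n n0 K K' /pred0Pn[u /andP[/= uK uK']].
  have U0 : (0 < #|K :|: K'|)%N.
    by rewrite card_gt0; apply/set0Pn; exists u; rewrite finset.in_setU uK.
  apply: (le_trans (prob_overlap_star (G n) tau2 w00 (L n) g1 d0 n0 uK uK')).
  have -> : (r n)^-1 * r n ^+ #|K :|: K'| = r n ^+ #|K :|: K'|.-1.
    by rewrite -[in LHS](prednK U0) exprS mulKf// gt_eqF.
  rewrite lee_fin lerXn2r ?nnegrE ?(ltW (r0 n))//.
    by rewrite mulr_ge0 ?conn_const_ge0// divr_ge0 ?exprn_ge0 ?(ltW (L0 n))// -scaleE// ltW.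
  rewrite /r -scaleE// ler_wpM2r// ?lerDl//.
  by rewrite divr_ge0 ?exprn_ge0 ?(ltW (L0 n)) ?(ltW (sc0 n)).
have e0 : (l * 2) * j.*2%:R - 1 < 0.
  rewrite subr_lt0 /l -mulrA [_^-1 * _]mulrC ltr_pdivrMr ?mulr_gt0// mul1r.
  by rewrite -!natrM ltr_nat; lia.
apply: (cvg_trans _ (@cvg_scale_powR0 (4 * mu * (4 * D / mu) ^+ j.*2) _ e0)).
apply: near_eq_cvg; apply: filterS3 near_gt0 near_natE rE => n n0 nE rE.
rewrite doubleS/= exprS.
have -> : (r n)^-1 * (4 * n%:R * r n * (4 * n%:R * r n) ^+ j.*2) =
    4 * n%:R * (4 * D / mu * sc n `^ (l * 2)) ^+ j.*2.
  by rewrite -rE; move: (_ ^+ j.*2) => Y; field; rewrite gt_eqF.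
have -> : (sc n `^ (l * 2 * j.*2%:R - 1)) = (sc n `^ (l * 2)) ^+ j.*2 / sc n.
  rewrite powRD ?(gt_eqF (sc0 n)) ?implybT// powRN powRr1 ?ltW//.
  by rewrite -powR_mulrn ?powR_ge0// -powRrM.
rewrite [(_ * sc n `^ _) ^+ _]exprMn nE.
move: ((4 * D / mu) ^+ j.*2) ((sc n `^ (l * 2)) ^+ j.*2) => x y.
by field; rewrite (gt_eqF (sc0 n)) (gt_eqF m0).
Qed.

(** Keep only the weights above T = (n mu)^e with e slightly below 1/2: all
    weights y sqrt (n mu) with y > 0 are eventually kept. The number of kept
    vertices is then of order n^al with al slightly above (3 - tau)/2, and the
    number of overlapping pairs is at most of order n^(al (2k - 1)). For e
    close to 1/2 this is negligible with respect to n^((3 - tau) k). *)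
Lemma cliques_nongeometric k : (0 < k)%N -> 2 < (3 - tau) * k%:R ->
  (J_NG tau g d k < +oo)%E /\
  cvg_in_prob P (fun n om => (nb_cliques k (adj (G n) om))%:R
                    / n%:R `^ ((3 - tau) * k%:R / 2))
    (pareto_const tau w0 ^+ k *
      (fine (J_NG tau g d k) / (mu `^ ((tau - 1) * k%:R / 2) * k`!%:R))).
Proof.
move=> k0 kt.
have m0 := pareto_mean_gt0 tau2 w00.
have [Jfin cT] := cvg_clique_mean_nongeometric tau23 w00 g1 d0 (B := fun=> setT) k0 kt
  (fun _ => measurableT) (fun w _ => nearW _ (fun _ => I)).
split => //.
have sc0 n : 0 < sc n := scale_gt0 tau23 w00 n.
have h2 := tau2; have h3 := tau3.
have m1 : 1 <= k.*2.-1%:R :> R by rewrite ler1n; lia.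
have kE : k.*2.-1%:R = 2 * k%:R - 1 :> R.
  by rewrite -subn1 natrB ?double_gt0// -muln2 natrM mulrC.
(* chosen so that al * (2k - 1) - (3 - tau) * k equals - (3 - tau) / 4 *)
pose th : R := (3 - tau) / (2 * (tau - 1) * k.*2.-1%:R).
have D0 : 0 < 2 * (tau - 1) * k.*2.-1%:R by nra.
have th0 : 0 < th by rewrite divr_gt0//; lra.
have th1 : th < 1 by rewrite ltr_pdivrMr//; nra.
have thE : th * (tau - 1) * k.*2.-1%:R = (3 - tau) / 2.
  by rewrite /th; field; apply/andP; split; lra.
pose e := (1 - th) / 2.
have e0 : 0 < e by rewrite divr_gt0// subr_gt0.
pose T n := sc n `^ e.
have T0 n : 0 < T n by rewrite powR_gt0.
pose r n := (w0 / T n) `^ (tau - 1).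
pose al := 1 - e * (tau - 1).
have al0 : 0 < al by rewrite /al /e; nra.
pose C := 4 * w0 `^ (tau - 1) / mu.
have C0 : 0 < C by rewrite divr_gt0// mulr_gt0// powR_gt0.
have rE : \forall n \near \oo, 4 * n%:R * r n = C * sc n `^ al.
  apply: filterS near_natE => n ->.
  have -> : sc n `^ al = sc n * sc n `^ (- e * (tau - 1)).
    rewrite /al -mulNr powRD ?(gt_eqF (sc0 n)) ?implybT// powRr1//.
    exact: ltW (sc0 n).
  have -> : r n = w0 `^ (tau - 1) * sc n `^ (- e * (tau - 1)).
    by rewrite /r powRM ?invr_ge0 ?powR_ge0 ?(ltW w00)// /T -powRN -powRrM.
  by rewrite /C; field; rewrite (gt_eqF m0).
have mB n : measurable (`]T n, +oo[%classic : set R) by exact: measurable_itv.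
have nB y : 0 < y -> \forall n \near \oo, `]T n, +oo[%classic (Num.sqrt (sc n) * y).
  move=> y0; have e1 : 0 < 2^-1 - e by rewrite /e; lra.
  apply: filterS (near_le_scale_powR (y^-1 + 1) e1) => n yn.
  rewrite /= in_itv/= andbT -powR12_sqrt ?(ltW (sc0 n))//.
  have -> : sc n `^ 2^-1 = T n * sc n `^ (2^-1 - e).
    rewrite /T -powRD ?(gt_eqF (sc0 n)) ?implybT//; congr (_ `^ _); ring.
  rewrite -mulrA ltr_pMr// -ltr_pdivrMr// div1r (lt_le_trans _ yn)//.
  by rewrite ltrDl.
have [_ cB] := cvg_clique_mean_nongeometric tau23 w00 g1 d0 k0 kt mB nB.
apply: (cvg_in_prob_cliques tau2 w00 (A := fun n => 1) (r := r) mB) => //.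
- by apply: filterS near_gt0 => n n0; rewrite powR_gt0// ltr0n.
- by apply: nearW => n; rewrite ler01.
- apply: filterS2 rE (near_le_scale_powR C^-1 al0) => n -> H.
  by rewrite mulrC -ler_pdivrMr// div1r.
- apply: filterS (near_le_scale_powR w0 e0) => n wT K K' _.
  rewrite clique_eventI mul1r; apply: prob_edges_le_law => //.
    by move=> ee; exact: pairs_inU_ltn.
  exact: pareto_tail.
have ex0 : al * k.*2.-1%:R - (3 - tau) * k%:R < 0.
  rewrite /al /e; nra.
apply: (cvg_trans _ (@cvg_scale_powR0 (C ^+ k.*2.-1 * mu `^ ((3 - tau) * k%:R)) _ ex0)).
apply: near_eq_cvg; apply: filterS3 near_gt0 near_natE rE => n n0 nE rE.
rewrite rE nE mul1r [(C * _) ^+ _]exprMn.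
have -> : sc n `^ (al * k.*2.-1%:R - (3 - tau) * k%:R) =
    (sc n `^ al) ^+ k.*2.-1 / sc n `^ ((3 - tau) * k%:R).
  rewrite powRD ?(gt_eqF (sc0 n)) ?implybT// powRN; congr (_ / _).
  by rewrite powRrM powR_mulrn ?powR_ge0.
have -> : ((sc n / mu) `^ ((3 - tau) * k%:R / 2)) ^+ 2 =
    sc n `^ ((3 - tau) * k%:R) / mu `^ ((3 - tau) * k%:R).
  rewrite -powR_mulrn ?powR_ge0// -powRrM divfK// powRM ?invr_ge0 ?ltW//.
  by rewrite -powR_inv1 ?ltW// -powRrM mulN1r powRN.
rewrite invf_div; ring.
Qed.

End Convergence.

Theorem theorem2 (R : realType) (tau w0 g : R) (d k : nat)
  (htau : 2 < tau < 3) (hw0 : 0 < w0) (hg : 1 < g)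
  (hd : (1 <= d)%N) (hk : (2 <= k)%N)
  (disp : nat -> measure_display)
  (Omega : forall n, measurableType (disp n))
  (P : forall n, probability (Omega n) R)
  (G : forall n, girg tau w0 g d n (P n)) :
  (2 / (3 - tau) < k%:R ->
     (J_NG tau g d k < +oo)%E /\
     cvg_in_prob P
       (fun n om => (nb_cliques k (adj (G n) om))%:R
                    / n%:R `^ ((3 - tau) * k%:R / 2))
       (pareto_const tau w0 ^+ k *
          (fine (J_NG tau g d k) /
           (pareto_mean tau w0 `^ ((tau - 1) * k%:R / 2) * k`!%:R))))
  /\
  (k%:R < 2 / (3 - tau) ->
     (J_G tau w0 g d k < +oo)%E /\
     cvg_in_prob P
       (fun n om => (nb_cliques k (adj (G n) om))%:R / n%:R)
       (pareto_const tau w0 ^+ k *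
          (fine (J_G tau w0 g d k) /
           (pareto_mean tau w0 ^+ k.-1 * k`!%:R)))).
Proof.
have [tau2 tau3] := andP htau.
have tau30 : 0 < 3 - tau by rewrite subr_gt0.
split=> [kt|kt].
  apply: (cliques_nongeometric G htau hw0 hg hd) => //; first exact: ltnW.
  by rewrite mulrC -ltr_pdivrMr.
case: k hk kt => // j _ jt; apply: (cliques_geometric G htau hw0 hg hd).
by rewrite mulrC -ltr_pdivlMr.
Qed.
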